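(* Let $X$ be a Banach space with $n(X)>0$. If $\mathcal{K}_v(X)$ is an M-ideal in $\mathcal{L}_v(X)$, then (1) $\mathrm{Ext}(B_{\mathcal{L}_v(X)^*})\subseteq \overline{\{\lambda x^*\otimes x:(x^*,x)\in\Pi(X)\text{ and }\lambda\in\mathbb{T}\}}^{w^*}$, where $x^*\otimes x$ is the functional $T\mapsto x^*(Tx)$ on $\mathcal{L}_v(X)$; and (2) $\mathrm{Ext}(B_{\mathcal{K}_v(X)^*})\subseteq\{\lambda x^{**}\otimes x^*:(x^{**},x^* )\in\Pi(X^* )\text{ and }\lambda\in\mathbb{T}\}$, where $x^{**}\otimes x^*$ is the functional $K\mapsto x^{**}(K^*x^* )$ on $\mathcal{K}_v(X)$.
   Context: Banach spaces are over $\mathbb{K}=\mathbb{R}$ or $\mathbb{C}$; $B_X$ and $S_X$ denote the closed unit ball and the unit sphere of $X$; $\mathbb{T}$ is the set of scalars of modulus $1$; $\mathrm{Ext}(C)$ is the set of extreme points of a convex set $C$; $\overline{A}^{w^*}$ is the weak-$*$ closure. $\mathcal{L}(X)$ is the space of bounded linear operators on $X$ and $\mathcal{K}(X)$ its subspace of compact operators. Put $\Pi(X)=\{(x^*,x)\in S_{X^*}\times S_X: x^*(x)=1\}$ (so $\Pi(X^* )\subseteq S_{X^{**}}\times S_{X^*}$). The numerical radius of $T\in\mathcal{L}(X)$ is $v(T)=\sup\{|x^*(Tx)|:(x^*,x)\in\Pi(X)\}$, and the numerical index of $X$ is $n(X)=\inf\{v(T):T\in\mathcal{L}(X),\ \|T\|=1\}$.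 If $n(X)>0$, then $v$ is a norm on $\mathcal{L}(X)$ equivalent to the operator norm; $\mathcal{L}_v(X)$ and $\mathcal{K}_v(X)$ denote $\mathcal{L}(X)$ and $\mathcal{K}(X)$ equipped with the norm $v$. A closed subspace $J$ of a Banach space $Z$ is an M-ideal in $Z$ if $Z^*=J^*\oplus_1 J^\perp$, i.e. the annihilator $J^\perp$ is the kernel of a linear projection $P$ on $Z^*$ with $\|z^*\|=\|Pz^*\|+\|z^*-Pz^*\|$ for all $z^*\in Z^*$ (the range of $P$ then being identified isometrically with $J^*$). *)

(* Defs.v *)
From HB Require Import structures.
From mathcomp Require Import all_boot all_order all_algebra.
From mathcomp Require Import complex.
From mathcomp Require Import all_classical all_reals all_analysis.

Set Implicit Arguments.
Unset Strict Implicit.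
Unset Printing Implicit Defensive.

Import Order.TTheory GRing.Theory Num.Theory.
Import numFieldNormedType.Exports.

Local Open Scope classical_set_scope.
Local Open Scope ring_scope.

Variant real_or_complex : numFieldType -> Prop :=
| Real_scalars (R : realType) : real_or_complex R
| Complex_scalars (R : realType) : real_or_complex R[i].

(* Norms take their values in the scalar field K, as in the library; for
   K = C this means in the nonnegative reals of C. In the order of C, x <= y
   says that y - x is a nonnegative real, so a bounded nonempty set of reals of
   C has the same supremum and infimum there as in R. *)

(* A vector space V is paired with an explicit norm p : V -> K, because the
   same space of operators is used with the operator norm and with the
   numerical radius. *)
Section BoundedLinear.
Context (K : numFieldType) (V : lmodType K) (p : V -> K) (W : normedModType K).

Definition bounded_linear : {pred (V -> W)} :=
  [pred f | `[< linear f /\ exists M : K, forall x, `|f x| <= M * p x >] ].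

Record blin := Blin {
  blin_fun :> V -> W;
  blin_funP : blin_fun \in bounded_linear }.

Fact bounded_linear_submod : submod_closed bounded_linear.
Proof.
split=> [|a f g].
  apply/asboolP; split=> [b x y /=|].
    by rewrite scaler0 addr0.
  by exists 0 => x; rewrite normr0 mul0r.
move=> /asboolP[lf [M fM]] /asboolP[lg [N gN]]; apply/asboolP.
split=> [b x y|].
  rewrite -[LHS]/(a *: f (b *: x + y) + g (b *: x + y)).
  rewrite -[RHS]/(b *: (a *: f x + g x) + (a *: f y + g y)).
  by rewrite lf lg !scalerDr !scalerA (mulrC a b) addrACA.
exists (`|a| * M + N) => x.
rewrite -[leLHS]/(`|a *: f x + g x|) mulrDl -mulrA.
by rewrite (le_trans (ler_normD _ _))// lerD// normrZ ler_wpM2l.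
Qed.

HB.instance Definition _ :=
  GRing.isSubmodClosed.Build K (V -> W) bounded_linear bounded_linear_submod.
HB.instance Definition _ := [isSub for blin_fun].
HB.instance Definition _ := [Choice of blin by <:].
HB.instance Definition _ := [SubChoice_isSubLmodule of blin by <:].

Definition opnorm (f : blin) : K :=
  supremum 0 [set `|f x| | x in [set x | p x <= 1]].

End BoundedLinear.
Arguments bounded_linear {K V} p W.

Section Dual.
Context (K : numFieldType) (V : lmodType K) (p : V -> K).

Definition dual := blin p K^o.
HB.instance Definition _ := GRing.Lmodule.on dual.

Definition dual_norm (f : dual) : K := opnorm f.

Definition dual_ball : set dual := [set f | dual_norm f <= 1].

Definition wstar_dual :=
  initial_topology (fun f : dual => (f : V -> K^o) : {ptws V -> K^o}).
HB.instance Definition _ := Topological.on wstar_dual.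

Definition wstar_closure (A : set dual) : set dual :=
  closure (A : set wstar_dual).

(* The set Pi(V) of the pairs (f, x) in S_{V^*} x S_V with f x = 1. *)
Definition norming_pairs : set (dual * V) :=
  [set fx | [/\ dual_norm fx.1 = 1, p fx.2 = 1 & fx.1 fx.2 = 1] ].

Definition annihilator (J : set V) : set dual :=
  [set f | forall x, J x -> f x = 0].

Definition subspace_set (J : set V) : Prop :=
  J 0 /\ forall (a : K) x y, J x -> J y -> J (a *: x + y).

Definition norm_closed (J : set V) : Prop :=
  forall z, (forall e, 0 < e -> exists2 x, J x & p (z - x) < e) -> J z.

Definition M_ideal (J : set V) : Prop :=
  [/\ subspace_set J, norm_closed J &
      exists P : {linear dual -> dual},
        [/\ forall f, P (P f) = P f,
            [set f | P f = 0] = annihilator J &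
            forall f, dual_norm f = dual_norm (P f) + dual_norm (f - P f)] ].

End Dual.
Arguments dual_norm {K V} p.
Arguments dual_ball {K V} p.
Arguments norming_pairs {K V} p.
Arguments annihilator {K V} p.

Definition extreme_points (K : numFieldType) (V : lmodType K) (C : set V) :
    set V :=
  [set x | C x /\ forall (t : K) y z, C y -> C z -> 0 < t < 1 ->
     x = t *: y + (1 - t) *: z -> y = x /\ z = x].

Section Operators.
Context (K : numFieldType) (X : normedModType K).

Definition norm_of : X -> K := fun x => `|x|.

Definition operators := blin norm_of X.
HB.instance Definition _ := GRing.Lmodule.on operators.

Definition numerical_radius (T : operators) : K :=
  supremum 0 [set `|fx.1 (T fx.2)| | fx in norming_pairs norm_of].

Definition numerical_index : K :=
  infimum 0 [set numerical_radius T | T in [set T | opnorm T = 1] ].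

Definition compact_operator : {pred operators} :=
  [pred T : operators | `[< precompact (T @` [set x | `|x| <= 1]) >] ].

Record compact_operators := CompactOperator {
  compact_val :> operators;
  compact_valP : compact_val \in compact_operator }.

Fact compact_operator_submod : submod_closed compact_operator.
Proof.
have hX : hausdorff_space X by exact: norm_hausdorff.
split=> [|a S T].
  apply/asboolP.
  apply: (@precompact_subset _ _ [set 0]) => [_ [x _ <-]//|].
  rewrite precompactE -(closure_id _).1; first exact: compact_set1.
  exact/accessible_closed_set1/hausdorff_accessible.
move=> /asboolP; rewrite precompactE => cS /asboolP.
rewrite precompactE => cT; apply/asboolP.
pose g (u : X * X) : X := a *: u.1 + u.2.
have cg : continuous g.
  move=> u; apply: cvgD; last exact: cvg_snd.
  by apply: cvgZr; exact: cvg_fst.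
pose A := g @` (closure (S @` [set x | `|x| <= 1]) `*`
                closure (T @` [set x | `|x| <= 1])).
have cA : compact A.
  apply: continuous_compact; last exact: compact_setX.
  exact: continuous_subspaceT.
apply: (@precompact_subset _ _ A) => [_ [x x1 <-]|].
  by exists (S x, T x) => //; split; apply: subset_closure; exists x.
by rewrite precompact_closed//; exact: compact_closed.
Qed.

HB.instance Definition _ := GRing.isSubmodClosed.Build K operators
  compact_operator compact_operator_submod.
HB.instance Definition _ := [isSub for compact_val].
HB.instance Definition _ := [Choice of compact_operators by <:].
HB.instance Definition _ := [SubChoice_isSubLmodule of compact_operators by <:].

(* The norm of K_v(X). *)
Definition numerical_radius_compact (S : compact_operators) : K :=
  numerical_radius S.

Fact adjoint_subproof (T : operators) (f : dual norm_of) :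
  (f \o T : X -> K^o) \in bounded_linear norm_of K^o.
Proof.
case: T f => T /= /asboolP[lT [M TM]].
case=> f /= /asboolP[lf [N fN]].
apply/asboolP; split=> [a x y /=|]; first by rewrite lT lf.
exists (`|N| * M) => x /=; rewrite -mulrA.
apply: (le_trans (fN _)); apply: (@le_trans _ _ (`|N| * `|T x|)); last first.
  by rewrite ler_wpM2l.
rewrite /norm_of; have [->|Tx0] := eqVneq (T x) 0.
  by rewrite normr0 !mulr0.
have Tx : 0 < `|T x| by rewrite normr_gt0.
rewrite ler_pM2r//; have := le_trans (normr_ge0 _) (fN (T x)).
by rewrite pmulr_lge0// => N0; rewrite ger0_norm.
Qed.

Definition adjoint (T : operators) (f : dual norm_of) : dual norm_of :=
  Blin (adjoint_subproof T f).

End Operators.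
Arguments norm_of {K} X.
Arguments compact_operator {K} X.
Arguments numerical_radius {K} X.
Arguments numerical_radius_compact {K} X.
Arguments numerical_index {K} X.

(* Main.v *)
Require Import Defs.
From HB Require Import structures.
From mathcomp Require Import all_boot all_order all_algebra.
From mathcomp Require Import complex.
From mathcomp Require Import all_classical all_reals all_analysis.
From mathcomp Require Import ring lra.
Import Order.TTheory GRing.Theory Num.Theory.
Import numFieldNormedType.Exports.
Local Open Scope classical_set_scope.
Local Open Scope ring_scope.
Set Implicit Arguments.
Unset Strict Implicit.
Unset Printing Implicit Defensive.

(** Both parts start from the same form of Milman's theorem, [extreme_ultra]:
    if a family of functionals norms a space, every extreme point of the dual
    ball is a pointwise limit of the family along an ultrafilter. By
    definition of the numerical radius v, the functionals T |-> l f(Tx), with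
    |l| = 1 and (f, x) a norming pair, norm L_v(X) and also its subspace
    K_v(X). For L_v(X) this is part (1).

    For K_v(X) let l0, us and u be the limits along the ultrafilter of the
    scalars l_i, of the functionals f_i pointwise on X, and of the points x_i
    pointwise on the dual X'. Since a compact S maps (x_i) to a norm
    convergent family, the extreme functional is S |-> l0 u(S' us), with S'
    the adjoint of S ([compact_limit]). What must be shown is |u| = |us| = 1
    and |u(us)| = 1. The main point is the inequality |u| |us| <= re u(us) of
    [ideal_norming]. Once it is known, (u, us) is up to scaling a norming pair
    of X', so that |u(S' us)| <= |u| |us| v(S) ([adjoint_radius_le]), and
    extremality forces |u| |us| >= 1.

    The inequality comes from the M-ideal. Let P be the L-projection of the
    dual of L_v(X). By Hahn-Banach there are, for every compact C with v(C) <=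
    1 and every functional Phi, compact S for which v(C + 1 - S) is at most
    about 1 and re Phi(S) is at most about re (P Phi)(1) ([ideal_split]). Then
    the numerical range of A = C - S lies essentially in the left half-plane,
    and this makes 1 + t A a contraction up to O(t^2) ([step_norm]). For a
    vector w of X'' the drift (Gw)(f) = P(w (x) f)(1) - w(f) compares the
    values at 1 of the functional w (x) f : T |-> w(T' f) and of its image
    under P. It is almost zero on nearly norming pairs, so that |w + t G w| >=
    |w| for every real t ([drift_skew]).

    Let [reach c] be the supremum of re z(M' us) over the compact
    perturbations M of 1 with |M| <= c. Because (u, us) is a limit of norming
    pairs, [reach c] is at most re u(us) + c - 1 at u ([limit_pair_le]).
    Composing M with the operators 1 + t A compares the values of [reach] at z
    and at z + t (w - z - G z), for every w no longer than z ([reach_step]).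
    Without the drift this would say that a subgradient of [reach] at z is at
    most its value at z on all w no longer than z, so that [reach] is a
    multiple of the norm, and the inequality would follow by comparing u with
    a vector z where re z(us) is nearly |z| |us|. The drift is removed by
    averaging along its flow: as G is skew, the flow nearly preserves norms
    over long times, and the averaged functional does have nearly radial
    subgradients ([flow_average_support]), hence is nearly constant on the
    unit sphere ([radial_drift]). This is [flow_norming]. *)

(** * Sublinear functionals and the Hahn-Banach theorem *)

Section HahnBanach.
Context (R : realType).

Definition rlinear (E : lmodType R) (f : E -> R) :=
  forall t x y, f (t *: x + y) = t * f x + f y.

Definition sublinear (E : lmodType R) (q : E -> R) :=
  (forall x y, q (x + y) <= q x + q y) /\
  (forall t x, 0 <= t -> q (t *: x) = t * q x).

Section Rlinear.
Context (E : lmodType R) (f : E -> R) (hf : rlinear f).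

Lemma rlinear0 : f 0 = 0.
Proof.
by have := hf 1 0 0; rewrite scale1r addr0 mul1r; lra.
Qed.

Lemma rlinearZ t x : f (t *: x) = t * f x.
Proof. by have := hf t x 0; rewrite rlinear0 !addr0. Qed.

Lemma rlinearD x y : f (x + y) = f x + f y.
Proof. by have := hf 1 x y; rewrite scale1r mul1r. Qed.

Lemma rlinearN x : f (- x) = - f x.
Proof. by rewrite -scaleN1r rlinearZ mulN1r. Qed.

Lemma rlinearB x y : f (x - y) = f x - f y.
Proof. by rewrite rlinearD rlinearN. Qed.
End Rlinear.

Section Sublinear.
Context (E : lmodType R) (q : E -> R) (hq : sublinear q).

Lemma sublinear0 : q 0 = 0.
Proof. by have := hq.2 0 0 (lexx _); rewrite scale0r mul0r. Qed.

Lemma sublinearD x y : q (x + y) <= q x + q y.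
Proof. exact: hq.1. Qed.

Lemma sublinearZ t x : 0 <= t -> q (t *: x) = t * q x.
Proof. exact: hq.2. Qed.

Lemma sublinear_oppl x : - q (- x) <= q x.
Proof. by have := sublinearD x (- x); rewrite subrr sublinear0; lra. Qed.

Lemma sublinearB x y : q x - q y <= q (x - y).
Proof. by have := sublinearD (x - y) y; rewrite subrK; lra. Qed.
End Sublinear.

(** The function [p x] is the infimum of [q (x + z) - s] over [(z, s)] in the
    cone [S]. It turns lower bounds into an upper one: a linear [f <= p]
    satisfies [f <= q] and, by oddness, [s <= f z] on [S]. *)
Lemma infconv (E : lmodType R) (q : E -> R) (S : set (E * R)) :
  sublinear q -> S (0, 0) ->
  (forall a b, S a -> S b -> S (a.1 + b.1, a.2 + b.2)) ->
  (forall t a, 0 <= t -> S a -> S (t *: a.1, t * a.2)) ->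
  (forall a, S a -> a.2 <= q a.1) ->
  exists p : E -> R, [/\ sublinear p, forall x, p x <= q x &
    forall a, S a -> p (- a.1) <= - a.2].
Proof.
move=> hq S0 SD SZ Sq.
pose V x := [set q (x + a.1) - a.2 | a in S].
have Vn x : V x !=set0 by exists (q (x + 0) - 0), (0, 0).
have Vlb x : lbound (V x) (- q (- x)).
  move=> _ [a Sa <-]; have := Sq _ Sa.
  have := sublinearB hq a.1 (- x); rewrite opprK addrC.
  by rewrite addrC [_ + x]addrC; lra.
have hV x : has_lbound (V x) by exists (- q (- x)).
exists (fun x => inf (V x)); split; first split.
- move=> x y; apply/ler_addgt0Pr => e e0.
  have e2 : 0 < e / 2 by lra.
  have [_ [a Sa <-] ha] := inf_adherent e2 (conj (Vn x) (hV x)).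
  have [_ [b Sb <-] hb] := inf_adherent e2 (conj (Vn y) (hV y)).
  have Vab : V (x + y) (q (x + y + (a.1 + b.1)) - (a.2 + b.2)).
    by exists (a.1 + b.1, a.2 + b.2) => //; exact: SD.
  have := ge_inf (hV _) Vab.
  have := sublinearD hq (x + a.1) (y + b.1).
  rewrite addrACA; lra.
- move=> t x; rewrite le_eqVlt => /predU1P[<-|t0].
    rewrite mul0r scale0r; apply/eqP; rewrite eq_le; apply/andP; split.
      have V0 : V 0 (q (0 + 0) - 0) by exists (0, 0).
      by have := ge_inf (hV _) V0; rewrite addr0 (sublinear0 hq) subr0.
    apply: lb_le_inf => // _ [a Sa <-]; rewrite add0r.
    by have := Sq _ Sa; lra.
  have key s y : 0 < s -> inf (V (s *: y)) <= s * inf (V y).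
    move=> s0; rewrite -ler_pdivrMl//; apply: lb_le_inf => // _ [a Sa <-].
    rewrite ler_pdivrMl// mulrBr -(sublinearZ hq _ (ltW s0)) scalerDr.
    apply: ge_inf => //; exists (s *: a.1, s * a.2) => //.
    exact: SZ (ltW s0) Sa.
  apply/eqP; rewrite eq_le key//= -ler_pdivlMl//.
  have := key t^-1 (t *: x); rewrite invr_gt0 => /(_ t0).
  by rewrite scalerA mulVf ?scale1r// gt_eqF.
- move=> x; have Vx : V x (q (x + 0) - 0) by exists (0, 0).
  by have := ge_inf (hV _) Vx; rewrite addr0 subr0.
- move=> a Sa; have : V (- a.1) (q (- a.1 + a.1) - a.2) by exists a.
  by move=> /(ge_inf (hV _)); rewrite addNr (sublinear0 hq) sub0r.
Qed.

(** For the ray of the points [(t *: x, t * p x)], [infconv] gives a sublinear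
    [g <= p] with [g (- x) <= - p x]. By minimality [p (- x) <= - p x], and an odd
    sublinear function is linear. *)
Lemma sublinear_minimal_rlinear (E : lmodType R) (p : E -> R) :
  sublinear p ->
  (forall g, sublinear g -> (forall x, g x <= p x) -> forall x, p x <= g x) ->
  rlinear p.
Proof.
move=> hp pmin.
have podd x : p (- x) = - p x.
  apply/eqP; rewrite eq_le; apply/andP; split; last first.
    by have := sublinear_oppl hp x; lra.
  pose S : set (E * R) := [set a | exists2 t, 0 <= t & a = (t *: x, t * p x)].
  have [||||g [hg gp gS]] := @infconv E p S hp.
  - by exists 0; rewrite // scale0r mul0r.
  - move=> _ _ [s s0 ->] [t t0 ->] /=; exists (s + t); first exact: addr_ge0.
    by rewrite scalerDl mulrDl.
  - move=> t _ t0 [s s0 ->] /=; exists (t * s); first exact: mulr_ge0.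
    by rewrite scalerA mulrA.
  - by move=> _ [t t0 ->] /=; rewrite sublinearZ.
  apply: le_trans (pmin _ hg gp _) _.
  have : S (x, p x) by exists 1; rewrite // scale1r mul1r.
  by move=> /gS.
have pZ t x : p (t *: x) = t * p x.
  have [t0|t0] := leP 0 t; first exact: sublinearZ.
  by rewrite -[t]opprK scaleNr podd sublinearZ ?mulNr ?oppr_ge0// ltW.
move=> t x y; rewrite -pZ; apply/eqP; rewrite eq_le sublinearD//=.
have := sublinearD hp (- (t *: x)) (- y); rewrite -opprD !podd; lra.
Qed.

(** Zorn's lemma: the infimum of a chain of sublinear functions below [q] is
    sublinear, and it is finite because each of them is at least
    [fun x => - q (- x)]. *)
Lemma sublinear_minimal (E : lmodType R) (q : E -> R) : sublinear q ->
  exists2 p, rlinear p & forall x, p x <= q x.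
Proof.
move=> hq.
pose T := {g : E -> R | sublinear g /\ forall x, g x <= q x}.
pose r (g h : T) : bool := `[< forall x, sval h x <= sval g x >].
have [| | |A Atot|p pmax] := @Zorn T r.
- by move=> g; apply/asboolP.
- move=> f g h /asboolP fg /asboolP gh; apply/asboolP => x.
  exact: le_trans (gh x) (fg x).
- move=> [g hg] [h hh] /asboolP/= gh /asboolP/= hg'.
  apply: eq_exist => /=; apply/funext => x; apply/eqP.
  by rewrite eq_le hg' gh.
- have [A0|/set0P[g0 Ag0]] := eqVneq A set0.
    exists (exist _ q (conj hq (fun x => lexx _))) => g.
    by rewrite A0.
  pose V x := [set sval g x | g in A].
  have Vn x : V x !=set0 by exists (sval g0 x), g0.
  have hV x : has_lbound (V x).
    exists (- q (- x)) => _ [g Ag <-].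
    have [hg gq] := svalP g; have := sublinear_oppl hg x.
    by have := gq (- x); lra.
  have hp : sublinear (fun x => inf (V x)).
    split=> [x y|t x].
      apply/ler_addgt0Pr => e e0; have e2 : 0 < e / 2 by lra.
      have [_ [a Aa <-] ha] := inf_adherent e2 (conj (Vn x) (hV x)).
      have [_ [b Ab <-] hb] := inf_adherent e2 (conj (Vn y) (hV y)).
      have [c [Ac ca cb]] : exists c, [/\ A c, forall x, sval c x <= sval a x &
                                   forall x, sval c x <= sval b x].
        have [/asboolP ab|/asboolP ba] := Atot _ _ Aa Ab.
          by exists b; split.
        by exists a; split.
      have Vc : V (x + y) (sval c (x + y)) by exists c.
      have := ge_inf (hV _) Vc; have := sublinearD (svalP c).1 x y.
      by have := ca x; have := cb y; lra.
    rewrite le_eqVlt => /predU1P[<-|t0].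
      rewrite mul0r scale0r [V 0](_ : _ = [set 0]) ?inf1//.
      apply/seteqP; split=> [_ [g Ag <-]/=|_ ->].
        by rewrite (sublinear0 (svalP g).1).
      by exists g0 => //; rewrite (sublinear0 (svalP g0).1).
    have key s y : 0 < s -> inf (V (s *: y)) <= s * inf (V y).
      move=> s0; rewrite -ler_pdivrMl//; apply: lb_le_inf => // _ [a Sa <-].
      rewrite ler_pdivrMl// -(sublinearZ (svalP a).1 _ (ltW s0)).
      by apply: ge_inf => //; exists a.
    apply/eqP; rewrite eq_le key//= -ler_pdivlMl//.
    have := key t^-1 (t *: x); rewrite invr_gt0 => /(_ t0).
    by rewrite scalerA mulVf ?scale1r// gt_eqF.
  have pq x : inf (V x) <= q x.
    apply: le_trans ((svalP g0).2 x).
    by apply: ge_inf => //; exists g0.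
  exists (exist _ (fun x => inf (V x)) (conj hp pq)) => g Ag.
  by apply/asboolP => x /=; apply: ge_inf => //; exists g.
have [hp pq] := svalP p.
exists (sval p) => //; apply: sublinear_minimal_rlinear => // g hg gp x.
have gq y : g y <= q y by exact: le_trans (gp y) (pq y).
have := pmax (exist _ g (conj hg gq)) _.
by move=> <- //; apply/asboolP.
Qed.

(** The Mazur-Orlicz form of the Hahn-Banach theorem: a convex cone of lower
    bounds can be met by one linear functional below [q] as soon as [q] itself
    meets each of them. *)
Theorem hahn_banach (E : lmodType R) (q : E -> R) (S : set (E * R)) :
  sublinear q -> S (0, 0) ->
  (forall a b, S a -> S b -> S (a.1 + b.1, a.2 + b.2)) ->
  (forall t a, 0 <= t -> S a -> S (t *: a.1, t * a.2)) ->
  (forall a, S a -> a.2 <= q a.1) ->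
  exists f : E -> R, [/\ rlinear f, forall x, f x <= q x &
    forall a, S a -> a.2 <= f a.1].
Proof.
move=> hq S0 SD SZ Sq.
have [p [hp pq pS]] := infconv hq S0 SD SZ Sq.
have [f hf fp] := sublinear_minimal hp.
exists f; split=> // [x|a Sa]; first exact: le_trans (fp x) (pq x).
by have := le_trans (fp _) (pS _ Sa); rewrite rlinearN// lerN2.
Qed.

Lemma hahn_banach_support (E : lmodType R) (q : E -> R) (x : E) :
  sublinear q -> exists f : E -> R,
    [/\ rlinear f, forall x, f x <= q x & f x = q x].
Proof.
move=> hq.
pose S : set (E * R) := [set a | exists2 t, 0 <= t & a = (t *: x, t * q x)].
have [||||f [hf fq fS]] := @hahn_banach E q S hq.
- by exists 0; rewrite // scale0r mul0r.
- move=> _ _ [s s0 ->] [t t0 ->] /=; exists (s + t); first exact: addr_ge0.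
  by rewrite scalerDl mulrDl.
- move=> t _ t0 [s s0 ->] /=; exists (t * s); first exact: mulr_ge0.
  by rewrite scalerA mulrA.
- by move=> _ [t t0 ->] /=; rewrite sublinearZ.
exists f; split=> //; apply/eqP; rewrite eq_le fq/=.
have : S (x, q x) by exists 1; rewrite // scale1r mul1r.
by move=> /fS.
Qed.

End HahnBanach.

(** * Sublinear functionals with nearly radial subgradients *)

Section Seminorm.
Context (R : realType) (E : lmodType R) (N : E -> R).

Definition seminorm :=
  (forall x y, N (x + y) <= N x + N y) /\ (forall t x, N (t *: x) = `|t| * N x).

Hypothesis hN : seminorm.

Lemma seminormD x y : N (x + y) <= N x + N y. Proof. exact: hN.1. Qed.
Lemma seminormZ t x : N (t *: x) = `|t| * N x. Proof. exact: hN.2. Qed.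
Lemma seminorm0 : N 0 = 0.
Proof. by rewrite -(scale0r 0) seminormZ normr0 mul0r. Qed.
Lemma seminormN x : N (- x) = N x.
Proof. by rewrite -scaleN1r seminormZ normrN1 mul1r. Qed.
Lemma seminorm_ge0 x : 0 <= N x.
Proof. by have := seminormD x (- x); rewrite subrr seminorm0 seminormN; lra. Qed.
Lemma seminormB x y : N (x - y) <= N x + N y.
Proof. by rewrite -[N y]seminormN seminormD. Qed.
Lemma seminorm_ler_distD x y : N x - N y <= N (x - y).
Proof. by have := seminormD (x - y) y; rewrite subrK; lra. Qed.

(** If the subgradients of a sublinear [A] at unit vectors are bounded on the unit
    ball by nearly the value of [A], then [A] nearly factors through [N], hence
    it is nearly constant on the unit sphere. Along the segment from [a] to [b],
    cut into [n] steps [c k], the quotient [al k] of [A] by [N] would have zero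
    derivative if the subgradients were exactly [A x * N]. In the discrete
    version the supporting functional at [c k.+1] is evaluated at
    [c k = 2 c k.+1 - c k.+2], which bounds the increment of [al] by the second
    difference of [N] plus an error [5 eps]. The second differences are
    nonnegative, and their sum telescopes to [O(1 / n)]. *)
Lemma radial_drift (A : E -> R) (M eps nu : R) (n : nat) (a b : E) :
  sublinear A -> 0 <= M -> 0 <= eps -> 0 < nu -> (0 < n)%N ->
  (forall x, A x <= M * N x) ->
  (forall x, N x = 1 -> exists f : E -> R, [/\ rlinear f,
     forall y, f y <= A y, f x = A x &
     forall w, N w <= 1 -> f w <= A x + eps]) ->
  N a = 1 -> N b = 1 ->
  (forall t, 0 <= t <= 1 -> nu <= N (a + t *: (b - a))) ->
  A b <= A a + (4 * M / n%:R + 5 * n%:R * eps) / nu.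
Proof.
move=> hA M0 e0 nu0 n0 AM Asupp Na Nb hnu.
have n0' : 0 < n%:R :> R by rewrite ltr0n.
pose c (k : nat) := a + (k%:R / n%:R) *: (b - a).
have c0 : c 0%N = a by rewrite /c mul0r scale0r addr0.
have cn : c n = b by rewrite /c divff ?gt_eqF// scale1r addrC subrK.
have Nba : N (b - a) <= 2 by have := seminormB b a; rewrite Na Nb; lra.
have Nc k : (k <= n)%N -> nu <= N (c k).
  move=> kn; apply: hnu; rewrite divr_ge0//= ler_pdivrMr// mul1r.
  by rewrite ler_nat.
have cS k : c k.+1 = c k + n%:R^-1 *: (b - a).
  by rewrite /c -addrA -scalerDl -addn1 natrD mulrDl mul1r.
have c2 k : c k = 2 *: c k.+1 - c k.+2.
  rewrite [c k.+2]cS scaler_nat mulr2n opprD addrA addrK [c k.+1]cS addrK //.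
have Nstep k : N (c k.+1) - N (c k) <= 2 / n%:R.
  apply: le_trans (seminorm_ler_distD _ _) _.
  rewrite cS addrAC subrr add0r seminormZ gtr0_norm ?invr_gt0//.
  by rewrite mulrC ler_pM2r ?invr_gt0.
have Nstep' k : N (c k) - N (c k.+1) <= 2 / n%:R.
  apply: le_trans (seminorm_ler_distD _ _) _.
  rewrite cS opprD addrA subrr add0r seminormN seminormZ.
  by rewrite gtr0_norm ?invr_gt0// mulrC ler_pM2r ?invr_gt0.
(* The points used run up to [c n.+1], one step beyond [b]. *)
have Nbnd k : (k <= n.+1)%N -> N (c k) <= 5.
  move=> kn; apply: le_trans (seminormD _ _) _; rewrite Na seminormZ.
  rewrite ger0_norm ?divr_ge0//.
  suff : k%:R / n%:R * N (b - a) <= 2 * 2 :> R by lra.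
  apply: ler_pM; [exact: divr_ge0|exact: seminorm_ge0| |by []].
  rewrite ler_pdivrMr// -natrM ler_nat.
  by apply: leq_trans kn _; rewrite mul2n -addnn -addn1 leq_add2l.
have conv k : 0 <= N (c k) - 2 * N (c k.+1) + N (c k.+2).
  have := seminormD (c k) (c k.+2).
  rewrite [X in N (X + _)]c2 subrK seminormZ ger0_norm//; lra.
pose al k := A (c k) / N (c k).
have inc k : (k < n)%N -> al k.+1 <= al k +
    (M * (N (c k) - 2 * N (c k.+1) + N (c k.+2)) + 5 * eps) / nu.
  move=> kn; have Nk := Nc k (ltnW kn); have Nk1 := Nc k.+1 kn.
  have P k' : nu <= N (c k') -> 0 < N (c k') by apply: lt_le_trans.
  have Pk := P _ Nk; have Pk1 := P _ Nk1.
  have i0 : 0 <= (N (c k.+1))^-1 by rewrite invr_ge0 ltW.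
  have [|f [lf fA fx fw]] := Asupp ((N (c k.+1))^-1 *: c k.+1).
    by rewrite seminormZ gtr0_norm ?invr_gt0// mulVf ?gt_eqF.
  have fal : f (c k.+1) = al k.+1 * N (c k.+1).
    have := fx; rewrite (rlinearZ lf) (sublinearZ hA _ i0).
    move=> /(congr1 (fun z => N (c k.+1) * z)).
    by rewrite !mulVKf ?gt_eqF// /al => ->; rewrite divfK ?gt_eqF.
  have fw' w : f w <= (al k.+1 + eps) * N w.
    have fw1 w' : N w' <= 1 -> f w' <= al k.+1 + eps.
      move=> /fw; rewrite (sublinearZ hA _ i0).
      by rewrite mulrC.
    have /predU1P[Nw|Nw] : (N w == 0) || (0 < N w).
      by rewrite eq_sym -le_eqVlt seminorm_ge0.
      rewrite Nw mulr0; apply/ler_addgt0Pr => e e0'; rewrite add0r.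
      have h := fw1 (((`|al k.+1| + eps + 1) / e) *: w).
      have t0 : 0 < (`|al k.+1| + eps + 1) / e.
        by rewrite divr_gt0// ltr_wpDl// addr_ge0.
      have := h; rewrite seminormZ Nw mulr0 ler01 => /(_ isT).
      rewrite (rlinearZ lf) -ler_pdivlMl// => /le_trans; apply.
      rewrite ler_pdivrMl// divfK ?gt_eqF//.
      by have := ler_norm (al k.+1); lra.
    have := fw1 ((N w)^-1 *: w).
    rewrite seminormZ gtr0_norm ?invr_gt0// mulVf ?gt_eqF// lexx => /(_ isT).
    by rewrite (rlinearZ lf) ler_pdivrMl// mulrC.
  have alM : al k.+1 <= M.
    by rewrite /al ler_pdivrMr.
  have main : al k.+1 * (2 * N (c k.+1) - N (c k.+2)) - eps * N (c k.+2)
      <= al k * N (c k).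
    have -> : al k * N (c k) = A (c k) by rewrite /al divfK ?gt_eqF.
    apply: le_trans (fA _).
    rewrite (c2 k) (rlinearB lf) (rlinearZ lf) fal.
    have := fw' (c k.+2); lra.
  have N2 : N (c k.+2) <= 5 by apply: Nbnd.
  have cv := conv k.
  have key : (al k.+1 - al k) * N (c k) <=
      M * (N (c k) - 2 * N (c k.+1) + N (c k.+2)) + 5 * eps.
    have h1 : al k.+1 * (N (c k) - 2 * N (c k.+1) + N (c k.+2)) <=
      M * (N (c k) - 2 * N (c k.+1) + N (c k.+2)) by rewrite ler_wpM2r.
    have h2 : eps * N (c k.+2) <= eps * 5 by rewrite ler_wpM2l.
    lra.
  rewrite -lerBlDl ler_pdivlMr//.
  have [neg|pos] := leP (al k.+1 - al k) 0.
    apply: (@le_trans _ _ 0); first by rewrite mulr_le0_ge0// ltW.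
    by rewrite addr_ge0 ?mulr_ge0.
  by apply: le_trans key; rewrite ler_pM2l.
have sum k : (k <= n)%N -> al k <= al 0%N +
    (M * (N (c k.+1) - N (c k) - (N (c 1%N) - N (c 0%N))) + 5 * k%:R * eps) / nu.
  elim: k => [_|k IH kn].
    by rewrite subrr !(mulr0, mul0r) addr0 mul0r addr0.
  have := IH (ltnW kn); have := inc k kn.
  rewrite -[k.+1%:R]natr1 => h1 h2.
  apply: le_trans h1 _; rewrite -lerBrDr; apply: le_trans h2 _.
  rewrite -[leRHS]addrA lerD2l -mulrBl ler_pM2r ?invr_gt0//; lra.
have := sum n (leqnn n).
rewrite /al cn c0 Na Nb !divr1 => h.
apply: le_trans h _; rewrite lerD2l ler_pM2r ?invr_gt0//.
have -> : 4 * M / n%:R = M * (4 / n%:R) by rewrite mulrA [M * 4]mulrC.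
rewrite lerD2r ler_wpM2l//.
have := Nstep n; have := Nstep' 0%N; rewrite cn c0 Na Nb.
have -> : 4 / n%:R = 2 / n%:R + 2 / n%:R :> R by rewrite -mulrDl; congr (_ / _); lra.
lra.
Qed.

End Seminorm.

(** * Flows generated by skew operators *)

(** A linear map [G] is called skew here when [x + t *: G x] is never shorter than
    [x]. Since (1 + t G) (1 - t G) = 1 - t^2 G^2, both factors then change norms
    at most by a factor [1 + B * t ^+ 2], so [m] steps of length [t] change them
    very little when [m * t ^+ 2] is small, however large the time [m * t] is.
    The functionals [Lam c] are compared along these steps by [Lam_step]. *)
Section Flow.
Context (R : realType) (E : lmodType R) (N : E -> R) (hN : seminorm N).
Context (G : E -> E) (r B : R).
Hypothesis hG : forall t x y, G (t *: x + y) = t *: G x + G y.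
Hypothesis Gr : forall x, N (G x) <= r * N x.
Hypothesis r0 : 0 <= r.
Hypothesis rB : r * r <= B.
Hypothesis Gskew : forall t x, N x <= N (x + t *: G x).
Context (Lam : R -> E -> R) (kappa : R).
Hypothesis k0 : 0 <= kappa.
Hypothesis hLam : forall c, 1 <= c -> sublinear (Lam c).
Hypothesis Lam_le : forall c x, 1 <= c -> Lam c x <= c * kappa * N x.
Hypothesis Lam_step : forall c t v w, 1 <= c -> 0 < t <= 1 -> N w <= N v ->
  Lam c (v + t *: (w - v - G v)) <= Lam (c * (1 + B * t ^+ 2)) v.

Lemma B0 : 0 <= B. Proof. by apply: le_trans rB; exact: mulr_ge0. Qed.

Lemma GD x y : G (x + y) = G x + G y.
Proof. by have := hG 1 x y; rewrite !scale1r. Qed.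
Lemma G0 : G 0 = 0.
Proof. by have := hG (-1) 0 0; rewrite !scaleN1r oppr0 addr0 addNr. Qed.
Lemma GZ t x : G (t *: x) = t *: G x.
Proof. by have := hG t x 0; rewrite !addr0 G0 addr0. Qed.
Lemma GN x : G (- x) = - G x.
Proof. by rewrite -scaleN1r GZ scaleN1r. Qed.

Section Step.
Variable t : R.
Hypothesis t01 : 0 < t <= 1.
Let q := 1 + B * t ^+ 2.
Let q1 : 1 <= q. Proof. by rewrite lerDl mulr_ge0 ?B0 ?sqr_ge0. Qed.
Let q0 : 0 < q. Proof. exact: lt_le_trans q1. Qed.

Definition back (x : E) := x - t *: G x.
Definition forth (x : E) := x + t *: G x.

Lemma backP s x y : back (s *: x + y) = s *: back x + back y.
Proof. by rewrite /back hG scalerDr !scalerBr scalerA mulrC -scalerA opprD addrACA. Qed.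

Lemma iter_backP k s x y :
  iter k back (s *: x + y) = s *: iter k back x + iter k back y.
Proof. by elim: k => //= k ->; rewrite backP. Qed.

Lemma back_ge x : N x <= N (back x).
Proof. by rewrite /back -scaleNr. Qed.

Lemma forth_back x : forth (back x) = x - (t ^+ 2) *: G (G x).
Proof. by rewrite /forth /back GD GN GZ scalerDr scalerN addrA subrK scalerA. Qed.

Lemma back_forth x : back (forth x) = forth (back x).
Proof. by rewrite forth_back /forth /back GD GZ scalerDr opprD addrA addrK scalerA. Qed.

Lemma N_GG x : N ((t ^+ 2) *: G (G x)) <= B * t ^+ 2 * N x.
Proof.
rewrite (seminormZ hN) ger0_norm ?sqr_ge0//.
have -> : B * t ^+ 2 * N x = t ^+ 2 * (B * N x) by ring.
rewrite ler_wpM2l ?sqr_ge0//; apply: le_trans (Gr _) _.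
apply: (@le_trans _ _ (r * (r * N x))); first by rewrite ler_wpM2l.
by rewrite mulrA ler_wpM2r ?(seminorm_ge0 hN).
Qed.

(** Skewness at the vector [back x] bounds its norm by that of
    [forth (back x)], which differs from [x] only to second order. *)
Lemma back_le x : N (back x) <= q * N x.
Proof.
apply: le_trans (Gskew t _) _; rewrite -/(forth _) forth_back.
apply: le_trans (seminormB hN _ _) _; rewrite mulrDl mul1r lerD2l.
exact: N_GG.
Qed.

Lemma forth_le x : N (forth x) <= q * N x.
Proof.
apply: le_trans (back_ge _) _; rewrite back_forth forth_back.
apply: le_trans (seminormB hN _ _) _; rewrite mulrDl mul1r lerD2l.
exact: N_GG.
Qed.

Lemma iter_back_ge k x : N x <= N (iter k back x).
Proof. by elim: k => //= k /le_trans; apply; exact: back_ge. Qed.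

Lemma iter_back_le k x : N (iter k back x) <= q ^+ k * N x.
Proof.
elim: k => [|k IH]; first by rewrite mul1r.
apply: le_trans (back_le _) _.
by rewrite exprS -mulrA ler_pM2l.
Qed.

Lemma iter_forth_ge k x : N x <= N (iter k forth x).
Proof. by elim: k => //= k /le_trans; apply; exact: Gskew. Qed.

Lemma iter_forth_le k x : N (iter k forth x) <= q ^+ k * N x.
Proof.
elim: k => [|k IH]; first by rewrite mul1r.
apply: le_trans (forth_le _) _.
by rewrite exprS -mulrA ler_pM2l.
Qed.

Lemma iter_back_forth k x :
  N (iter k back (iter k forth x) - x) <= (q ^+ k - 1) * N x.
Proof.
have comm j y : iter j forth (back y) = back (iter j forth y).
  by elim: j => //= j ->; rewrite back_forth.
elim: k x => [|k IH] x; first by rewrite /= !subrr (seminorm0 hN) mul0r.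
pose z := forth (back x).
have -> : iter k.+1 back (iter k.+1 forth x) = iter k back (iter k forth z).
  by rewrite iterSr [iter k.+1 forth x]iterSr -comm back_forth.
have -> : iter k back (iter k forth z) - x =
  (iter k back (iter k forth z) - z) + (z - x) by rewrite addrA subrK.
apply: le_trans (seminormD hN _ _) _.
have zx : N (z - x) <= B * t ^+ 2 * N x.
  rewrite /z forth_back addrC addrA addNr add0r (seminormN hN).
  exact: N_GG.
have Nz : N z <= q * N x.
  have := seminormD hN (z - x) x; rewrite subrK /q mulrDl mul1r; lra.
apply: (@le_trans _ _ ((q ^+ k - 1) * (q * N x) + B * t ^+ 2 * N x)).
  apply: lerD => //; apply: le_trans (IH z) _.
  by rewrite ler_wpM2l// subr_ge0 exprn_ege1.
have -> : B * t ^+ 2 = q - 1 by rewrite /q addrC addKr.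
by rewrite exprSr le_eqVlt; apply/orP; left; apply/eqP; ring.
Qed.

Section Average.
Variable m : nat.
Hypothesis m0 : (0 < m)%N.
(** The functional [Lam] transported along the flow: each step from [L k.+1] to
    [L k] uses up one of the factors [q] by which [Lam_step] increases the
    parameter of [Lam]. *)
Let L k x := Lam (q ^+ (m - k)) (iter k back x).

(** The error, for unit vectors, of rescaling by [q ^+ m] plus that of the two
    terms in [G] by which [Lam_step] and an application of [back] differ. *)
Definition flow_error := q ^+ m - 1 + 2 * (t * r * q ^+ m).
Let e1 := kappa * q ^+ m * flow_error.

Let qk1 k : 1 <= q ^+ k. Proof. exact: exprn_ege1. Qed.
Let qm k : (k <= m)%N -> q ^+ (m - k) <= q ^+ m.
Proof. by move=> km; rewrite ler_weXn2l// leq_subr. Qed.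

Lemma flow_error_ge0 : 0 <= flow_error.
Proof.
have /andP[t0 _] := t01.
have qm0 := le_trans ler01 (qk1 m).
by rewrite /flow_error addr_ge0 ?subr_ge0 ?qk1// !mulr_ge0// ltW.
Qed.

Lemma L_sublinear k : sublinear (L k).
Proof.
split=> [x y|s x s0]; rewrite /L.
  have := iter_backP k 1 x y; rewrite !scale1r => ->.
  exact: sublinearD (hLam (qk1 _)) _ _.
have := iter_backP k s x 0; rewrite addr0.
have -> : iter k back 0 = 0.
  by have := iter_backP k (-1) 0 0; rewrite !scaleN1r oppr0 addr0 addNr.
rewrite addr0 => ->; apply: sublinearZ s0; exact: hLam (qk1 _).
Qed.

Lemma L_le k x : (k <= m)%N -> L k x <= kappa * q ^+ m * N x.
Proof.
move=> km; apply: le_trans (Lam_le _ (qk1 _)) _.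
have -> : kappa * q ^+ m * N x = q ^+ (m - k) * kappa * (q ^+ k * N x).
  by rewrite -{1}(subnK km) exprD; ring.
have qk0 := le_trans ler01 (qk1 (m - k)).
by rewrite ler_wpM2l ?iter_back_le// mulr_ge0.
Qed.

(** [Lam_step] at the transported vectors [x] and [y] of [a] and [w], where [y] is
    first shortened to [v] so as to be no longer than [x]. The drift term of
    [Lam_step] is the one that an additional [back] produces. *)
Lemma L_step k a w : (k < m)%N -> N a = 1 -> N w <= 1 ->
  L k.+1 (a + t *: (w - a)) <= L k a + t * e1.
Proof.
move=> km Na Nw; have /andP[t0 _] := t01.
pose x := iter k back a; pose y := iter k back w.
pose v := (q ^+ m)^-1 *: y.
have qm0 : 0 < q ^+ m by rewrite exprn_gt0.
have Nx : 1 <= N x by rewrite -Na; exact: iter_back_ge.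
have qkm : q ^+ k <= q ^+ m by rewrite ler_weXn2l// ltnW.
have Ny : N y <= q ^+ m.
  apply: le_trans (iter_back_le _ _) _; apply: le_trans qkm.
  by rewrite ler_piMr// exprn_ge0// ltW.
have Nx' : N x <= q ^+ m.
  by apply: le_trans (iter_back_le _ _) _; rewrite Na mulr1.
have Nv : N v <= N x.
  apply: le_trans Nx; rewrite (seminormZ hN) gtr0_norm ?invr_gt0//.
  by rewrite ler_pdivrMl// mulr1.
have := Lam_step (qk1 (m - k.+1)) t01 Nv.
rewrite -/q -exprSr subnSK// -/(L k a) => st.
have E1 : iter k.+1 back (a + t *: (w - a)) =
    (x + t *: (v - x - G x)) + t *: ((1 - (q ^+ m)^-1) *: y - t *: G y + t *: G x).
  have -> : a + t *: (w - a) = t *: w + (1 - t) *: a.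
    by rewrite scalerBr scalerBl scale1r addrCA.
  have -> : iter k.+1 back (t *: w + (1 - t) *: a) = t *: back y + (1 - t) *: back x.
    rewrite iter_backP; have := iter_backP k.+1 (1 - t) a 0.
    have -> : iter k.+1 back 0 = 0.
      by have := iter_backP k.+1 (-1) 0 0; rewrite !scaleN1r oppr0 addr0 addNr.
    by rewrite !addr0 => ->.
  rewrite -addrA -scalerDr.
  have -> : v - x - G x + ((1 - (q ^+ m)^-1) *: y - t *: G y + t *: G x) =
            back y - back x - G x.
    rewrite /v /back scalerBl scale1r.
    set p := _ *: y; set gy := t *: G y; set gx := t *: G x.
    rewrite [y - p - gy]addrAC [X in _ + X = _]addrAC.
    rewrite addrC -[p - x - G x]addrA addrACA subrr add0r addrC.
    by rewrite opprB !addrA.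
  rewrite scalerBl scale1r (scalerBr t (back y - back x)) (scalerBr t (back y)).
  set Y := t *: back y; set X := t *: back x; rewrite -[back x]/(x - t *: G x).
  rewrite -[x - _ - X]addrA [Y + (x + _)]addrCA; congr (_ + _).
  by rewrite -addrA; congr (_ + _); rewrite addrC.
rewrite /L E1; apply: le_trans (sublinearD (hLam (qk1 _)) _ _) _.
apply: lerD; first exact: st.
apply: le_trans (Lam_le _ (qk1 _)) _.
rewrite (seminormZ hN) (gtr0_norm t0).
set z := _ + t *: G x.
have -> : q ^+ (m - k.+1) * kappa * (t * N z) =
  t * (kappa * (q ^+ (m - k.+1) * N z)) by ring.
rewrite ler_pM2l// /e1 -mulrA ler_wpM2l//.
have qk0 := le_trans ler01 (qk1 (m - k.+1)).
apply: ler_pM => //; [exact: (seminorm_ge0 hN)|exact: qm|].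
have c0 : 0 <= 1 - (q ^+ m)^-1 by rewrite subr_ge0 invf_le1// qk1.
have NG u : N u <= q ^+ m -> N (t *: G u) <= t * r * q ^+ m.
  move=> Nu; rewrite (seminormZ hN) (gtr0_norm t0) -mulrA ler_pM2l//.
  by apply: le_trans (Gr _) _; rewrite ler_wpM2l.
have Ncy : N ((1 - (q ^+ m)^-1) *: y) <= q ^+ m - 1.
  rewrite (seminormZ hN) ger0_norm//.
  apply: (@le_trans _ _ ((1 - (q ^+ m)^-1) * q ^+ m)); first by rewrite ler_wpM2l.
  by rewrite mulrBl mul1r mulVf ?gt_eqF.
have := seminormD hN ((1 - (q ^+ m)^-1) *: y - t *: G y) (t *: G x).
have := seminormB hN ((1 - (q ^+ m)^-1) *: y) (t *: G y).
have := NG _ Ny; have := NG _ Nx'; rewrite /flow_error -/z; lra.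
Qed.

Definition flow_average x := m%:R^-1 * \sum_(k < m) L k.+1 x.
Local Notation Av := flow_average.

Let mR0 : 0 < m%:R :> R. Proof. by rewrite ltr0n. Qed.

Lemma flow_average_sublinear : sublinear Av.
Proof.
split=> [x y|s x s0]; rewrite /Av.
  rewrite -mulrDr ler_pM2l ?invr_gt0// -big_split/=.
  by apply: ler_sum => k _; exact: sublinearD (L_sublinear _) _ _.
rewrite mulrCA; congr (_ * _); rewrite mulr_sumr; apply: eq_bigr => k _.
by apply: sublinearZ s0; exact: L_sublinear.
Qed.

Lemma flow_average_le x : Av x <= kappa * q ^+ m * N x.
Proof.
rewrite /Av ler_pdivrMl//.
have -> : m%:R * (kappa * q ^+ m * N x) = \sum_(k < m) (kappa * q ^+ m * N x).
  by rewrite sumr_const card_ord mulr_natl.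
by apply: ler_sum => k _; apply: L_le.
Qed.

(** A supporting functional at [a] grows in the direction [w - a] at most like the
    average itself, and by [L_step] the increments of the terms telescope to
    [L 0 a - L m a]; divided by the time [m * t] this is small. *)
Lemma flow_average_support a : N a = 1 -> exists f : E -> R, [/\ rlinear f,
  forall y, f y <= Av y, f a = Av a &
  forall w, N w <= 1 -> f w <= Av a + (2 * kappa * q ^+ m / (m%:R * t) + e1)].
Proof.
move=> Na; have /andP[t0 _] := t01.
have [f [lf fA fa]] := hahn_banach_support a flow_average_sublinear.
exists f; split=> // w Nw.
have h1 := fA (a + t *: (w - a)).
rewrite (rlinearD lf) (rlinearZ lf) (rlinearB lf) fa in h1.
have h2 : Av (a + t *: (w - a)) <= m%:R^-1 * \sum_(k < m) L k a + t * e1.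
  rewrite -[t * e1](mulKf (lt0r_neq0 mR0)) -mulrDr ler_pM2l ?invr_gt0//.
  have -> : m%:R * (t * e1) = \sum_(k < m) (t * e1).
    by rewrite sumr_const card_ord mulr_natl.
  by rewrite -big_split/=; apply: ler_sum => k _; apply: L_step.
have h3 : \sum_(k < m) L k a = \sum_(k < m) L k.+1 a + L 0%N a - L m a.
  have : \sum_(k < m.+1) L k a = \sum_(k < m.+1) L k a by [].
  by rewrite {1}big_ord_recl big_ord_recr/=; lra.
have h4 := L_le a (leq0n m); have h5 := L_le (- a) (leqnn m).
have h6 := sublinear_oppl (L_sublinear m) a.
rewrite (seminormN hN) Na mulr1 in h4 h5.
have h7 : m%:R^-1 * \sum_(k < m) L k a <= Av a + m%:R^-1 * (2 * kappa * q ^+ m).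
  by rewrite h3 /Av -mulrDr ler_pM2l ?invr_gt0//; lra.
have h8 : t * (f w - Av a) <= m%:R^-1 * (2 * kappa * q ^+ m) + t * e1 by lra.
have h9 : f w - Av a <= t^-1 * (m%:R^-1 * (2 * kappa * q ^+ m)) + e1.
  by rewrite -lerBlDr ler_pdivlMl//; lra.
have -> : 2 * kappa * q ^+ m / (m%:R * t) = t^-1 * (m%:R^-1 * (2 * kappa * q ^+ m)).
  by rewrite invfM mulrC [m%:R^-1 * t^-1]mulrC -mulrA.
lra.
Qed.

Lemma flow_average_start a : N a = 1 -> Av a <= Lam (q ^+ m) a + m%:R * (t * e1).
Proof.
move=> Na; have /andP[t0 _] := t01.
have e0 : 0 <= t * e1.
  have qm0 := le_trans ler01 (qk1 m).
  by rewrite !mulr_ge0 ?flow_error_ge0// ltW.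
have dec k : (k <= m)%N -> L k a <= L 0%N a + k%:R * (t * e1).
  elim: k => [|k IH] km; first by rewrite mul0r addr0.
  have := L_step km Na (_ : N a <= 1); rewrite Na => /(_ (lexx _)).
  rewrite subrr scaler0 addr0 -natr1; have := IH (ltnW km); lra.
have -> : Lam (q ^+ m) a = L 0%N a by rewrite /L subn0.
rewrite /Av ler_pdivrMl//.
have -> : m%:R * (L 0%N a + m%:R * (t * e1)) =
    \sum_(k < m) (L 0%N a + m%:R * (t * e1)).
  by rewrite sumr_const card_ord mulr_natl.
apply: ler_sum => k _; apply: le_trans (dec _ (ltn_ord k)) _.
by rewrite lerD2l ler_wpM2r// ler_nat.
Qed.

Lemma flow_average_end a : N a = 1 ->
  Lam 1 (iter m back a) <= Av a + m%:R * (t * e1).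
Proof.
move=> Na; have /andP[t0 _] := t01.
have e0 : 0 <= t * e1.
  have qm0 := le_trans ler01 (qk1 m).
  by rewrite !mulr_ge0 ?flow_error_ge0// ltW.
have dec j k : (j + k <= m)%N -> L (j + k)%N a <= L k a + j%:R * (t * e1).
  elim: j => [|j IH] km; first by rewrite mul0r addr0.
  have := L_step km Na (_ : N a <= 1); rewrite Na => /(_ (lexx _)).
  rewrite subrr scaler0 addr0 -natr1; have := IH (ltnW km).
  rewrite addSn; lra.
have -> : Lam 1 (iter m back a) = L m a by rewrite /L subnn.
rewrite -lerBlDr /Av ler_pdivlMl//.
have -> : m%:R * (L m a - m%:R * (t * e1)) =
    \sum_(k < m) (L m a - m%:R * (t * e1)).
  by rewrite sumr_const card_ord mulr_natl.
apply: ler_sum => k _; have := @dec (m - k.+1)%N k.+1.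
rewrite subnK// => /(_ (leqnn _)) => h; rewrite lerBlDr; apply: le_trans h _.
by rewrite lerD2l ler_wpM2r// ler_nat leq_subr.
Qed.

End Average.
End Step.

Lemma expr1D_le (x : R) k : 0 <= x -> 2 * k%:R * x <= 1 ->
  (1 + x) ^+ k <= 1 + 2 * k%:R * x.
Proof.
move=> x0; elim: k => [|k IH] kx; first by rewrite expr0 mulr0 mul0r addr0.
have kx' : 2 * k%:R * x <= 1.
  apply: le_trans kx; rewrite ler_wpM2r// ler_wpM2l// ler_nat; exact: leqnSn.
rewrite exprSr; apply: (@le_trans _ _ ((1 + 2 * k%:R * x) * (1 + x))).
  by rewrite ler_wpM2r ?IH// addr_ge0.
have : (2 * k%:R * x) * x <= 1 * x by rewrite ler_wpM2r.
by rewrite -natr1; lra.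
Qed.

(** With [t = j^-3] and [m = j^4] the time [m * t = j] is large, while
    [m * t ^+ 2 = j^-2] and the accumulated error, of order [j^-1], are small. *)
Lemma flow_parameters (eta : R) : 0 < eta <= 1 -> exists t m,
  [/\ 0 < t <= 1, (0 < m)%N, (1 + B * t ^+ 2) ^+ m <= 1 + eta,
      m%:R * t * flow_error t m <= eta & (m%:R * t)^-1 <= eta].
Proof.
move=> /andP[eta0 eta1].
have B0 := B0.
pose C := 2 * B + 4 * r + 1.
have C0 : 0 < C by rewrite /C ltr_wpDl// addr_ge0// mulr_ge0.
pose j := (Num.bound (C / eta)).+1.
have jR : 0 < j%:R :> R by rewrite ltr0n.
have Cj : C <= eta * j%:R.
  rewrite -ler_pdivrMl// mulrC; apply: ltW.
  apply: lt_le_trans (archi_boundP _) _; first by rewrite divr_ge0 ?ltW.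
  by rewrite ler_nat /j leqnSn.
pose s := (j%:R : R)^-1.
have js : j%:R * s = 1 by rewrite /s divff ?gt_eqF.
have s0 : 0 < s by rewrite invr_gt0.
have s1 : s <= 1 by rewrite /s invf_le1// ler1n.
have Cs : C * s <= eta by rewrite /s ler_pdivrMr.
have s2 : s * s <= s by rewrite ler_piMl// ltW.
have s3 : s * s * s <= s * s by rewrite ler_piMr// mulr_ge0// ltW.
pose t := s ^+ 3; pose m := (j ^ 4)%N.
have tE : t = s * s * s by rewrite /t !exprS expr0 mulr1 mulrA.
have t0 : 0 < t by rewrite exprn_gt0.
have mt : m%:R * t = j%:R.
  have -> : m%:R * t = j%:R * (j%:R * s) ^+ 3 by rewrite /m natrX /t; ring.
  by rewrite js expr1n mulr1.
have mt2 : m%:R * (B * t ^+ 2) = B * (s * s).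
  have -> : m%:R * (B * t ^+ 2) = B * (j%:R * s) ^+ 4 * (s * s).
    by rewrite /m natrX /t; ring.
  by rewrite js expr1n mulr1.
have BC : 2 * B <= C by rewrite /C -addrA lerDl addr_ge0// mulr_ge0.
have s0' := ltW s0.
have Bs : 2 * B * s <= C * s by rewrite ler_wpM2r.
have Bss : B * (s * s) <= B * s by rewrite ler_wpM2l.
have qm : (1 + B * t ^+ 2) ^+ m <= 1 + 2 * (B * (s * s)).
  rewrite -mt2 mulrA; apply: expr1D_le; first by rewrite mulr_ge0 ?sqr_ge0.
  by rewrite -mulrA mt2; lra.
exists t, m; split.
- by rewrite t0/= tE; lra.
- by rewrite expn_gt0.
- by apply: le_trans qm _; lra.
- rewrite mt /flow_error; set Q := (_ ^+ m).
  have Q2 : Q <= 2 by apply: le_trans qm _; lra.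
  have rtQ : t * r * Q <= s * s * r * 2.
    apply: ler_pM => //; last by rewrite ler_wpM2r// tE.
      by rewrite mulr_ge0// ltW.
    by rewrite exprn_ge0// addr_ge0 ?mulr_ge0 ?sqr_ge0.
  apply: (@le_trans _ _ (j%:R * (2 * (B * (s * s)) + 2 * (s * s * r * 2)))).
    by rewrite ler_pM2l//; rewrite -/Q in qm; lra.
  have -> : j%:R * (2 * (B * (s * s)) + 2 * (s * s * r * 2)) =
    (j%:R * s) * ((2 * B + 4 * r) * s) by ring.
  rewrite js mul1r; apply: le_trans Cs.
  by rewrite ler_pM2r// /C lerDl.
- rewrite mt -/s; apply: le_trans Cs; rewrite ler_peMl// /C lerDr.
  by rewrite addr_ge0// mulr_ge0.
Qed.

Variable ell : E -> R.
Hypothesis hell : rlinear ell.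
Hypothesis ell_le : forall x, ell x <= kappa * N x.
Hypothesis ell_Lam : forall c x, 1 <= c -> ell x <= Lam c x.
Hypothesis ell_sup : forall eta, 0 < eta -> exists2 y, N y <= 1 & kappa - eta <= ell y.

Lemma ell_ge x : - (kappa * N x) <= ell x.
Proof.
by have := ell_le (- x); rewrite (rlinearN hell) (seminormN hN); lra.
Qed.

Section Unit.
Variables (u : E) (K : R).
Hypothesis (Nu : N u = 1) (K0 : 0 <= K).
Hypothesis Lam_u : forall c, 1 <= c -> Lam c u <= ell u + K * (c - 1).

Section Scales.
Variables (eta t : R) (m : nat).
Hypotheses (eta01 : 0 < eta <= 1) (t01 : 0 < t <= 1) (m0 : (0 < m)%N).
Let q := 1 + B * t ^+ 2.
Hypothesis qm : q ^+ m <= 1 + eta.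
Hypothesis mte : m%:R * t * flow_error t m <= eta.
Hypothesis mt : (m%:R * t)^-1 <= eta.

Let qm1 : 1 <= q ^+ m.
Proof. by rewrite exprn_ege1// lerDl mulr_ge0 ?B0 ?sqr_ge0. Qed.
Let fe0 : 0 <= flow_error t m. Proof. exact: flow_error_ge0. Qed.
Let mt0 : 0 < m%:R * t.
Proof. by case/andP: t01 => t0 _; rewrite mulr_gt0// ltr0n. Qed.

Lemma flow_mte1 : m%:R * (t * (kappa * q ^+ m * flow_error t m)) <= 2 * kappa * eta.
Proof.
have /andP[e0 e1] := eta01.
have -> : m%:R * (t * (kappa * q ^+ m * flow_error t m)) =
  q ^+ m * (kappa * (m%:R * t * flow_error t m)) by ring.
have q2 : q ^+ m <= 2 by apply: le_trans qm _; lra.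
have x0 : 0 <= q ^+ m by exact: le_trans ler01 qm1.
have y0 : 0 <= kappa * (m%:R * t * flow_error t m).
  by apply: mulr_ge0 => //; apply: mulr_ge0 => //; exact: ltW.
rewrite -[2 * kappa * eta]mulrA; apply: ler_pM => //.
by rewrite ler_wpM2l.
Qed.

Lemma flow_eps : 2 * kappa * q ^+ m / (m%:R * t) + kappa * q ^+ m * flow_error t m
  <= 6 * kappa * eta.
Proof.
have /andP[e0 e1] := eta01.
have q2 : q ^+ m <= 2 by apply: le_trans qm _; lra.
have kq : kappa * q ^+ m <= 2 * kappa by rewrite mulrC ler_wpM2r.
have kq0 : 0 <= kappa * q ^+ m by rewrite mulr_ge0// (le_trans ler01).
have fe : flow_error t m <= eta.
  have -> : flow_error t m = (m%:R * t)^-1 * (m%:R * t * flow_error t m).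
    by rewrite mulKf ?gt_eqF.
  apply: (@le_trans _ _ (eta * 1)); last by rewrite mulr1.
  apply: ler_pM => //; first by rewrite invr_ge0 ltW.
    by rewrite mulr_ge0// ltW.
  exact: le_trans mte _.
have h1 : kappa * q ^+ m / (m%:R * t) <= 2 * kappa * eta.
  by apply: ler_pM => //; rewrite invr_ge0 ltW.
have h2 : kappa * q ^+ m * flow_error t m <= 2 * kappa * eta by exact: ler_pM.
by rewrite -2!mulrA [kappa * _]mulrA; lra.
Qed.

Local Notation Av := (flow_average t m).

Lemma Av_le x : Av x <= 2 * kappa * N x.
Proof.
have /andP[e0 e1] := eta01.
apply: le_trans (flow_average_le t m0 x) _.
rewrite ler_wpM2r ?(seminorm_ge0 hN)// mulrC ler_wpM2r//.
by apply: le_trans qm _; lra.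
Qed.

Lemma Av_support x : N x = 1 -> exists f : E -> R, [/\ rlinear f,
  forall y, f y <= Av y, f x = Av x &
  forall w, N w <= 1 -> f w <= Av x + 6 * kappa * eta].
Proof.
move=> Nx; have [f [lf fA fx fw]] := flow_average_support t01 m0 Nx.
exists f; split=> // w Nw; apply: le_trans (fw w Nw) _.
by rewrite lerD2l; exact: flow_eps.
Qed.

Lemma Av_u : Av u <= ell u + (K + 2 * kappa) * eta.
Proof.
have := flow_average_start t01 m0 Nu.
have := Lam_u qm1; have := flow_mte1.
have : K * (q ^+ m - 1) <= K * eta by rewrite ler_wpM2l// lerBlDl.
rewrite -/q; lra.
Qed.

(** For [b] the normalization of the result of [m] forward steps from [y], the [m]
    backward steps lead back near to [y], where [ell] is below [Lam 1]. *)
Lemma Av_target y : N y = 1 -> exists2 b, N b = 1 &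
  ell y - 4 * kappa * eta <= Av b.
Proof.
move=> Ny; have /andP[e0 e1] := eta01.
pose b0 := iter m (forth t) y.
have b1 : 1 <= N b0 by rewrite -Ny; exact: iter_forth_ge.
have b2 : N b0 <= 1 + eta.
  by apply: le_trans (iter_forth_le t _ _) _; rewrite Ny mulr1.
have Nb0 : 0 < N b0 by exact: lt_le_trans b1.
pose b := (N b0)^-1 *: b0.
have Nb : N b = 1 by rewrite (seminormZ hN) gtr0_norm ?invr_gt0// mulVf ?gt_eqF.
exists b => //.
have := flow_average_end t01 m0 Nb; have := flow_mte1.
have := ell_Lam (iter m (back t) b) (lexx 1).
have -> : iter m (back t) b = (N b0)^-1 *: iter m (back t) b0.
  have it0 : iter m (back t) 0 = 0.
    by have := iter_backP t m (-1) 0 0; rewrite !scaleN1r oppr0 addr0 addNr.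
  by have := iter_backP t m (N b0)^-1 b0 0; rewrite it0 !addr0.
rewrite (rlinearZ hell).
set p := ell (iter m (back t) b0) => h1 h2 h3.
have hp : ell y - kappa * eta <= p.
  have := ell_ge (iter m (back t) b0 - y); rewrite (rlinearB hell) -/p.
  have := iter_back_forth t m y; rewrite Ny mulr1 -/b0 => h.
  have : kappa * N (iter m (back t) b0 - y) <= kappa * eta.
    by rewrite ler_wpM2l//; apply: le_trans h _; rewrite lerBlDl.
  lra.
have ly : ell y <= kappa by have := ell_le y; rewrite Ny mulr1.
have ke : 0 <= kappa * eta by rewrite mulr_ge0// ltW.
have pk : ell y - 2 * (kappa * eta) <= (N b0)^-1 * p.
  rewrite ler_pdivlMl//.
  apply: le_trans hp.
  have [neg|pos] := leP (ell y - 2 * (kappa * eta)) 0.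
    apply: (@le_trans _ _ (1 * (ell y - 2 * (kappa * eta)))); last by lra.
    by rewrite ler_wnM2r.
  apply: (@le_trans _ _ ((1 + eta) * (ell y - 2 * (kappa * eta)))).
    by rewrite ler_pM2r.
  have e0' := ltW e0; have : ell y * eta <= kappa * eta by rewrite ler_wpM2r.
  have : 0 <= kappa * eta * eta by rewrite mulr_ge0// ltW.
  lra.
rewrite -/q in h2 h3 *; lra.
Qed.

Lemma Av_u_ge : - (6 * kappa * eta) <= Av u.
Proof.
have [f [lf fA fx fw]] := Av_support Nu.
by have := fw 0; rewrite (seminorm0 hN) (rlinear0 lf) ler01 => /(_ isT); lra.
Qed.

End Scales.

(** A subgradient of [Av] at [u] is at most [Av u + 6 * kappa * eta] on the unit
    ball, in particular at 0, so [Av u] is nearly nonnegative; and it is at most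
    about [ell u]. *)
Lemma ell_u_ge0 : 0 <= ell u.
Proof.
rewrite leNgt; apply/negP => lu.
pose C := K + 8 * kappa + 1.
have C0 : 0 < C by rewrite /C ltr_wpDl// addr_ge0// mulr_ge0.
pose eta := Num.min 1 (- ell u / (2 * C)).
have e0 : 0 < eta by rewrite lt_min ltr01 divr_gt0//; lra.
have e1 : eta <= 1 by rewrite ge_min lexx.
have eC : C * eta <= - ell u / 2.
  rewrite mulrC -ler_pdivlMr// ge_min; apply/orP; right.
  by rewrite invfM mulrA.
have e01 : 0 < eta <= 1 by rewrite e0.
have [t [m [t01 m0 qm mte mt]]] := flow_parameters e01.
have := Av_u_ge e01 t01 m0 qm mte mt.
have := Av_u e01 t01 m0 qm mte.
rewrite /C in eC; lra.
Qed.

(** In the one-dimensional case the unit vectors where [ell] nearly attains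
    [kappa] are close to [u] or [- u], and [ell_u_ge0] decides the sign. *)
Lemma kappa_le_ell_degenerate :
  (forall delta e, 0 < delta -> N e = 1 -> exists s, N (e - s *: u) < delta) ->
  kappa <= ell u.
Proof.
move=> degen; apply/ler_addgt0Pr => e e0.
have [k00|kpos] := leP kappa 0; first by have := ell_u_ge0; lra.
pose d := Num.min (kappa / 2) (Num.min 1 (e / (2 + 4 * kappa))).
have k4 : 0 < 2 + 4 * kappa by lra.
have d0 : 0 < d by rewrite !lt_min ltr01 !divr_gt0.
have dk : d <= kappa / 2 by rewrite ge_min lexx.
have dd1 : d <= 1 by rewrite !ge_min lexx orbT.
have de : d * (2 + 4 * kappa) <= e.
  by rewrite -ler_pdivlMr// !ge_min lexx !orbT.
have [y Ny ly] := ell_sup d0.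
have Ny0 : 0 < N y.
  rewrite lt_neqAle (seminorm_ge0 hN) andbT; apply/eqP => Ny0.
  by have := ell_le y; rewrite -Ny0 mulr0; lra.
pose y' := (N y)^-1 *: y.
have Ny' : N y' = 1 by rewrite (seminormZ hN) gtr0_norm ?invr_gt0// mulVf ?gt_eqF.
have ly' : kappa - d <= ell y'.
  rewrite (rlinearZ hell) ler_pdivlMl//; apply: le_trans ly.
  by rewrite ler_piMl//; lra.
have [s hs] := degen d y' d0 Ny'.
have hd : ell y' - s * ell u <= kappa * d.
  rewrite -(rlinearZ hell) -(rlinearB hell); apply: le_trans (ell_le _) _.
  by rewrite ler_wpM2l// ltW.
have s1 : s <= 1 + d.
  have := seminorm_ler_distD hN (s *: u) y'.
  rewrite -(seminormN hN (_ - y')) opprB (seminormZ hN) Nu Ny' mulr1.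
  have := ler_norm s; lra.
have lu := ell_u_ge0.
have luk : ell u <= kappa by have := ell_le u; rewrite Nu mulr1.
have : s * ell u <= (1 + d) * ell u by rewrite ler_wpM2r.
have : d * ell u <= d * kappa by rewrite ler_wpM2l// ltW.
have : 0 <= d * kappa by rewrite mulr_ge0// ltW.
lra.
Qed.

(** The lower bounds [1 - 2 * s] near [a], [1 - 2 * (1 - s)] near [b], and the
    smaller of [s] and [1 - s] in between, cover all [s]: one of them is always at
    least 1/5. *)
Lemma segment_away (a b : E) : N a = 1 -> N b = 1 -> 1 <= N (a + b) ->
  forall s, 0 <= s <= 1 -> 5^-1 <= N (a + s *: (b - a)).
Proof.
move=> Na Nb ab s /andP[s0 s1].
pose c := a + s *: (b - a).
have cE : c = (1 - s) *: a + s *: b.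
  by rewrite /c scalerBr scalerBl scale1r addrCA addrC.
have h1 : 1 - 2 * s <= N c.
  have := seminormD hN c (- (s *: (b - a))); rewrite addrK Na (seminormN hN).
  rewrite (seminormZ hN) ger0_norm//.
  have : s * N (b - a) <= s * 2.
    by rewrite ler_wpM2l//; have := seminormB hN b a; lra.
  lra.
have h2 : 1 - 2 * (1 - s) <= N c.
  have E1 : c = b - (1 - s) *: (b - a).
    rewrite cE scalerBr opprB addrCA; congr (_ + _).
    by rewrite -[X in X - _]scale1r -scalerBl; congr (_ *: _); lra.
  have := seminormD hN c ((1 - s) *: (b - a)); rewrite {1}E1 subrK Nb.
  rewrite (seminormZ hN) ger0_norm ?subr_ge0//.
  have : (1 - s) * N (b - a) <= (1 - s) * 2.
    by rewrite ler_wpM2l ?subr_ge0//; have := seminormB hN b a; lra.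
  lra.
have [s2|s2] := leP s (1 / 2).
  have h3 : s <= N c.
    have E1 : (1 - s) *: (a + b) = c + (1 - 2 * s) *: b.
      rewrite cE scalerDr -addrA -scalerDl; congr (_ + _ *: _); lra.
    have := seminormD hN c ((1 - 2 * s) *: b).
    rewrite -E1 !(seminormZ hN) !ger0_norm ?subr_ge0//; last by lra.
    have : (1 - s) * 1 <= (1 - s) * N (a + b) by rewrite ler_wpM2l// subr_ge0.
    rewrite Nb; lra.
  lra.
have h3 : 1 - s <= N c.
  have E1 : s *: (a + b) = c + (2 * s - 1) *: a.
    rewrite cE scalerDr addrAC -scalerDl; congr (_ *: _ + _); lra.
  have := seminormD hN c ((2 * s - 1) *: a).
  rewrite -E1 !(seminormZ hN) !ger0_norm//; last by lra.
  have : s * 1 <= s * N (a + b) by rewrite ler_wpM2l.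
  rewrite Na; lra.
lra.
Qed.

Lemma ell_sup_unit (eta : R) : 0 < eta < kappa ->
  exists2 y, N y = 1 & kappa - eta <= ell y.
Proof.
move=> /andP[e0 ek]; have [y Ny ly] := ell_sup e0.
have Ny0 : 0 < N y.
  rewrite lt_neqAle (seminorm_ge0 hN) andbT; apply/eqP => Ny0.
  by have := ell_le y; rewrite -Ny0 mulr0; lra.
exists ((N y)^-1 *: y).
  by rewrite (seminormZ hN) gtr0_norm ?invr_gt0// mulVf ?gt_eqF.
rewrite (rlinearZ hell) ler_pdivlMl//; apply: le_trans ly.
by rewrite ler_piMl//; lra.
Qed.

(** The segment from [u] to any target may cross the origin, so [radial_drift] is
    applied twice: from [u] to [e] or [- e], which stays away from the origin
    because [e] is away from the line of [u], and from there to [b], where the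
    sign is chosen so that [segment_away] applies. *)
Lemma kappa_le_ell_away (d : R) (e : E) : 0 < d -> N e = 1 ->
  (forall s, d <= N (e - s *: u)) -> kappa <= ell u.
Proof.
move=> d0 Ne hd; apply/ler_addgt0Pr => eps eps0.
have [k00|kpos] := leP kappa 0; first by have := ell_u_ge0; lra.
have d1 : d <= 1 by have := hd 0; rewrite scale0r subr0 Ne.
have seg (sg : R) : sg * sg = 1 -> forall s, 0 <= s <= 1 ->
    d / 4 <= N (u + s *: (sg *: e - u)).
  move=> sg1 s /andP[s0 s1].
  have sgn : `|sg| = 1.
    have : `|sg| ^+ 2 = 1 by rewrite -normrX expr2 sg1 normr1.
    by move=> /eqP; rewrite sqrf_eq1 => /orP[/eqP//|/eqP h]; have := normr_ge0 sg; rewrite h; lra.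
  have Nsg : N (sg *: e) = 1 by rewrite (seminormZ hN) sgn Ne mulr1.
  have [s4|s4] := leP s (1 / 4).
    have := seminormD hN (u + s *: (sg *: e - u)) (- (s *: (sg *: e - u))).
    rewrite addrK Nu (seminormN hN) (seminormZ hN _ (sg *: e - u)) ger0_norm//.
    have : s * N (sg *: e - u) <= s * 2.
      by rewrite ler_wpM2l//; have := seminormB hN (sg *: e) u; rewrite Nu; lra.
    lra.
  have sp : 0 < s by lra.
  have -> : u + s *: (sg *: e - u) = (s * sg) *: (e - (- (sg * ((1 - s) / s))) *: u).
    rewrite scaleNr opprK scalerBr [in RHS]scalerDr !scalerA.
    have -> : s * sg * (sg * ((1 - s) / s)) = 1 - s.
      have -> : s * sg * (sg * ((1 - s) / s)) = (sg * sg) * (s * ((1 - s) / s)) by ring.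
      by rewrite sg1 mul1r mulrC divfK ?gt_eqF.
    by rewrite scalerBl scale1r addrCA.
  rewrite (seminormZ hN) normrM sgn mulr1 gtr0_norm//.
  apply: (@le_trans _ _ (s * d)); last by rewrite ler_pM2l.
  have : 1 / 4 * d <= s * d by rewrite ler_wpM2r ?(ltW d0)// ltW.
  lra.
pose Kp := 4 / d + 5.
have Kp0 : 0 < Kp by rewrite addr_gt0// divr_gt0.
pose n := (Num.bound (32 * kappa * Kp / eps)).+1.
have n0 : (0 < n)%N by [].
have nR : 0 < n%:R :> R by rewrite ltr0n.
have kK : 0 < kappa * Kp by rewrite mulr_gt0.
have hn : 8 * (kappa * Kp) / n%:R <= eps / 4.
  rewrite ler_pdivrMr//.
  have : 32 * kappa * Kp <= eps * n%:R.
    rewrite -ler_pdivrMl// mulrC; apply: ltW.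
    apply: lt_le_trans (archi_boundP _) _; last by rewrite ler_nat /n leqnSn.
    by rewrite divr_ge0 ?(ltW eps0)// -mulrA mulr_ge0// ltW.
  lra.
pose C := K + 10 * kappa + 30 * n%:R * (kappa * Kp) + 1.
have C1 : 1 <= C.
  by rewrite /C lerDr !addr_ge0 ?mulr_ge0// ltW.
have C0 : 0 < C by exact: lt_le_trans C1.
pose eta := Num.min (kappa / 2) (Num.min 1 (eps / (4 * C))).
have e0 : 0 < eta by rewrite !lt_min ltr01 !divr_gt0// mulr_gt0.
have ek : eta < kappa.
  by apply: (@le_lt_trans _ _ (kappa / 2)); [rewrite ge_min lexx|lra].
have e1 : eta <= 1 by rewrite !ge_min lexx orbT.
have eC : eta * (4 * C) <= eps.
  by rewrite -ler_pdivlMr ?mulr_gt0// !ge_min lexx !orbT.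
have e01 : 0 < eta <= 1 by rewrite e0.
have [t [m [t01 m0 qm mte mt]]] := flow_parameters e01.
have [|y Ny ly] := @ell_sup_unit eta; first by rewrite e0.
have [b Nb hb] := Av_target e01 t01 m0 qm mte Ny.
have [sg [sg1 sgb]] : exists sg : R, sg * sg = 1 /\ 1 <= N (sg *: e + b).
  have [h|h] := leP 1 (N (e + b)).
    by exists 1; rewrite mulr1 scale1r.
  exists (-1); rewrite mulrNN mulr1 scaleN1r; split=> //.
  have := seminormD hN (e + b) (b - e).
  rewrite [b - e]addrC addrACA subrr add0r -[b + b]mulr2n -scaler_nat.
  by rewrite (seminormZ hN) ger0_norm// Nb; lra.
have Nse : N (sg *: e) = 1.
  have := sg1; rewrite -expr2 => /eqP; rewrite sqrf_eq1 => /orP[] /eqP ->.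
    by rewrite scale1r.
  by rewrite scaleN1r (seminormN hN).
have hM : 0 <= 2 * kappa by rewrite mulr_ge0.
have he : 0 <= 6 * kappa * eta by rewrite !mulr_ge0// ltW.
have h5 : (0 : R) < 5^-1 by rewrite invr_gt0.
have d4 : 0 < d / 4 by rewrite divr_gt0.
have Asub := flow_average_sublinear t m0.
have Ale := Av_le e01 m0 qm.
have Asupp x : N x = 1 -> exists f : E -> R, [/\ rlinear f,
  forall y, f y <= flow_average t m y, f x = flow_average t m x &
  forall w, N w <= 1 -> f w <= flow_average t m x + 6 * kappa * eta].
  move=> Nx. have := Av_support e01 t01 m0 qm mte mt Nx. exact.
have r1 := radial_drift hN Asub hM he h5 n0 Ale Asupp Nse Nb (segment_away Nse Nb sgb).
have r2 := radial_drift hN Asub hM he d4 n0 Ale Asupp Nu Nse (seg sg sg1).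
have ru := Av_u e01 t01 m0 qm mte.
rewrite invrK in r1; rewrite invf_div in r2.
set X := 4 * (2 * kappa) / n%:R + 5 * n%:R * (6 * kappa * eta) in r1 r2.
have XK : X * (4 / d) + X * 5 = 8 * (kappa * Kp) / n%:R + 30 * n%:R * (kappa * Kp) * eta.
  by rewrite -mulrDr -/Kp /X; ring.
have eC' : eta * C <= eps / 4 by lra.
rewrite /C in eC'.
lra.
Qed.

Lemma kappa_le_ell : kappa <= ell u.
Proof.
have [[d [e [d0 Ne hd]]]|H] := pselect (exists d e, [/\ 0 < d, N e = 1 &
    forall s, d <= N (e - s *: u)]).
  exact: kappa_le_ell_away hd.
apply: kappa_le_ell_degenerate => d e d0 Ne; apply: contrapT => Hs.
apply: H; exists d, e; split=> // s; rewrite leNgt; apply/negP => ds.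
by apply: Hs; exists s.
Qed.

End Unit.

(** Here [kappa] is the norm of [ell], so the conclusion is that [ell] attains its
    norm at [u]. The average of the transported functionals is at most about
    [ell u] at [u], at least about [kappa] at a suitable unit vector, and nearly
    constant on the unit sphere. *)
Theorem flow_norming (u : E) (K : R) : 0 <= K ->
  (forall c, 1 <= c -> Lam c u <= ell u + K * (c - 1)) ->
  kappa * N u <= ell u.
Proof.
move=> K0 hu; have := seminorm_ge0 hN u; rewrite le_eqVlt => /predU1P[Nu|Nu].
  by have := ell_ge u; rewrite -Nu mulr0; lra.
rewrite -ler_pdivlMr// mulrC -(rlinearZ hell).
apply: (@kappa_le_ell _ ((N u)^-1 * K)).
- by rewrite (seminormZ hN) gtr0_norm ?invr_gt0// mulVf ?gt_eqF.
- by rewrite mulr_ge0// invr_ge0 ltW.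
- move=> c c1; rewrite (sublinearZ (hLam c1)) ?invr_ge0 ?(ltW Nu)//.
  by rewrite (rlinearZ hell) -mulrA -mulrDr ler_pM2l ?invr_gt0// hu.
Qed.

End Flow.

(** * Real parts of scalars *)

(** The real and the complex case are treated together through the real part
    [re]: by [complexify] a real-linear functional is the real part of a
    scalar-linear one, and by [re_im] two real parts determine a scalar. *)
Record real_form (R : realType) (K : numFieldType) (emb : {rmorphism R -> K})
    (re : K -> R) : Prop := RealForm {
  emb_ge0 : forall a, (0 <= emb a) = (0 <= a);
  reD : forall x y, re (x + y) = re x + re y;
  reM : forall a x, re (emb a * x) = a * re x;
  re1 : re 1 = 1;
  ge0_emb : forall x, 0 <= x -> x = emb (re x);
  re_le_norm : forall x, re x <= re `|x|;
  re_im : exists j j' : K, [/\ `|j| <= 1, `|j'| <= 1 &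
    forall x, x = emb (re x) + j * emb (re (j' * x))];
  complexify : forall (V : lmodType K) (g : V -> R),
    (forall x y, g (x + y) = g x + g y) ->
    (forall a x, g (emb a *: x) = a * g x) ->
    exists F : V -> K, (forall a x y, F (a *: x + y) = a * F x + F y) /\
      forall x, re (F x) = g x }.

Lemma real_form_real (R : realType) : real_form (idfun : {rmorphism R -> R}) id.
Proof.
split=> //=.
- by move=> x; exact: ler_norm.
- by exists 0, 0; split; rewrite ?normr0// => x; rewrite mul0r addr0.
- by move=> V g gD gZ; exists g; split=> // a x y; rewrite gD gZ.
Qed.

Lemma real_form_complex (R : realType) :
  real_form (real_complex R : {rmorphism R -> R[i]}) (@complex.Re R).
Proof.
split=> //=.
- by move=> a; rewrite ler0c.
- by case=> a b [c d].
- by move=> a [b c] /=; rewrite mul0r subr0.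
- by case=> a b; rewrite lecE/= => /andP[/eqP -> _].
- case=> a b /=.
  by rewrite (le_trans (ler_norm _))// -sqrtr_sqr ler_wsqrtr// lerDl sqr_ge0.
- exists 'i%C, (- 'i%C); split=> [||x].
  + by rewrite normc_def/= expr0n expr1n add0r sqrtr1.
  + by rewrite normrN normc_def/= expr0n expr1n add0r sqrtr1.
  + by case: x => a b; simpc.
- move=> V g gD gZ; pose i : R[i] := 'i%C.
  exists (fun x => (g x +i* (- g (i *: x)))%C).
  have gN x : g (- x) = - g x.
    by rewrite -scaleN1r -(rmorphN1 (real_complex R)) gZ mulN1r.
  have ii : i * i = -1 by rewrite -expr2 sqr_i.
  split=> // -[a b] x y.
  have E1 : (a +i* b)%C = (a%:C + b%:C * i)%C by simpc.
  rewrite [X in X *: x]E1 !scalerDl !scalerDr !gD -!scalerA !gZ.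
  rewrite [i *: (_ *: x)]scalerA [i * _]mulrC -scalerA gZ.
  rewrite [i *: (b%:C%C *: (i *: x))]scalerA [i * b%:C%C]mulrC -scalerA gZ scalerA ii.
  by rewrite scaleN1r gN; apply/eqP; rewrite eq_complex/=; simpc.
Qed.

(** The same space with scalars restricted to [R], to which the real Hahn-Banach
    theorem applies. *)
Definition realify (R : realType) (K : numFieldType) (emb : {rmorphism R -> K})
  (V : lmodType K) : Type := V.

Section Realify.
Context (R : realType) (K : numFieldType) (emb : {rmorphism R -> K}) (V : lmodType K).
HB.instance Definition _ := GRing.Zmodule.on (realify emb V).
Let scale (a : R) (x : realify emb V) : realify emb V := emb a *: (x : V).
Fact realify_scaleA a b x : scale a (scale b x) = scale (a * b) x.
Proof. by rewrite /scale scalerA rmorphM. Qed.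
Fact realify_scale1 : left_id 1 scale.
Proof. by move=> x; rewrite /scale rmorph1 scale1r. Qed.
Fact realify_scaleDr : right_distributive scale +%R.
Proof. by move=> a x y; rewrite /scale scalerDr. Qed.
Fact realify_scaleDl x : {morph scale^~ x : a b / a + b}.
Proof. by move=> a b; rewrite /scale rmorphD scalerDl. Qed.
HB.instance Definition _ := GRing.Zmodule_isLmodule.Build R (realify emb V)
  realify_scaleA realify_scale1 realify_scaleDr realify_scaleDl.
Lemma realify_scaleE a (x : realify emb V) : a *: x = emb a *: (x : V).
Proof. by []. Qed.
End Realify.

Section Scalars.
Context (R : realType) (K : numFieldType) (emb : {rmorphism R -> K}) (re : K -> R).
Hypothesis H : real_form emb re.
Implicit Types (x y z : K) (a b : R).

Lemma re0 : re 0 = 0.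
Proof. by have := reM H 0 0; rewrite mulr0 mul0r. Qed.
Lemma reN x : re (- x) = - re x.
Proof. by have := reM H (-1) x; rewrite rmorphN1 !mulN1r. Qed.
Lemma reB x y : re (x - y) = re x - re y.
Proof. by rewrite (reD H) reN. Qed.
Lemma reK a : re (emb a) = a.
Proof. by have := reM H a 1; rewrite !mulr1 (re1 H) mulr1. Qed.
Lemma emb_le a b : (emb a <= emb b) = (a <= b).
Proof. by rewrite -subr_ge0 -rmorphB (emb_ge0 H) subr_ge0. Qed.
Lemma emb_lt a b : (emb a < emb b) = (a < b).
Proof. by rewrite !lt_neqAle emb_le fmorph_eq. Qed.
Lemma re_ge0 x : 0 <= x -> 0 <= re x.
Proof. by move=> x0; rewrite -(emb_ge0 H) -(ge0_emb H). Qed.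
Lemma re_mono x y : x <= y -> re x <= re y.
Proof. by rewrite -subr_ge0 => /re_ge0; rewrite reB subr_ge0. Qed.
Lemma norm_emb z : `|z| = emb (re `|z|).
Proof. by apply: (ge0_emb H); exact: normr_ge0. Qed.
Lemma rn_ge0 z : 0 <= re `|z|.
Proof. exact: re_ge0. Qed.
Lemma le_emb x a : 0 <= x -> (x <= emb a) = (re x <= a).
Proof. by move=> x0; rewrite {1}(ge0_emb H x0) emb_le. Qed.
Lemma emb_lex x a : 0 <= x -> (emb a <= x) = (a <= re x).
Proof. by move=> x0; rewrite {1}(ge0_emb H x0) emb_le. Qed.
Lemma reM_ge0 x y : 0 <= x -> re (x * y) = re x * re y.
Proof. by move=> x0; rewrite {1}(ge0_emb H x0) (reM H). Qed.
Lemma rnM x y : re `|x * y| = re `|x| * re `|y|.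
Proof. by rewrite normrM reM_ge0. Qed.
Lemma rnD x y : re `|x + y| <= re `|x| + re `|y|.
Proof. by rewrite -(reD H) re_mono// ler_normD. Qed.
Lemma rn_emb a : re `|emb a| = `|a|.
Proof.
have [a0|a0] := leP 0 a; first by rewrite !ger0_norm ?reK ?(emb_ge0 H).
rewrite (ltr0_norm a0) -normrN -rmorphN ger0_norm ?reK// (emb_ge0 H) oppr_ge0.
exact: ltW.
Qed.
Lemma re_ge_norm x : - re `|x| <= re x.
Proof. by rewrite lerNl -reN -normrN (re_le_norm H). Qed.

Lemma exists_rotation z : exists2 l, `|l| = 1 & l * z = `|z|.
Proof.
have [->|z0] := eqVneq z 0; first by exists 1; rewrite ?normr1 ?mulr0 ?normr0.
exists (`|z| / z); last by rewrite divfK.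
by rewrite normf_div normr_id divff// normr_eq0.
Qed.

Lemma re_eq0 z : (forall l, `|l| = 1 -> re (l * z) = 0) -> z = 0.
Proof.
have [l l1 lz] := exists_rotation z; move=> /(_ l l1).
by rewrite lz => h; apply/eqP; rewrite -normr_eq0 norm_emb h rmorph0.
Qed.

Lemma supremum_lub (A : set K) (M : K) :
  A !=set0 -> (forall x, A x -> 0 <= x <= M) ->
  [/\ 0 <= supremum 0 A, forall x, A x -> x <= supremum 0 A &
      forall y, (forall x, A x -> x <= y) -> supremum 0 A <= y].
Proof.
move=> A0 AM; have [a Aa] := A0.
have hs : has_sup [set re x | x in A].
  split; first by exists (re a), a.
  by exists (re M) => _ [x Ax <-]; apply: re_mono; have /andP[] := AM _ Ax.
have ss : supremums A (emb (sup [set re x | x in A])).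
  split=> [x Ax|y yA].
    have /andP[x0 _] := AM _ Ax.
    rewrite le_emb//; apply: ub_le_sup; first exact: hs.2.
    by exists x.
  have y0 : 0 <= y.
    by have /andP[a0 _] := AM _ Aa; exact: le_trans a0 (yA _ Aa).
  rewrite emb_lex//; apply: ge_sup; first exact: hs.1.
  by move=> _ [x Ax <-]; apply: re_mono; exact: yA.
have [u l] : supremums A (supremum 0 A).
  rewrite /supremum ifF; last by apply/negbTE/set0P.
  by case: xgetP => [y _ //|/(_ _ ss)].
split=> //; have /andP[a0 _] := AM _ Aa; exact: le_trans a0 (u _ Aa).
Qed.

Lemma infimum_le (A : set K) :
  (forall x, A x -> 0 <= x) -> forall x, A x -> infimum 0 A <= x.
Proof.
move=> A0 a Aa.
have hi : has_inf [set re x | x in A].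
  split; first by exists (re a), a.
  by exists 0 => _ [x Ax <-]; apply: re_ge0; exact: A0.
have ss : infimums A (emb (inf [set re x | x in A])).
  split=> [x Ax|y yA].
    rewrite emb_lex ?A0//; apply: ge_inf; first exact: hi.2.
    by exists x.
  have yE : y = emb (re y).
    have d0 : 0 <= a - y by rewrite subr_ge0 yA.
    have -> : y = a - (a - y) by rewrite subKr.
    by rewrite {1}(ge0_emb H d0) {1}(ge0_emb H (A0 _ Aa)) -rmorphB [re (a - (a - y))]reB.
  rewrite yE emb_le; apply: lb_le_inf; first exact: hi.1.
  by move=> _ [x Ax <-]; apply: re_mono; exact: yA.
have [u l] : infimums A (infimum 0 A).
  rewrite /infimum ifF; last by apply/negbTE/set0P; exists a.
  by case: xgetP => [y _ //|/(_ _ ss)].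
exact: u.
Qed.
End Scalars.

(** * Dual norms and the numerical radius *)

Section Evaluation.
Context (K : numFieldType) (V : lmodType K) (p : V -> K) (W : normedModType K).

Lemma blinDE (f g : blin p W) x : (f + g) x = f x + g x.
Proof. by []. Qed.
Lemma blinZE a (f : blin p W) x : (a *: f) x = a *: f x.
Proof. by []. Qed.
Lemma blinNE (f : blin p W) x : (- f) x = - f x.
Proof. by []. Qed.
Lemma dualZE a (f : dual p) x : (a *: f) x = a * f x.
Proof. by []. Qed.
Lemma blin_eq (f g : blin p W) : (forall x, f x = g x) -> f = g.
Proof. by move=> fg; apply/val_inj/funext. Qed.

Lemma blinP (f : blin p W) a x y : f (a *: x + y) = a *: f x + f y.
Proof. by case: f => f /= /asboolP[lf _]; exact: lf. Qed.
End Evaluation.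

Record kseminorm (K : numFieldType) (V : lmodType K) (p : V -> K) : Prop := {
  ksD : forall x y, p (x + y) <= p x + p y;
  ksZ : forall a x, p (a *: x) = `|a| * p x;
  ks_ge0 : forall x, 0 <= p x }.

Section Norms.
Context (R : realType) (K : numFieldType) (emb : {rmorphism R -> K}) (re : K -> R).
Hypothesis H : real_form emb re.

Lemma ks0 (V : lmodType K) (p : V -> K) : kseminorm p -> p 0 = 0.
Proof. by move=> hp; rewrite -(scale0r 0) (ksZ hp) normr0 mul0r. Qed.
Lemma ksN (V : lmodType K) (p : V -> K) x : kseminorm p -> p (- x) = p x.
Proof. by move=> hp; rewrite -scaleN1r (ksZ hp) normrN1 mul1r. Qed.

Section Opnorm.
Context (V : lmodType K) (p : V -> K) (hp : kseminorm p) (W : normedModType K).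
Implicit Type f : blin p W.

Lemma blin0 f : f 0 = 0.
Proof. by have := blinP f (-1) 0 0; rewrite !scaleN1r oppr0 addr0 addNr. Qed.
Lemma blinD f x y : f (x + y) = f x + f y.
Proof. by have := blinP f 1 x y; rewrite !scale1r. Qed.
Lemma blinZ f a x : f (a *: x) = a *: f x.
Proof. by have := blinP f a x 0; rewrite blin0 !addr0. Qed.
Lemma blinN f x : f (- x) = - f x.
Proof. by rewrite -scaleN1r blinZ scaleN1r. Qed.
Lemma blinB f x y : f (x - y) = f x - f y.
Proof. by rewrite blinD blinN. Qed.

Lemma blin_bounded f : exists M : K, 0 <= M /\ forall x, `|f x| <= M * p x.
Proof.
case: f => f /= /asboolP[_ [M fM]]; exists `|M|; split=> // x.
apply: le_trans (fM x) _.
have Mp := le_trans (normr_ge0 _) (fM x).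
by rewrite -(ger0_norm Mp) normrM (ger0_norm (ks_ge0 hp x)).
Qed.

Lemma opnorm_lub f : [/\ 0 <= opnorm f,
  forall x, p x <= 1 -> `|f x| <= opnorm f &
  forall y, (forall x, p x <= 1 -> `|f x| <= y) -> opnorm f <= y].
Proof.
have [M [M0 fM]] := blin_bounded f.
have [||h0 h1 h2] := @supremum_lub R K emb re H
    [set `|f x| | x in [set x | p x <= 1]] M.
- by exists `|f 0|, 0 => //=; rewrite ks0.
- move=> _ [x /= px <-]; rewrite normr_ge0/=; apply: le_trans (fM x) _.
  by rewrite -[leRHS]mulr1 ler_wpM2l.
split=> // [x px|y hy]; first by apply: h1; exists x.
by apply: h2 => _ [x px <-]; exact: hy.
Qed.

Lemma opnorm_ge0 f : 0 <= opnorm f. Proof. by have [] := opnorm_lub f. Qed.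

Lemma le_opnorm f x : `|f x| <= opnorm f * p x.
Proof.
have [h0 h1 _] := opnorm_lub f.
have := ks_ge0 hp x; rewrite le_eqVlt => /predU1P[px|px].
  have [M [_ fM]] := blin_bounded f.
  by have := fM x; rewrite -px !mulr0.
have := h1 ((p x)^-1 *: x); rewrite (ksZ hp) blinZ normrZ.
rewrite (gtr0_norm (_ : 0 < (p x)^-1)) ?invr_gt0// mulVf ?gt_eqF// => /(_ (lexx _)).
by rewrite ler_pdivrMl// mulrC.
Qed.

Lemma opnorm_le f c : 0 <= c -> (forall x, `|f x| <= c * p x) -> opnorm f <= c.
Proof.
move=> c0 fc; have [_ _ h2] := opnorm_lub f; apply: h2 => x px.
by apply: le_trans (fc x) _; rewrite -[leRHS]mulr1 ler_wpM2l.
Qed.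

Lemma opnorm_adherent f (eta : R) : 0 < eta ->
  exists2 x, p x <= 1 & re (opnorm f) - eta < re `|f x|.
Proof.
move=> e0; apply: contrapT => Hx.
have [h0 h1 h2] := opnorm_lub f.
have : opnorm f <= emb (re (opnorm f) - eta).
  apply: h2 => x px; rewrite (le_emb H)// leNgt; apply/negP => hx.
  by apply: Hx; exists x.
by rewrite (le_emb H)//; lra.
Qed.

Lemma re_le_opnorm f x : re `|f x| <= re (opnorm f) * re (p x).
Proof. by rewrite -(reM_ge0 H) ?opnorm_ge0// (re_mono H)// le_opnorm. Qed.

Lemma re_opnorm_ge0 f : 0 <= re (opnorm f).
Proof. exact/(re_ge0 H)/opnorm_ge0. Qed.

Lemma opnormE f : opnorm f = emb (re (opnorm f)).
Proof. by apply: (ge0_emb H); exact: opnorm_ge0. Qed.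

Lemma re_opnorm_le f (c : R) : 0 <= c ->
  (forall x, re `|f x| <= c * re (p x)) -> re (opnorm f) <= c.
Proof.
move=> c0 fc; rewrite -(le_emb H) ?opnorm_ge0//; apply: opnorm_le.
  by rewrite (emb_ge0 H).
move=> x; rewrite (ge0_emb H (ks_ge0 hp x)) -rmorphM (le_emb H)//.
Qed.

Lemma mem_bounded_linear (f : V -> W) (M : R) :
  (forall a x y, f (a *: x + y) = a *: f x + f y) ->
  (forall x, re `|f x| <= M * re (p x)) -> f \in bounded_linear p W.
Proof.
move=> lf fM; apply/asboolP; split; first by move=> a x y; exact: lf.
exists (emb M) => x; rewrite (ge0_emb H (ks_ge0 hp x)) -rmorphM.
by rewrite (le_emb H).
Qed.
End Opnorm.

Section DualNorm.
Context (V : lmodType K) (p : V -> K) (hp : kseminorm p).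
Implicit Type f : dual p.

Lemma dualZ f a x : f (a *: x) = a * f x. Proof. exact: blinZ. Qed.
Lemma dualP f a x y : f (a *: x + y) = a * f x + f y. Proof. exact: blinP. Qed.

Lemma dual_norm_ge0 f : 0 <= dual_norm p f.
Proof. exact: opnorm_ge0. Qed.

Lemma le_dual_norm f x : `|f x : K| <= dual_norm p f * p x.
Proof. exact: le_opnorm. Qed.

Lemma kseminorm_dual : kseminorm (dual_norm p).
Proof.
split=> [f g|a f|f]; last exact: dual_norm_ge0.
- apply: opnorm_le => //; first by rewrite addr_ge0// dual_norm_ge0.
  move=> x; apply: le_trans (ler_normD _ _) _.
  by rewrite mulrDl lerD// le_dual_norm.
- have Zle b g : dual_norm p (b *: g) <= `|b| * dual_norm p g.
    apply: opnorm_le => //; first by rewrite mulr_ge0// dual_norm_ge0.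
    move=> x; rewrite -[leLHS]/(`|b * g x|) normrM -mulrA.
    by rewrite ler_wpM2l// le_dual_norm.
  apply/eqP; rewrite eq_le Zle/=.
  have [->|a0] := eqVneq a 0; first by rewrite normr0 mul0r dual_norm_ge0.
  rewrite -ler_pdivlMl ?normr_gt0//.
  by have := Zle a^-1 (a *: f); rewrite scalerA mulVf// scale1r normfV.
Qed.

Lemma dual_adherent f (eta : R) : 0 < eta ->
  exists2 x, p x <= 1 & re (dual_norm p f) - eta < re (f x) /\ f x = `|f x| :> K.
Proof.
move=> /(opnorm_adherent hp f)[x px fx].
have [l l1 lf] := exists_rotation (f x : K).
exists (l *: x); first by rewrite (ksZ hp) l1 mul1r.
by rewrite dualZ lf normr_id.
Qed.

(** A bound on the real part of [F] is a bound on its modulus, since the modulus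
    of [F x] is the real part of [F] at a rotation of [x]. *)
Lemma dual_of_real (g : V -> R) (c : R) : 0 <= c ->
  (forall x y, g (x + y) = g x + g y) ->
  (forall a x, g (emb a *: x) = a * g x) ->
  (forall x, g x <= c * re (p x)) ->
  exists2 f : dual p, (forall x, re (f x) = g x) & re (dual_norm p f) <= c.
Proof.
move=> c0 gD gZ gp; have [F [lF rF]] := complexify H gD gZ.
have F0 : F 0 = 0.
  by have := lF (-1) 0 0; rewrite !scaleN1r mulN1r oppr0 addr0 addNr.
have Fb x : re `|F x| <= c * re (p x).
  have [l l1 lx] := exists_rotation (F x).
  have : l * F x = F (l *: x) by rewrite -[l *: x]addr0 lF F0 addr0.
  rewrite lx => ->; rewrite rF; apply: le_trans (gp _) _.
  by rewrite (ksZ hp) l1 mul1r.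
have hF : (F : V -> K^o) \in bounded_linear p K^o.
  exact: (@mem_bounded_linear _ _ hp K^o F c lF Fb).
by exists (Blin hF) => //; apply: re_opnorm_le.
Qed.
End DualNorm.

Section Space.
Context (X : normedModType K).

Lemma kseminorm_norm : kseminorm (norm_of X).
Proof.
split=> [x y|a x|x]; rewrite /norm_of; [exact: ler_normD|exact: normrZ|exact: normr_ge0].
Qed.

Lemma norming_functional (x : X) : x != 0 ->
  exists2 f : dual (norm_of X), dual_norm (norm_of X) f = 1 & f x = `|x|.
Proof.
move=> x0; pose q (y : realify emb X) : R := re `|y : X|.
have hq : sublinear q.
  split=> [y z|t y t0]; rewrite /q.
    by rewrite -(reD H) (re_mono H)// ler_normD.
  by rewrite realify_scaleE normrZ (reM_ge0 H)// (rn_emb H) ger0_norm.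
have [g [lg gq gx]] := hahn_banach_support (x : realify emb X) hq.
have [||||f fg fn] := @dual_of_real X (norm_of X) kseminorm_norm g 1.
- by [].
- exact: (rlinearD lg).
- by move=> a y; have := rlinearZ lg a y.
- by move=> y; rewrite mul1r; exact: gq.
have [l l1 lf] := exists_rotation (f x : K).
pose h : dual (norm_of X) := l *: f.
have nx : re `|x| <= re `|f x : K|.
  by rewrite -[leLHS]gx -fg (re_le_norm H).
have nh : re (dual_norm (norm_of X) h) <= 1.
  by rewrite (ksZ (kseminorm_dual kseminorm_norm)) l1 mul1r.
have hx : h x = `|x|.
  rewrite -[LHS]/(l * f x) lf (norm_emb H) [RHS](ge0_emb H (normr_ge0 _)).
  congr (emb _); apply/eqP; rewrite eq_le nx andbT.
  have := re_le_opnorm kseminorm_norm f x.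
  move=> /le_trans; apply; apply: ler_piMl => //.
  by apply: (re_ge0 H); exact: normr_ge0.
exists h => //; apply/eqP; rewrite eq_le; apply/andP; split.
  by rewrite -(rmorph1 emb) (le_emb H) ?nh//; exact: (dual_norm_ge0 kseminorm_norm).
have := le_dual_norm kseminorm_norm h x; rewrite hx normr_id /norm_of.
by rewrite ler_pMl ?normr_gt0.
Qed.

Lemma operator_le (T : operators X) x : `|T x| <= opnorm T * `|x|.
Proof. exact: (le_opnorm kseminorm_norm). Qed.

Lemma pair_le (T : operators X) fx : norming_pairs (norm_of X) fx ->
  `|fx.1 (T fx.2) : K| <= opnorm T.
Proof.
case: fx => f x [/= f1 x1 _].
apply: le_trans (le_dual_norm kseminorm_norm _ _) _; rewrite f1 mul1r.
by apply: le_trans (operator_le _ _) _; rewrite -[`|x|]/(norm_of X x) x1 mulr1.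
Qed.

Lemma numerical_radius_lub (T : operators X) : [/\ 0 <= numerical_radius X T,
  forall fx, norming_pairs (norm_of X) fx ->
    `|fx.1 (T fx.2) : K| <= numerical_radius X T &
  forall y, 0 <= y -> (forall fx, norming_pairs (norm_of X) fx ->
    `|fx.1 (T fx.2) : K| <= y) -> numerical_radius X T <= y].
Proof.
pose A := [set (`|fx.1 (T fx.2)| : K) | fx in norming_pairs (norm_of X)].
have [A0|A0] := pselect (A !=set0).
  have [|h0 h1 h2] := @supremum_lub R K emb re H A (opnorm T) A0.
    by move=> _ [fx hfx <-]; rewrite normr_ge0 pair_le.
  split=> // [fx hfx|y y0 hy]; first by apply: h1; exists fx.
  by apply: h2 => _ [fx hfx <-]; exact: hy.
(* Without norming pairs, as for [X = 0], both sides vanish. *)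
have AE : A = set0 by apply/seteqP; split=> // a Aa; apply: A0; exists a.
have v0 : numerical_radius X T = 0.
  by rewrite /numerical_radius -/A AE supremum0.
rewrite v0; split=> // fx hfx; exfalso; apply: A0.
by exists (`|fx.1 (T fx.2)| : K), fx.
Qed.

Lemma numerical_radius_le (T : operators X) fx : norming_pairs (norm_of X) fx ->
  `|fx.1 (T fx.2) : K| <= numerical_radius X T.
Proof. by have [_ + _] := numerical_radius_lub T; apply. Qed.

Lemma numerical_radius_ge0 (T : operators X) : 0 <= numerical_radius X T.
Proof. by have [] := numerical_radius_lub T. Qed.

Lemma kseminorm_numerical_radius : kseminorm (numerical_radius X).
Proof.
split=> [S T|a T|T]; last exact: numerical_radius_ge0.
- have [_ _ h] := numerical_radius_lub (S + T); apply: h.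
    by rewrite addr_ge0// numerical_radius_ge0.
  move=> fx hfx; rewrite blinDE blinD; apply: le_trans (ler_normD _ _) _.
  by rewrite lerD// numerical_radius_le.
- have Zle b S : numerical_radius X (b *: S) <= `|b| * numerical_radius X S.
    have [_ _ h] := numerical_radius_lub (b *: S); apply: h.
      by rewrite mulr_ge0// numerical_radius_ge0.
    move=> fx hfx; rewrite blinZE dualZ normrM ler_wpM2l//.
    exact: numerical_radius_le.
  apply/eqP; rewrite eq_le Zle/=.
  have [->|a0] := eqVneq a 0; first by rewrite normr0 mul0r numerical_radius_ge0.
  rewrite -ler_pdivlMl ?normr_gt0//.
  by have := Zle a^-1 (a *: T); rewrite scalerA mulVf// scale1r normfV.
Qed.

Lemma kseminorm_compact : kseminorm (numerical_radius_compact X).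
Proof.
have [hD hZ h0] := kseminorm_numerical_radius.
by split=> [S T|a S|S]; rewrite /numerical_radius_compact; [exact: hD|exact: hZ|exact: h0].
Qed.

Lemma numerical_radius_opnorm (T : operators X) : numerical_radius X T <= opnorm T.
Proof.
have [_ _ h] := numerical_radius_lub T; apply: h; first exact: (opnorm_ge0 kseminorm_norm).
by move=> fx; exact: pair_le.
Qed.

Lemma numerical_index_le (T : operators X) :
  numerical_index X * opnorm T <= numerical_radius X T.
Proof.
have := opnorm_ge0 kseminorm_norm T; rewrite le_eqVlt => /predU1P[<-|T0].
  by rewrite mulr0 numerical_radius_ge0.
pose S : operators X := (opnorm T)^-1 *: T.
have inv0 : 0 < (opnorm T)^-1 by rewrite invr_gt0.
have vS : numerical_radius X S = (opnorm T)^-1 * numerical_radius X T.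
  by rewrite (ksZ kseminorm_numerical_radius) (gtr0_norm inv0).
suff : numerical_index X <= numerical_radius X S.
  by rewrite vS ler_pdivlMl// mulrC.
apply: (infimum_le H); first by move=> _ [U _ <-]; exact: numerical_radius_ge0.
exists S => //=; apply/eqP; rewrite eq_le; apply/andP; split.
  apply: (opnorm_le kseminorm_norm) => // x.
  rewrite blinZE normrZ (gtr0_norm inv0) ler_pdivrMl// mul1r.
  exact: (le_opnorm kseminorm_norm).
rewrite -(ler_pM2l T0) mulr1; apply: (opnorm_le kseminorm_norm).
  by rewrite mulr_ge0 ?(ltW T0)// (opnorm_ge0 kseminorm_norm).
move=> x; have -> : T x = opnorm T *: S x.
  by rewrite blinZE scalerA divff ?gt_eqF// scale1r.
rewrite normrZ (gtr0_norm T0) -mulrA ler_pM2l//.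
exact: (le_opnorm kseminorm_norm).
Qed.
End Space.
End Norms.

(** * Extreme functionals as limits of norming families *)

Lemma sublinear_sup (R : realType) (E : lmodType R) (I : Type) (B : set I)
    (g : I -> E -> R) (M : E -> R) : B !=set0 -> (forall i, rlinear (g i)) ->
  (forall i x, B i -> g i x <= M x) ->
  sublinear (fun x => sup [set g i x | i in B]).
Proof.
move=> [i0 Bi0] lg gM.
have hs x : has_sup [set g i x | i in B].
  by split; [exists (g i0 x), i0|exists (M x) => _ [i Bi <-]; exact: gM].
split=> [x y|t x].
  apply: ge_sup; first exact: (hs _).1.
  move=> _ [i Bi <-]; rewrite (rlinearD (lg i)).
  by apply: lerD; apply: ub_le_sup; [exact: (hs _).2|exists i|exact: (hs _).2|exists i].
rewrite le_eqVlt => /predU1P[<-|t0].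
  rewrite mul0r scale0r [X in sup X](_ : _ = [set 0]) ?sup1//.
  apply/seteqP; split=> [_ [i _ <-]/=|_ ->]; first exact: rlinear0.
  by exists i0 => //; exact: rlinear0.
have key s y : 0 < s -> s * sup [set g i y | i in B] <= sup [set g i (s *: y) | i in B].
  move=> s0; rewrite -ler_pdivlMl//; apply: ge_sup; first exact: (hs _).1.
  move=> _ [i Bi <-]; rewrite ler_pdivlMl// -(rlinearZ (lg i)).
  by apply: ub_le_sup; [exact: (hs _).2|exists i].
apply/eqP; rewrite eq_le key// andbT -ler_pdivrMl//.
have := key t^-1 (t *: x); rewrite invr_gt0 => /(_ t0).
by rewrite scalerA mulVf ?scale1r// gt_eqF.
Qed.

Section Milman.
Context (R : realType) (K : numFieldType) (emb : {rmorphism R -> K}) (re : K -> R).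
Hypothesis H : real_form emb re.
Context (V : lmodType K) (p : V -> K) (hp : kseminorm p) (I : Type).
Context (a : I -> V -> K).
Hypothesis aP : forall i c x y, a i (c *: x + y) = c * a i x + a i y.
Hypothesis a_le : forall i x, re (a i x) <= re (p x).
Hypothesis a_norming : forall x eta, 0 < eta -> exists i, re (p x) - eta < re (a i x).

(** This says that [f] lies below the support function of the functionals with
    index in [B], that is, in their weak-star closed convex hull. *)
Definition dominated (f : dual p) (B : set I) :=
  forall x (eta : R), 0 < eta -> exists2 i, B i & re (f x) < re (a i x) + eta.

Let aR i : rlinear (fun x : realify emb V => re (a i x)).
Proof. by move=> t x y; rewrite realify_scaleE aP (reD H) (reM H). Qed.

(** By Hahn-Banach for the maximum of the two support functions on the space
    [V * V * R * R], the real part of [f] is [g1 + g2] with [g1] below [s] times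
    the support function of [B], [g2] below [t] times that of [C], and
    [s + t = 1]. Such a convex combination of points of the ball is trivial
    when [f] is extreme. *)
Lemma dominated_setU (f : dual p) (B C : set I) :
  extreme_points (dual_ball p) f -> dominated f (B `|` C) ->
  dominated f B \/ dominated f C.
Proof.
move=> [fb fext] dom.
have [B0|B0] := pselect (B !=set0); last first.
  by right=> x eta e0; have [i [Bi|Ci] hi] := dom x eta e0; [exfalso; apply: B0; exists i|exists i].
have [C0|C0] := pselect (C !=set0); last first.
  by left=> x eta e0; have [i [Bi|Ci] hi] := dom x eta e0; [exists i|exfalso; apply: C0; exists i].
pose s_ (D : set I) (x : realify emb V) := sup [set re (a i x) | i in D].
have s_sub D : D !=set0 -> sublinear (s_ D).
  by move=> D0; apply: (sublinear_sup D0 aR) => i x _; exact: a_le.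
have s_le D x i : D i -> re (a i x) <= s_ D x.
  move=> Di; apply: ub_le_sup; last by exists i.
  by exists (re (p x)) => _ [j _ <-]; exact: a_le.
have s_p D x : D !=set0 -> s_ D x <= re (p x).
  move=> [i Di]; apply: ge_sup; first by exists (re (a i x)), i.
  by move=> _ [j _ <-]; exact: a_le.
have s_dom D x : D !=set0 -> forall r : R, r <= s_ D x ->
    forall eta, 0 < eta -> exists2 i, D i & r < re (a i x) + eta.
  move=> [i Di] r hr eta e0.
  have hs : has_sup [set re (a i x) | i in D].
    by split; [exists (re (a i x)), i|exists (re (p x)) => _ [j _ <-]; exact: a_le].
  have [_ [j Dj <-] hj] := sup_adherent e0 hs.
  by exists j => //; rewrite -ltrBlDr; apply: le_lt_trans hj; rewrite lerD2r.
(* The last two coordinates are slack variables: they make [g] recover the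
   weights [s] and [t] of the two support functions. *)
pose E : lmodType R := ((realify emb V * realify emb V) * (R^o * R^o))%type.
pose q (z : E) : R := Num.max (s_ B z.1.1 + z.2.1) (s_ C z.1.2 + z.2.2).
have hq : sublinear q.
  have [BD BZ] := s_sub B B0; have [CD CZ] := s_sub C C0.
  split=> [z w|t z t0]; rewrite /q /=.
    have h1 := BD z.1.1 w.1.1; have h2 := CD z.1.2 w.1.2.
    rewrite ge_max; apply/andP; split.
      have : s_ B z.1.1 + z.2.1 <= Num.max (s_ B z.1.1 + z.2.1) (s_ C z.1.2 + z.2.2).
        by rewrite le_max lexx.
      have : s_ B w.1.1 + w.2.1 <= Num.max (s_ B w.1.1 + w.2.1) (s_ C w.1.2 + w.2.2).
        by rewrite le_max lexx.
      by lra.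
    have : s_ C z.1.2 + z.2.2 <= Num.max (s_ B z.1.1 + z.2.1) (s_ C z.1.2 + z.2.2).
      by rewrite le_max lexx orbT.
    have : s_ C w.1.2 + w.2.2 <= Num.max (s_ B w.1.1 + w.2.1) (s_ C w.1.2 + w.2.2).
      by rewrite le_max lexx orbT.
    by lra.
  by rewrite BZ// CZ// -!mulrDr maxr_pMr.
pose S : set (E * R) :=
  [set w | exists x c, w = (((x : realify emb V), x, ((c : R^o), c)), re (f x) + c)].
have [||||g [lg gq gS]] := @hahn_banach R E q S hq.
- exists 0, 0; rewrite (blin0 f) addr0 (re0 H) //.
- move=> _ _ [x [c ->]] [y [d ->]] /=; exists (x + y), (c + d).
  by rewrite (blinD f) (reD H) addrACA.
- move=> t _ t0 [x [c ->]] /=; exists (t *: x), (t * c).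
  by rewrite realify_scaleE (dualZ f) (reM H) mulrDr.
- move=> _ [x [c ->]] /=; rewrite /q /=.
  have h (D : set I) : re (f x) <= s_ D x -> re (f x) + c <= s_ D x + c by rewrite lerD2r.
  rewrite le_max; have [fB|fB] := leP (re (f x)) (s_ B x); first by apply/orP; left; exact: h.
  have [fC|fC] := leP (re (f x)) (s_ C x); first by apply/orP; right; exact: h.
  exfalso; pose eta := Num.min (re (f x) - s_ B x) (re (f x) - s_ C x).
  have e0 : 0 < eta by rewrite lt_min !subr_gt0 fB.
  have [i Di] := dom x eta e0; rewrite ltNge => /negP; apply.
  case: Di => Di.
    have := s_le B x i Di; have : eta <= re (f x) - s_ B x by rewrite ge_min lexx.
    by lra.
  have := s_le C x i Di; have : eta <= re (f x) - s_ C x by rewrite ge_min lexx orbT.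
  by lra.
have sB0 : s_ B 0 = 0 by exact: sublinear0 (s_sub _ B0).
have sC0 : s_ C 0 = 0 by exact: sublinear0 (s_sub _ C0).
pose s : R := g (0, 0, (1, 0)); pose t : R := g (0, 0, (0, 1)).
have gE (x y : realify emb V) (c d : R) : g (x, y, (c, d)) =
    g (x, 0, (0, 0)) + g (0, y, (0, 0)) + c * s + d * t.
  have -> : ((x, y, (c : R^o, d : R^o)) : E) =
     ((x, 0, (0, 0)) : E) + ((0, y, (0, 0)) : E) +
     c *: ((0, 0, (1, 0)) : E) + d *: ((0, 0, (0, 1)) : E).
    congr (_, _, (_, _)) => /=; rewrite ?scaler0 ?addr0 ?add0r//.
      by rewrite /GRing.scale/= mulr1.
    by rewrite /GRing.scale/= mulr1.
  by rewrite !(rlinearD lg) !(rlinearZ lg).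
have g0 : g (0, 0, (0, 0)) = 0 by exact: (rlinear0 lg).
have gst (c d : R) : c * s + d * t <= Num.max c d.
  by have := gq (0, 0, (c, d)); rewrite /q /= sB0 sC0 !add0r gE g0 !add0r.
have s0 : 0 <= s.
  have := gst (-1) 0; have -> : Num.max (-1) 0 = 0 :> R by rewrite max_r// lerN10.
  lra.
have t0 : 0 <= t.
  have := gst 0 (-1); have -> : Num.max 0 (-1) = 0 :> R by rewrite max_l// lerN10.
  lra.
have st : s + t = 1.
  apply/eqP; rewrite eq_le; apply/andP; split.
    by have := gst 1 1; rewrite maxxx !mul1r.
  have : S (((0 : realify emb V), 0, ((1 : R^o), 1)), re (f 0) + 1) by exists 0, 1.
  by move=> /gS /=; rewrite gE g0 (blin0 f) (re0 H) !mul1r !add0r.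
pose g1 x := g (x, 0, (0, 0)); pose g2 x := g (0, x, (0, 0)).
have g1D x y : g1 (x + y) = g1 x + g1 y.
  rewrite /g1 -(rlinearD lg); congr g.
  by congr (_, _, (_, _)) => /=; rewrite ?addr0.
have g2D x y : g2 (x + y) = g2 x + g2 y.
  rewrite /g2 -(rlinearD lg); congr g.
  by congr (_, _, (_, _)) => /=; rewrite ?addr0.
have g1Z c (x : V) : g1 (emb c *: x) = c * g1 x.
  rewrite /g1 -(rlinearZ lg); congr g.
  by congr (_, _, (_, _)) => /=; rewrite ?scaler0.
have g2Z c (x : V) : g2 (emb c *: x) = c * g2 x.
  rewrite /g2 -(rlinearZ lg); congr g.
  by congr (_, _, (_, _)) => /=; rewrite ?scaler0.
have g1s x : g1 x <= s * s_ B x.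
  have := gq (x, 0, (- s_ B x, 0)); rewrite /q /= subrr sC0 addr0 maxxx gE.
  rewrite -/(g1 x) -/(g2 0).
  have -> : g2 0 = 0 by have := g2Z 0 0; rewrite scaler0 mul0r.
  lra.
have g2s x : g2 x <= t * s_ C x.
  have := gq (0, x, (0, - s_ C x)); rewrite /q /= subrr sB0 addr0 maxxx gE.
  rewrite -/(g1 0) -/(g2 x).
  have -> : g1 0 = 0 by have := g1Z 0 0; rewrite scaler0 mul0r.
  lra.
have fE x : re (f x) = g1 x + g2 x.
  have h y : re (f y) <= g1 y + g2 y.
    have : S ((y, y, ((0 : R^o), 0)), re (f y) + 0) by exists y, 0.
    by move=> /gS/=; rewrite gE !mul0r !addr0.
  apply/eqP; rewrite eq_le h/=.
  have := h (- x); rewrite (blinN f) (reN H).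
  have -> : g1 (- x) = - g1 x by have := g1Z (-1) x; rewrite rmorphN1 scaleN1r mulN1r.
  have -> : g2 (- x) = - g2 x by have := g2Z (-1) x; rewrite rmorphN1 scaleN1r mulN1r.
  lra.
have gnul (g' : V -> R) (D : set I) : D !=set0 -> (forall c (x : V), g' (emb c *: x) = c * g' x) ->
   (forall x, g' x <= 0 * s_ D x) -> forall x, g' x = 0.
  move=> D0 gZ gs x; have h y : g' y <= 0 by have := gs y; rewrite mul0r.
  have := h (- x); have -> : g' (- x) = - g' x.
    by have := gZ (-1) x; rewrite rmorphN1 scaleN1r mulN1r.
  by move=> h1; apply/eqP; rewrite eq_le h/= -oppr_le0.
have [s00|s00] := eqVneq s 0.
  right=> x; apply: s_dom => //.
  have t1 : t = 1 by move: st; rewrite s00 add0r.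
  rewrite fE (gnul g1 B) ?add0r//; last by move=> y; have := g1s y; rewrite s00.
  by have := g2s x; rewrite t1 mul1r.
have [t00|t00] := eqVneq t 0.
  left=> x; apply: s_dom => //.
  have s1 : s = 1 by move: st; rewrite t00 addr0.
  rewrite fE (gnul g2 C) ?addr0//; last by move=> y; have := g2s y; rewrite t00.
  by have := g1s x; rewrite s1 mul1r.
have sp : 0 < s by rewrite lt0r s00.
have tp : 0 < t by rewrite lt0r t00.
have mk (g' : V -> R) c (D : set I) : 0 < c -> D !=set0 ->
    (forall x y, g' (x + y) = g' x + g' y) ->
    (forall c (x : V), g' (emb c *: x) = c * g' x) ->
    (forall x, g' x <= c * s_ D x) ->
    exists2 h : dual p, dual_ball p h & forall x, re (h x) = c^-1 * g' x.
  move=> c0 D0 gD gZ gs.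
  have [||||h hg hn] := @dual_of_real R K emb re H V p hp (fun x => c^-1 * g' x) 1.
  - by [].
  - by move=> x y; rewrite gD mulrDr.
  - by move=> b x; rewrite gZ mulrCA.
  - move=> x; rewrite mul1r; apply: le_trans (s_p D x D0).
    by rewrite ler_pdivrMl.
  exists h => //; rewrite /dual_ball /= -(rmorph1 emb) (le_emb H)//.
  exact: (dual_norm_ge0 H hp).
have [h1 h1b h1E] := mk g1 s B sp B0 g1D g1Z g1s.
have [h2 h2b h2E] := mk g2 t C tp C0 g2D g2Z g2s.
have [||h1f _] := fext (emb s) h1 h2 h1b h2b.
- rewrite -(rmorph0 emb) -(rmorph1 emb) !(emb_lt H) sp/=; lra.
- apply: blin_eq => x; apply/eqP; rewrite -subr_eq0; apply/eqP; apply: (re_eq0 H) => l l1.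
  rewrite mulrBr -dualZ blinDE !blinZE mulrDr (reB H) (reD H).
  have -> : 1 - emb s = emb t by rewrite -(rmorph1 emb) -rmorphB -st addrAC subrr add0r.
  rewrite -[emb s *: h1 x]/(emb s * h1 x) -[emb t *: h2 x]/(emb t * h2 x).
  rewrite mulrCA [l * (emb t * _)]mulrCA !(reM H) -!dualZ fE h1E h2E.
  by rewrite !mulVKf// subrr.
left=> x; apply: s_dom => //.
by rewrite -h1f h1E ler_pdivrMl.
Qed.

(** A form of Milman's converse to the Krein-Milman theorem: an extreme functional
    is a pointwise limit of any norming family. By [dominated_setU] the sets
    whose complement does not dominate [f] form a filter, and each member of a
    finer ultrafilter dominates [f], which rules out that [re (a i x)] stays away
    from [re (f x)] along it. *)
Lemma extreme_ultra (f : dual p) : extreme_points (dual_ball p) f ->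
  exists U : set_system I, UltraFilter U /\
    forall x, (fun i => a i x : K^o) @ U --> (f x : K^o).
Proof.
move=> fext.
have [fb _] := fext.
pose F : set_system I := [set B | ~ dominated f (~` B)].
have FF : Filter F.
  split.
  - by move=> /(_ 0 1 ltr01)[i /= []].
  - move=> P Q FP FQ; rewrite /F/= setCI => dPQ.
    by have [] := dominated_setU fext dPQ.
  - move=> P Q PQ FP dQ; apply: (FP : ~ dominated f (~` P)) => x eta e0.
    by have [i Qi hi] := dQ x eta e0; exists i => // Pi; apply: Qi; exact: PQ.
have PF : ProperFilter F.
  apply: Build_ProperFilter_ex => // B FB; apply: contrapT => B0.
  apply: (FB : ~ dominated f (~` B)) => x eta e0.
  have [i hi] := a_norming x e0; exists i; first by move=> Bi; apply: B0; exists i.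
  have : re (f x) <= re (p x).
    apply: le_trans (re_le_norm H _) _; apply: (re_mono H).
    apply: le_trans (le_dual_norm H hp f x) _.
    by rewrite -[leRHS]mul1r ler_wpM2r// (ks_ge0 hp).
  by lra.
have [U [UU FU]] := ultraFilterLemma PF.
have UP : ProperFilter U by exact: ultra_proper.
have UF : Filter U by exact: filter_filter.
exists U; split=> // x.
have Udom B : U B -> dominated f B.
  move=> UB; apply: contrapT => dB.
  have /FU UC : F (~` B) by rewrite /F/= setCK.
  have : U (B `&` ~` B) by exact: filterI.
  by rewrite setICr => h; have [] := filter_ex h.
have a0 i : a i 0 = 0.
  by have := aP i (-1) 0 0; rewrite scaler0 addr0 mulN1r addNr.
have aN i y : a i (- y) = - a i y.
  by rewrite -[- y]addr0 -scaleN1r aP a0 addr0 mulN1r.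
have up y (eta : R) : 0 < eta -> U [set i | re (a i y) <= re (f y) + eta].
  move=> e0; have [//|/Udom/(_ (- y) eta e0)[i /= hi]] :=
    in_ultra_setVsetC [set i | re (a i y) <= re (f y) + eta] UU.
  rewrite aN.
  rewrite (blinN f) !(reN H) => h; exfalso; apply: hi.
  by move: h; lra.
have near y (eta : R) : 0 < eta -> U [set i | `|re (a i y - f y)| <= eta].
  move=> e0; apply: filterS (filterI (up y eta e0) (up (- y) eta e0)).
  move=> i [/= h1].
  rewrite aN.
  by rewrite (blinN f) !(reN H) (reB H) ler_norml => h2; apply/andP; split; lra.
have [j [j' [j1 j'1 jE]]] := re_im H.
apply/cvgrPdist_lt => eps eps0.
have e0 : 0 < re eps by rewrite -(emb_lt H) rmorph0 -(ge0_emb H) // ltW.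
pose eta := re eps / 3.
have eta0 : 0 < eta by rewrite divr_gt0.
apply: filterS (filterI (near x eta eta0) (near (j' *: x) eta eta0)).
move=> i [/= h1 h2]; rewrite distrC.
pose z := a i x - f x.
have zj : a i (j' *: x) - f (j' *: x) = j' * z.
  by rewrite -[j' *: x]addr0 aP a0 !addr0 (dualZ f) mulrBr.
rewrite zj in h2; rewrite -/z in h1 *.
rewrite (norm_emb H) (ge0_emb H (ltW eps0)) (emb_lt H).
rewrite [z]jE; apply: le_lt_trans (rnD H _ _) _.
rewrite (rnM H) !(rn_emb H).
have hj : re `|j| <= 1 by rewrite -(re1 H) (re_mono H).
have : re `|j| * `|re (j' * z)| <= 1 * eta by rewrite ler_pM// (rn_ge0 H).
rewrite mul1r /eta in h1 h2 *; lra.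
Qed.
End Milman.

(** * Compact operators and limits along ultrafilters *)

Lemma ultra_fmap (I T : Type) (U : set_system I) (g : I -> T) :
  UltraFilter U -> UltraFilter (g @ U).
Proof.
move=> UU; have UP : ProperFilter U by exact: ultra_proper.
split; first exact: fmap_proper_filter.
move=> G PG UG; apply/seteqP; split=> // P GP.
have [//|UC] := in_ultra_setVsetC (g @^-1` P) UU.
have GC : G (~` P) by apply: UG.
have : G (P `&` ~` P) by exact: filterI.
by rewrite setICr => h; have [] := filter_ex h.
Qed.

Lemma ultra_compact (I : Type) (T : topologicalType) (U : set_system I) (g : I -> T) (A : set T) :
  UltraFilter U -> compact A -> (forall i, A (g i)) -> exists2 y, A y & g @ U --> y.
Proof.
move=> UU; rewrite compact_ultra => cA Ag.
have UP : ProperFilter U by exact: ultra_proper.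
have gA : (g @ U) A by apply: (@filterS _ U _ setT) => [i _|]; [exact: Ag|exact: filterT].
by have [y [Ay gy]] := cA _ (ultra_fmap g UU) gA; exists y.
Qed.

Section Operations.
Context (R : realType) (K : numFieldType) (emb : {rmorphism R -> K}) (re : K -> R).
Hypothesis H : real_form emb re.

Lemma cvg_emb_comb (W : normedModType K) (x y : W) :
  continuous (fun ab : R^o * R^o => emb ab.1 *: x + emb ab.2 *: y).
Proof.
have c_emb : continuous (emb : R^o -> K^o).
  move=> a; apply/cvgrPdist_lt => eps eps0.
  have e0 : 0 < re eps by rewrite -(emb_lt H) rmorph0 -(ge0_emb H) // ltW.
  near=> b; rewrite -rmorphB (norm_emb H) (rn_emb H) (ge0_emb H (ltW eps0)) (emb_lt H).
  near: b; exact: (@cvgr_dist_lt _ _ _ _ _ id a cvg_id).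
move=> u; apply: cvgD; apply: cvgZr_tmp.
- apply: (@cvg_comp _ _ _ fst emb _ (nbhs u.1)); first exact: cvg_fst.
  exact: c_emb.
- apply: (@cvg_comp _ _ _ snd emb _ (nbhs u.2)); first exact: cvg_snd.
  exact: c_emb.
Unshelve. all: end_near. Qed.

(** By [re_im], the disc is contained in a continuous image of the compact square
    of real parts [- c, c]. *)
Lemma disc_compact (W : normedModType K) (x : W) (c : R) :
  exists2 A : set W, compact A & forall z : K, re `|z| <= c -> A (z *: x).
Proof.
have [j [j' [j1 j'1 jE]]] := re_im H.
pose g (ab : R^o * R^o) : W := emb ab.1 *: x + emb ab.2 *: (j *: x).
exists (g @` ([set` `[- c, c]] `*` [set` `[- c, c]])).
  apply: continuous_compact; last by apply: compact_setX; exact: segment_compact.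
  by apply: continuous_subspaceT; exact: cvg_emb_comb.
move=> z zc; exists (re z, re (j' * z)); last first.
  by rewrite /g/= scalerA -scalerDl mulrC -jE.
have h w : re `|w| <= c -> re w \in `[- c, c].
  move=> wc; rewrite in_itv/= (le_trans (re_le_norm H _) wc) andbT.
  by apply: le_trans (re_ge_norm H w); rewrite lerN2.
split; apply: h => //=; apply: le_trans zc.
rewrite (rnM H) -[leRHS]mul1r ler_wpM2r// ?(rn_ge0 H)//.
by rewrite -(re1 H) (re_mono H).
Qed.

Lemma lim_adherent (I : Type) (U : set_system I) (W : normedModType K) (g : I -> W)
    (y : W) (eta : R) : ProperFilter U ->
  g @ U --> y -> 0 < eta -> exists i, re `|y - g i| < eta.
Proof.
move=> UP gy e0; have eK : 0 < emb eta by rewrite -(rmorph0 emb) (emb_lt H).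
move: gy => /cvgrPdist_lt/(_ _ eK)/filter_ex[i hi].
by exists i; rewrite -(emb_lt H) -(ge0_emb H).
Qed.

Lemma lim_re_le (I : Type) (U : set_system I) (g : I -> K) (y : K) (c : R) :
  ProperFilter U -> (g : I -> K^o) @ U --> (y : K^o) -> (forall i, re (g i) <= c) -> re y <= c.
Proof.
move=> UP gy gc; apply/ler_addgt0Pl => eta e0.
have [i hi] := lim_adherent UP gy e0.
have -> : y = (y - g i) + g i by rewrite subrK.
by rewrite (reD H) lerD// (le_trans (re_le_norm H _))// ltW.
Qed.

Section Operators.
Context (X : normedModType K).
Local Notation norm := (norm_of X).
Local Notation kn := (kseminorm_norm X).

Fact op_id_subproof : (idfun : X -> X) \in bounded_linear norm X.
Proof. by apply/asboolP; split=> //; exists 1 => x; rewrite mul1r. Qed.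
Definition op_id : operators X := Blin op_id_subproof.

Fact op_comp_subproof (S T : operators X) : (S \o T : X -> X) \in bounded_linear norm X.
Proof.
apply/asboolP; split=> [a x y /=|]; first by rewrite blinP blinP.
exists (opnorm S * opnorm T) => x /=; rewrite -mulrA.
apply: le_trans (operator_le H S _) _.
by rewrite ler_wpM2l ?(opnorm_ge0 H kn)// (operator_le H).
Qed.
Definition op_comp (S T : operators X) : operators X := Blin (op_comp_subproof S T).

Fact rank_one_subproof (f : dual norm) (x : X) :
  ((fun y => (f y : K) *: x) : X -> X) \in bounded_linear norm X.
Proof.
apply/asboolP; split=> [a y z /=|]; first by rewrite dualP scalerDl scalerA.
exists (dual_norm norm f * `|x|) => y; rewrite normrZ mulrAC.
by rewrite ler_wpM2r// (le_dual_norm H kn).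
Qed.
Definition rank_one (f : dual norm) (x : X) : operators X := Blin (rank_one_subproof f x).

Lemma compact_opP (T : operators X) :
  reflect (exists2 A : set X, compact A & forall x, `|x| <= 1 -> A (T x))
    (T \in compact_operator X).
Proof.
have hX : hausdorff_space X by exact: norm_hausdorff.
apply: (iffP (asboolP _)) => [|[A cA AT]].
  rewrite precompactE => cT; exists (closure (T @` [set x | `|x| <= 1])) => // x x1.
  by apply: subset_closure; exists x.
apply: (@precompact_subset _ _ A) => [_ [x x1 <-]|]; first exact: AT.
by rewrite precompact_closed//; exact: compact_closed.
Qed.

Lemma compactZ a (T : operators X) : T \in compact_operator X -> a *: T \in compact_operator X.
Proof. exact: rpredZ. Qed.

Lemma compact_rank_one f x : rank_one f x \in compact_operator X.
Proof.
have [A cA hA] := disc_compact x (re (dual_norm norm f)).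
apply/compact_opP; exists A => // y y1; apply: hA; apply: (re_mono H).
apply: le_trans (le_dual_norm H kn f y) _.
by rewrite -[leRHS]mulr1 ler_wpM2l// (dual_norm_ge0 H kn).
Qed.

Lemma compact_comp (S T : operators X) :
  S \in compact_operator X -> op_comp S T \in compact_operator X.
Proof.
move=> /compact_opP[A cA AS].
(* [c^-1 *: T] maps the unit ball into itself. *)
pose c := opnorm T + 1.
have c0 : 0 < c by rewrite ltr_wpDl// (opnorm_ge0 H kn).
have -> : op_comp S T = c *: op_comp S (c^-1 *: T).
  apply: blin_eq => x; rewrite -[RHS]/(c *: S (c^-1 *: T x)) blinZ scalerA.
  by rewrite divff ?scale1r// gt_eqF.
apply: compactZ; apply/compact_opP; exists A => // x x1; apply: AS.
rewrite blinZE normrZ gtr0_norm ?invr_gt0// ler_pdivrMl// mulr1.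
apply: le_trans (operator_le H T x) _; apply: le_trans (_ : opnorm T <= _); last by rewrite lerDl.
by rewrite -[leRHS]mulr1 ler_wpM2l// (opnorm_ge0 H kn).
Qed.
End Operators.

(** Boundedness puts the values at each point in a compact disc, so the pointwise
    limits along an ultrafilter exist. *)
Lemma ultra_dual (V : lmodType K) (p : V -> K) (hp : kseminorm p) (I : Type)
    (U : set_system I) (g : I -> V -> K) : UltraFilter U ->
  (forall i a x y, g i (a *: x + y) = a * g i x + g i y) ->
  (forall i x, `|g i x| <= p x) ->
  exists2 f : dual p, forall x, (fun i => g i x : K^o) @ U --> (f x : K^o) &
    re (dual_norm p f) <= 1.
Proof.
move=> UU lg gp; have UP : ProperFilter U by exact: ultra_proper.
have lim x : exists y : K^o, (fun i => g i x : K^o) @ U --> y.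
  have [A cA hA] := disc_compact (1 : K^o) (re (p x)).
  have [i|y _ gy] := @ultra_compact _ _ U (fun i => g i x : K^o) A UU cA; last by exists y.
  rewrite -[g i x]mulr1; exact/hA/(re_mono H).
have [f hf] := choice lim.
have flin a x y : f (a *: x + y) = a * f x + f y.
  have h : (fun i => g i (a *: x + y) : K^o) @ U --> (a *: f x + f y : K^o).
    rewrite (_ : (fun i => _) = (fun i => a *: (g i x : K^o) + g i y)).
      by apply: cvgD; [apply: cvgZl_tmp|].
    by apply/funext => i; rewrite lg.
  exact: (@cvg_unique K^o (@norm_hausdorff _ K^o) _ _ _ _ (hf _) h).
have fle x : `|f x : K| <= p x.
  rewrite (norm_emb H) (ge0_emb H (ks_ge0 hp x)) (emb_le H).
  apply/ler_addgt0Pl => eta e0; have [i hi] := lim_adherent UP (hf x) e0.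
  have -> : f x = (f x - g i x) + g i x by rewrite subrK.
  by rewrite (le_trans (rnD H _ _))// lerD ?(ltW hi)// (re_mono H).
have hF : (f : V -> K^o) \in bounded_linear p K^o.
  by apply: (@mem_bounded_linear _ _ _ _ H _ p hp K^o f 1 flin) => x; rewrite mul1r (re_mono H).
exists (Blin hF) => //; apply: (re_opnorm_le H hp) => // x.
by rewrite mul1r (re_mono H).
Qed.
End Operations.

(** * The norm of a small step *)

Section Index.
Context (R : realType) (K : numFieldType) (emb : {rmorphism R -> K}) (re : K -> R).
Hypothesis H : real_form emb re.
Context (X : normedModType K).
Local Notation norm := (norm_of X).
Local Notation kn := (kseminorm_norm X).
Local Notation dn f := (re (dual_norm norm f)).
Local Notation vr T := (re (numerical_radius X T)).

Lemma re_normv_ge0 (x : X) : 0 <= re `|x|.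
Proof. exact/(re_ge0 H)/normr_ge0. Qed.

Lemma normv_emb (x : X) : `|x| = emb (re `|x|).
Proof. by apply: (ge0_emb H); exact: normr_ge0. Qed.

(** For [y = x + t A x] one has [y - t A y = x - t^2 A (A x)], and a norming
    functional of [y] bounds the norm of the left-hand side from below in terms
    of the numerical range of [A]. So to first order the growth of the norm is
    governed by the numerical range alone. *)
Lemma step_norm (A : operators X) (a b t : R) :
  (forall fx, norming_pairs norm fx -> re (fx.1 (A fx.2)) <= a) ->
  (forall x, re `|A x| <= b * re `|x|) -> 0 <= t -> t * a < 1 ->
  forall x, re `|x + emb t *: A x| * (1 - t * a) <= (1 + t ^+ 2 * b ^+ 2) * re `|x|.
Proof.
move=> Aa Ab t0 ta x; pose y := x + emb t *: A x; rewrite -/y.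
have ta0 : 0 < 1 - t * a by rewrite subr_gt0.
have [y0|y0] := eqVneq y 0.
  rewrite y0 normr0 (re0 H) mul0r; apply: mulr_ge0; last exact: re_normv_ge0.
  by apply: addr_ge0 => //; apply: mulr_ge0; exact: sqr_ge0.
have [f f1 fy] := norming_functional H y0.
have ny0 : 0 < re `|y| by rewrite -(emb_lt H) rmorph0 -normv_emb normr_gt0.
have fAy : re (f (A y)) <= a * re `|y|.
  have nyE : `|y| = emb (re `|y|) by exact: normv_emb.
  have : norming_pairs norm (f, `|y|^-1 *: y).
    split=> //=; first by rewrite /norm_of normrZ normfV normr_id mulVf ?normr_eq0.
    by rewrite (dualZ f) fy mulVf ?normr_eq0.
  move=> /Aa /=; rewrite blinZ dualZ nyE -fmorphV (reM H) ler_pdivrMl//.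
  by rewrite (reK H) mulrC.
have yE : y - emb t *: A y = x - emb (t ^+ 2) *: A (A x).
  by rewrite /y blinD blinZ scalerDr scalerA -rmorphM -expr2 opprD addrA addrK.
have h1 : re (f (y - emb t *: A y)) <= re `|y - emb t *: A y|.
  apply: le_trans (re_le_norm H _) _.
  have := le_dual_norm H kn f (y - emb t *: A y); rewrite f1 mul1r.
  exact: (re_mono H).
rewrite {2}yE (blinB f) (dualZ f) fy (reB H) (reM H) in h1.
have h2 : re `|x - emb (t ^+ 2) *: A (A x)| <= re `|x| + t ^+ 2 * re `|A (A x)|.
  apply: le_trans (re_mono H (ler_normB _ _)) _.
  by rewrite (reD H) normrZ (reM_ge0 H)// (rn_emb H) ger0_norm ?sqr_ge0.
have [b0|b0] := leP 0 b; last first.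
  have : re `|A x| <= 0.
    by apply: le_trans (Ab x) _; apply: mulr_le0_ge0; [exact: ltW|exact: re_normv_ge0].
  have := Ab y.
  have : b * re `|y| < 0 by rewrite pmulr_llt0.
  by have := re_normv_ge0 (A y); lra.
have h3 : re `|A (A x)| <= b * (b * re `|x|).
  by apply: le_trans (Ab _) _; rewrite ler_wpM2l.
have h4 : t ^+ 2 * re `|A (A x)| <= t ^+ 2 * (b * (b * re `|x|)).
  by apply: ler_wpM2l h3; exact: sqr_ge0.
have h5 : t * re (f (A y)) <= t * (a * re `|y|) by rewrite ler_wpM2l.
rewrite mulrBr mulr1 mulrDl mul1r expr2 (expr2 b); rewrite expr2 in h2 h4.
have -> : re `|y| * (t * a) = t * (a * re `|y|) by ring.
have -> : t * t * (b * b) * re `|x| = t * t * (b * (b * re `|x|)) by ring.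
lra.
Qed.

Lemma adjoint_norm_le (T : operators X) (f : dual norm) c : 0 <= c ->
  (forall x, re `|T x| <= c * re `|x|) -> dn (adjoint T f) <= c * dn f.
Proof.
move=> c0 Tc; apply: (re_opnorm_le H kn).
  by rewrite mulr_ge0// (re_opnorm_ge0 H kn).
move=> x; rewrite [adjoint T f x]/(f (T x)).
apply: le_trans (re_le_opnorm H kn f (T x)) _.
rewrite [c * _]mulrC -mulrA; apply: ler_wpM2l; first exact: (re_opnorm_ge0 H kn).
exact: Tc.
Qed.

Hypothesis hn : 0 < numerical_index X.
Let k : R := (re (numerical_index X))^-1.

Lemma index_inv_ge0 : 0 <= k.
Proof. by rewrite invr_ge0 (re_ge0 H)// ltW. Qed.

Lemma re_opnorm_le_radius (T : operators X) : re (opnorm T) <= k * vr T.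
Proof.
have n0 : 0 < re (numerical_index X) by rewrite -(emb_lt H) rmorph0 -(ge0_emb H)// ltW.
rewrite ler_pdivlMl// -(reM_ge0 H) ?(ltW hn)//.
by apply: (re_mono H); exact: (numerical_index_le H T).
Qed.
End Index.

(** * Splitting the identity by an M-ideal *)

Section Ideal.
Context (R : realType) (K : numFieldType) (emb : {rmorphism R -> K}) (re : K -> R).
Hypothesis H : real_form emb re.
Context (X : normedModType K).
Local Notation v := (numerical_radius X).
Local Notation kv := (kseminorm_numerical_radius H X).
Local Notation vr T := (re (v T)).
Local Notation id := (op_id X).
Context (P : {linear dual v -> dual v}).
Hypothesis PP : forall f, P (P f) = P f.
Hypothesis P_ann : [set f | P f = 0] = annihilator v [set T | T \in compact_operator X].
Hypothesis P_norm : forall f, dual_norm v f = dual_norm v (P f) + dual_norm v (f - P f).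

Lemma numerical_radius_id : vr id <= 1.
Proof.
have [_ _ h] := numerical_radius_lub H id.
rewrite -(le_emb H) ?numerical_radius_ge0// ?rmorph1; last exact: (numerical_radius_ge0 H).
by apply: h => // -[f x] [/= _ _ fx]; rewrite fx normr1.
Qed.

Lemma le_dual_radius (f : dual v) T : re (f T) <= re (dual_norm v f) * vr T.
Proof. by apply: le_trans (re_le_norm H _) _; exact: (re_le_opnorm H kv f T). Qed.

Lemma P_compact (f : dual v) (S : operators X) : S \in compact_operator X -> P f S = f S.
Proof.
move=> Sc; have : [set f | P f = 0] (f - P f) by rewrite /= linearB PP subrr.
by rewrite P_ann => /(_ S Sc) /eqP; rewrite blinDE blinNE subr_eq0 => /eqP.
Qed.

(** If no compact [S] were suitable, Hahn-Banach would give functionals [f1], [f2]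
    and a weight [gam] with |f1| + |f2| + gam <= 1 such that
    [f2 - f1 + gam N Phi] vanishes on compact operators and
    [re (f1 (C + 1)) - gam N re (P Phi 1) = 1 + eps]. As [P] annihilates
    that combination, [gam N P Phi = P f1 - P f2], so the left-hand side is
    the real part of [P f1 C + (f1 - P f1) 1 + P f2 1]. This is at most
    |P f1| + |f1 - P f1| + |f2| = |f1| + |f2|, hence at most 1. *)
Lemma ideal_split (C : operators X) (Phi : dual v) (eps : R) :
  C \in compact_operator X -> vr C <= 1 -> 0 < eps <= 1 ->
  exists2 S : operators X, S \in compact_operator X &
    [/\ vr (C + id - S) <= 1 + eps, vr S <= 1 + eps &
        re (Phi S) <= re (P Phi id) + eps].
Proof.
move=> cC C1 /andP[e0 e1]; apply: contrapT => nS.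
(* With this [N], a failure of the third inequality costs [N * eps = 2], which
   is at least [1 + eps]. *)
pose w := re (P Phi id); pose N := 2 / eps.
have Ne : N * eps = 2 by rewrite /N divfK// gt_eqF.
have N0 : 0 < N by rewrite divr_gt0.
have vD S T : vr (S + T) <= vr S + vr T by rewrite -(reD H) (re_mono H)// (ksD kv).
have vZ (t : R) S : 0 <= t -> vr (emb t *: S) = t * vr S.
  by move=> t0; rewrite (ksZ kv) (reM_ge0 H)// (rn_emb H) ger0_norm.
have v0 S : 0 <= vr S by exact/(re_ge0 H)/(ks_ge0 kv).
pose L := realify emb (operators X).
pose E : lmodType R := ((L * L) * R^o)%type.
pose q (z : E) : R := Num.max (Num.max (vr z.1.1) (vr z.1.2)) (z.2 : R).
have q1 z : vr z.1.1 <= q z by rewrite /q !le_max lexx.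
have q2 z : vr z.1.2 <= q z by rewrite /q !le_max lexx orbT.
have q3 z : z.2 <= q z by rewrite /q !le_max lexx orbT.
have hq : sublinear q.
  split=> [y z|t z t0].
    rewrite /q !ge_max; apply/andP; split; first apply/andP; first split.
    - by apply: le_trans (vD _ _) _; apply: lerD; exact: q1.
    - by apply: le_trans (vD _ _) _; apply: lerD; exact: q2.
    - by apply: lerD; exact: q3.
  by rewrite /q /= !realify_scaleE !vZ// -!maxr_pMr.
pose pt (s : R) (S : operators X) : E :=
  ((emb s *: (C + id) - S : L, S : L), N * (re (Phi S) - s * w) : R^o).
have ptD s S s' S' : pt (s + s') (S + S') = pt s S + pt s' S'.
  have e : N * (re (Phi (S + S')) - (s + s') * w) =
      N * (re (Phi S) - s * w) + N * (re (Phi S') - s' * w).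
    by rewrite (blinD Phi) (reD H); ring.
  congr (_, _, _) => /=; last exact: e.
  by rewrite rmorphD scalerDl opprD addrACA.
have ptZ t s S : pt (t * s) (emb t *: S) = t *: pt s S.
  have e : N * (re (Phi (emb t *: S)) - (t * s) * w) = t * (N * (re (Phi S) - s * w)).
    by rewrite (dualZ Phi) (reM H); ring.
  congr (_, _, _) => /=; last exact: e.
  by rewrite realify_scaleE scalerBr scalerA rmorphM.
pose A : set (E * R) := [set y | exists s S, S \in compact_operator X /\
  y = (pt s S, s * (1 + eps))].
have [||||F [lF Fq FA]] := @hahn_banach R E q A hq.
- exists 0, 0; split; first exact: rpred0.
  rewrite mul0r; congr (_, _); congr (_, _, _) => /=.
    by rewrite rmorph0 scale0r subr0.
  by rewrite (blin0 Phi) (re0 H) mul0r subr0 mulr0.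
- move=> _ _ [s [S [cS ->]]] [s' [S' [cS' ->]]] /=.
  by exists (s + s'), (S + S'); rewrite rpredD// ptD mulrDl.
- move=> t _ t0 [s [S [cS ->]]] /=; exists (t * s), (emb t *: S).
  by rewrite compactZ// ptZ mulrA.
- move=> _ [s [S [cS ->]]] /=.
  have [s0|s0] := leP s 0.
    apply: le_trans (q1 _); apply: le_trans (v0 _).
    by apply: mulr_le0_ge0 => //; rewrite addr_ge0 ?(ltW e0).
  have -> : S = emb s *: (emb s^-1 *: S).
    by rewrite scalerA -rmorphM divff ?gt_eqF// rmorph1 scale1r.
  rewrite -{1 2}[s]mulr1 ptZ; set S' := emb s^-1 *: S.
  rewrite (sublinearZ hq _ (ltW s0)) mulr1 ler_pM2l// leNgt; apply/negP => qlt.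
  apply: nS; exists S'; first exact: compactZ.
  have h1 := q1 (pt 1 S'); have h2 := q2 (pt 1 S'); have h3 := q3 (pt 1 S').
  move: (q (pt 1 S')) qlt h1 h2 h3 => r rlt.
  rewrite /pt /= rmorph1 scale1r mul1r => h1 h2 h3.
  split; [exact: le_trans (ltW rlt)|exact: le_trans (ltW rlt)|].
  rewrite -/w -lerBlDl -(ler_pM2l N0) Ne.
  by apply: le_trans h3 _; lra.
pose F1 (S : L) := F (S, 0, 0); pose F2 (S : L) := F (0, S, 0).
pose gam : R := F (0, 0, 1).
have FE S T t : F (S, T, t) = F1 S + F2 T + t * gam.
  have -> : ((S, T, t : R^o) : E) = ((S, 0, 0) : E) + ((0, T, 0) : E) + t *: ((0, 0, 1) : E).
    congr (_, _, _) => /=; rewrite ?scaler0 ?addr0 ?add0r//.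
    by rewrite /GRing.scale/= mulr1.
  by rewrite !(rlinearD lF) (rlinearZ lF).
have F10 : F1 0 = 0 by exact: (rlinear0 lF).
have F20 : F2 0 = 0 by exact: (rlinear0 lF).
have F1D x y : F1 (x + y) = F1 x + F1 y.
  rewrite /F1 -(rlinearD lF); congr F.
  by congr (_, _, _) => /=; rewrite ?addr0.
have F2D x y : F2 (x + y) = F2 x + F2 y.
  rewrite /F2 -(rlinearD lF); congr F.
  by congr (_, _, _) => /=; rewrite ?addr0.
have F1Z c (x : operators X) : F1 (emb c *: x) = c * F1 x.
  rewrite /F1 -(rlinearZ lF); congr F.
  by congr (_, _, _) => /=; rewrite ?scaler0.
have F2Z c (x : operators X) : F2 (emb c *: x) = c * F2 x.
  rewrite /F2 -(rlinearZ lF); congr F.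
  by congr (_, _, _) => /=; rewrite ?scaler0.
have vr0 : vr 0 = 0 by rewrite (ks0 kv) (re0 H).
have gam0 : 0 <= gam.
  have := Fq (0, 0, -1); rewrite FE F10 F20 /q /= vr0 maxxx max_l ?lerN10//.
  by rewrite !add0r mulN1r oppr_le0.
have F1q (x : operators X) : F1 x <= 1 * vr x.
  have := Fq (x, 0, 0); rewrite FE F20 mul0r !addr0 /q /= vr0 mul1r.
  by rewrite (max_l (v0 x)) (max_l (v0 x)).
have F2q (x : operators X) : F2 x <= 1 * vr x.
  have := Fq (0, x, 0); rewrite FE F10 mul0r addr0 add0r /q /= vr0 mul1r.
  by rewrite (max_r (v0 x)) (max_l (v0 x)).
have [f1 f1E f1n] := dual_of_real H kv ler01 F1D F1Z F1q.
have [f2 f2E f2n] := dual_of_real H kv ler01 F2D F2Z F2q.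
have n12 : re (dual_norm v f1) + re (dual_norm v f2) + gam <= 1.
  apply/ler_addgt0Pl => eta eta0; have eta2 : 0 < eta / 2 by rewrite divr_gt0.
  have [S S1 [hS _]] := dual_adherent H kv f1 eta2.
  have [T T1 [hT _]] := dual_adherent H kv f2 eta2.
  have : q (S, T, 1) <= 1.
    rewrite /q /= !ge_max lexx andbT -(re1 H); apply/andP.
    by split; apply: (re_mono H).
  by have := Fq (S, T, 1); rewrite FE mul1r -f1E -f2E; lra.
have FAE s S : S \in compact_operator X -> F (pt s S) = s * (1 + eps).
  move=> cS; apply/eqP; rewrite eq_le; apply/andP; split; last first.
    have : A (pt s S, s * (1 + eps)) by exists s, S.
    by move=> /FA.
  have : A (pt (-1 * s) (emb (-1) *: S), (-1 * s) * (1 + eps)).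
    by exists (-1 * s), (emb (-1) *: S); rewrite compactZ.
  by move=> /FA /=; rewrite ptZ (rlinearZ lF) -mulrA !mulN1r lerN2.
pose Psi : dual v := f2 - f1 + emb (gam * N) *: Phi.
have Psi0 : P Psi = 0.
  have : annihilator v [set T | T \in compact_operator X] Psi.
    move=> S cS; apply: (re_eq0 H) => l l1; rewrite -dualZ.
    have cS' : l *: S \in compact_operator X by exact: compactZ.
    have := FAE 0 (l *: S) cS'; rewrite /pt FE -f1E -f2E rmorph0 scale0r sub0r !mul0r subr0.
    rewrite (blinN f1) (reN H) => h.
    rewrite !blinDE blinNE dualZE !(reD H) (reN H) (reM H).
    by rewrite -h; ring.
  by rewrite -P_ann.
have hw : gam * N * w = re (P f1 id) - re (P f2 id).
  have PsiE : P Psi = P f2 - P f1 + emb (gam * N) *: P Phi.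
    by rewrite /Psi linearD linearB linearZ.
  have : re ((P f2 - P f1 + emb (gam * N) *: P Phi) id) = 0 by rewrite -PsiE Psi0 (re0 H).
  rewrite !blinDE blinNE dualZE !(reD H) (reN H) (reM H).
  by rewrite -/w; lra.
have h1 := FAE 1 0 (rpred0 _).
rewrite /pt FE -f1E F20 (blin0 Phi) (re0 H) rmorph1 scale1r subr0 (blinD f1) (reD H) in h1.
have fC : re (f1 C) <= re (dual_norm v (P f1)).
  rewrite -P_compact//; apply: le_trans (le_dual_radius _ _) _.
  by rewrite -[leRHS]mulr1 ler_wpM2l// (re_opnorm_ge0 H kv).
have fid (g : dual v) : re (g id) <= re (dual_norm v g).
  apply: le_trans (le_dual_radius _ _) _.
  by rewrite -[leRHS]mulr1 ler_wpM2l ?numerical_radius_id// (re_opnorm_ge0 H kv).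
have := fid (f1 - P f1); rewrite blinDE blinNE (reD H) (reN H).
have := fid (P f2).
have : re (dual_norm v (P f2)) <= re (dual_norm v f2).
  by rewrite (P_norm f2) (reD H) lerDl (re_opnorm_ge0 H kv).
have : re (dual_norm v f1) = re (dual_norm v (P f1)) + re (dual_norm v (f1 - P f1)).
  by rewrite {1}(P_norm f1) (reD H).
have : N * (0 - 1 * w) * gam = - (gam * N * w) by ring.
lra.
Qed.
End Ideal.

(** * The drift on the bidual *)

Section Drift.
Context (R : realType) (K : numFieldType) (emb : {rmorphism R -> K}) (re : K -> R).
Hypothesis H : real_form emb re.
Context (X : normedModType K).
Local Notation norm := (norm_of X).
Local Notation v := (numerical_radius X).
Local Notation kn := (kseminorm_norm X).
Local Notation kdn := (kseminorm_dual H kn).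
Local Notation kv := (kseminorm_numerical_radius H X).
Local Notation vr T := (re (v T)).
Local Notation dn f := (re (dual_norm norm f)).
Local Notation bidual := (dual (dual_norm norm)).
Local Notation ddn w := (re (dual_norm (dual_norm norm) w)).
Local Notation id := (op_id X).
Hypothesis hn : 0 < numerical_index X.
Let k : R := (re (numerical_index X))^-1.
Let k0 : 0 <= k. Proof. exact: (index_inv_ge0 H hn). Qed.
Let kle T : re (opnorm T) <= k * vr T. Proof. exact: (re_opnorm_le_radius H hn). Qed.

Lemma adjointP (T : operators X) a (f g : dual norm) :
  adjoint T (a *: f + g) = a *: adjoint T f + adjoint T g.
Proof. exact: blin_eq. Qed.

Lemma adjoint_opP (S T : operators X) a (f : dual norm) :
  adjoint (a *: S + T) f = a *: adjoint S f + adjoint T f.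
Proof. by apply: blin_eq => x; rewrite [LHS]blinP. Qed.

Lemma le_bidual (w : bidual) f : re `|w f : K| <= ddn w * dn f.
Proof. exact: (re_le_opnorm H kdn). Qed.

Lemma re_le_bidual (w : bidual) f : re (w f) <= ddn w * dn f.
Proof. exact: le_trans (re_le_norm H _) (le_bidual _ _). Qed.

Lemma re_operator_le (T : operators X) x : re `|T x| <= re (opnorm T) * re `|x|.
Proof. exact: (re_le_opnorm H kn). Qed.

Fact tensor_bound (w : bidual) (f : dual norm) T :
  re `|w (adjoint T f) : K| <= (ddn w * dn f * k) * vr T.
Proof.
apply: le_trans (le_bidual _ _) _; rewrite -!mulrA.
apply: ler_wpM2l; first exact: (re_opnorm_ge0 H kdn).
apply: le_trans (adjoint_norm_le H _ (re_opnorm_ge0 H kn T) (re_operator_le T)) _.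
by rewrite mulrC; apply: ler_wpM2l; [exact: (re_opnorm_ge0 H kn)|exact: kle].
Qed.

Fact tensor_subproof (w : bidual) (f : dual norm) :
  ((fun T => w (adjoint T f)) : operators X -> K^o) \in bounded_linear v K^o.
Proof.
apply: (@mem_bounded_linear _ _ _ _ H _ v kv K^o _ (ddn w * dn f * k)).
  by move=> a S T; rewrite adjoint_opP blinP.
exact: tensor_bound.
Qed.
Definition tensor w f : dual v := Blin (tensor_subproof w f).

Lemma tensor_norm w f : re (dual_norm v (tensor w f)) <= ddn w * dn f * k.
Proof.
apply: (re_opnorm_le H kv); last exact: tensor_bound.
by rewrite !mulr_ge0// ?(re_opnorm_ge0 H kdn)// (re_opnorm_ge0 H kn).
Qed.

Context (P : {linear dual v -> dual v}).
Hypothesis PP : forall f, P (P f) = P f.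
Hypothesis P_ann : [set f | P f = 0] = annihilator v [set T | T \in compact_operator X].
Hypothesis P_norm : forall f, dual_norm v f = dual_norm v (P f) + dual_norm v (f - P f).

Lemma ideal_id_le w f : re `|P (tensor w f) id : K| <= (k * ddn w) * dn f.
Proof.
have t0 := re_opnorm_ge0 H kv.
apply: le_trans (re_le_opnorm H kv _ id) _.
apply: (@le_trans _ _ (re (dual_norm v (P (tensor w f))))).
  by rewrite -[leRHS]mulr1; apply: ler_wpM2l; [exact: t0|exact: (numerical_radius_id H X)].
apply: le_trans (_ : re (dual_norm v (tensor w f)) <= _).
  by rewrite (P_norm (tensor w f)) (reD H) lerDl; exact: t0.
by apply: le_trans (tensor_norm w f) _; rewrite mulrC mulrA.
Qed.

Fact drift_subproof (w : bidual) :
  ((fun f => (P (tensor w f) id : K^o) - w f) : dual norm -> K^o)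
    \in bounded_linear (dual_norm norm) K^o.
Proof.
apply: (@mem_bounded_linear _ _ _ _ H _ _ kdn K^o _ ((k + 1) * ddn w)).
  move=> a f g.
  have -> : tensor w (a *: f + g) = a *: tensor w f + tensor w g.
    by apply: blin_eq => T; rewrite [LHS]/= adjointP blinP.
  by rewrite linearP blinDE blinZE blinP scalerBr opprD addrACA.
move=> f; apply: le_trans (rnD H _ _) _; rewrite normrN.
rewrite !mulrDl mul1r; apply: lerD; [exact: ideal_id_le|exact: le_bidual].
Qed.
(** The functional [P (tensor w f)] is the extension to all operators, with the
    same norm, of the restriction of [tensor w f] to compact operators. The drift
    compares its value at the identity with [w f]. *)
Definition drift w : bidual := Blin (drift_subproof w).

Lemma driftE w f : drift w f = P (tensor w f) id - w f.
Proof. by []. Qed.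

Lemma driftP a w w' : drift (a *: w + w') = a *: drift w + drift w'.
Proof.
apply: blin_eq => f; rewrite !blinDE !blinZE !driftE.
have -> : tensor (a *: w + w') f = a *: tensor w f + tensor w' f.
  exact: blin_eq.
by rewrite linearP !blinDE !blinZE scalerBr opprD addrACA.
Qed.

Lemma drift_norm w : ddn (drift w) <= (k + 1) * ddn w.
Proof.
apply: (re_opnorm_le H kdn).
  by rewrite mulr_ge0 ?(re_opnorm_ge0 H kdn)// addr_ge0.
move=> f; apply: le_trans (rnD H _ _) _; rewrite normrN.
rewrite !mulrDl mul1r; apply: lerD; [exact: ideal_id_le|exact: le_bidual].
Qed.

Lemma pair_re_le (T : operators X) fx : norming_pairs norm fx -> re (fx.1 (T fx.2)) <= vr T.
Proof.
move=> hfx; apply: le_trans (re_le_norm H _) _; apply: (re_mono H).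
exact: (numerical_radius_le H T hfx).
Qed.

(** [step_norm] for the adjoint of [1 + s A], tested at the pair [(w, f)]. *)
Lemma near_pair_sharp (A : operators X) (a b s d : R) (w : bidual) (f : dual norm) :
  (forall fx, norming_pairs norm fx -> re (fx.1 (A fx.2)) <= a) ->
  (forall x, re `|A x| <= b * re `|x|) -> 0 <= s -> s * a < 1 ->
  ddn w <= 1 -> dn f <= 1 -> 1 - d <= re (w f) ->
  (1 - d + s * re (w (adjoint A f))) * (1 - s * a) <= 1 + s ^+ 2 * b ^+ 2.
Proof.
move=> Aa Ab s0 sa w1 f1 wf; have sa0 : 0 < 1 - s * a by rewrite subr_gt0.
pose c := (1 + s ^+ 2 * b ^+ 2) / (1 - s * a).
have c0 : 0 <= c.
  by rewrite divr_ge0 ?(ltW sa0)// addr_ge0// mulr_ge0// sqr_ge0.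
have hT x : re `|(emb s *: A + id) x| <= c * re `|x|.
  have := step_norm H Aa Ab s0 sa x; rewrite [x + _]addrC.
  by rewrite -[emb s *: A x + x]/((emb s *: A + id) x) -ler_pdivlMr// mulrAC.
have wT := re_le_bidual w (adjoint (emb s *: A + id) f).
have wc : ddn w * dn (adjoint (emb s *: A + id) f) <= c.
  apply: le_trans (_ : dn (adjoint (emb s *: A + id) f) <= c).
    by rewrite -[leRHS]mul1r; apply: ler_wpM2r => //; exact: (re_opnorm_ge0 H kn).
  apply: le_trans (adjoint_norm_le H f c0 hT) _.
  by rewrite -[leRHS]mulr1; apply: ler_wpM2l.
rewrite -ler_pdivlMr// -/c; apply: le_trans wc; apply: le_trans wT.
rewrite adjoint_opP (blinD w) (blinZ w) (reD H) [re (_ *: _)](reM H).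
have -> : adjoint id f = f by exact: blin_eq.
by rewrite addrC lerD2l.
Qed.

Lemma near_pair (A : operators X) (a b s d : R) (w : bidual) (f : dual norm) :
  (forall fx, norming_pairs norm fx -> re (fx.1 (A fx.2)) <= a) ->
  (forall x, re `|A x| <= b * re `|x|) -> 0 <= s -> 0 <= a -> s * a <= 1 / 2 ->
  ddn w <= 1 -> dn f <= 1 -> 1 - d <= re (w f) ->
  s * re (w (adjoint A f)) <= d + 2 * (s ^+ 2 * b ^+ 2) + 2 * (s * a).
Proof.
move=> Aa Ab s0 a0 sa w1 f1 wf.
have sa0 : 0 <= s * a by exact: mulr_ge0.
have sa1 : s * a < 1 by lra.
have := near_pair_sharp Aa Ab s0 sa1 w1 f1 wf.
have : 0 <= s ^+ 2 * b ^+ 2 by apply: mulr_ge0; exact: sqr_ge0.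
move: (s ^+ 2 * b ^+ 2) (s * re _) sa0 sa => be r; move: (s * a) => e e0 e2 be0 h.
rewrite leNgt; apply/negP => hr.
have h0 : 0 < 1 - e by lra.
have : (1 + 2 * be + 2 * e) * (1 - e) < (1 - d + r) * (1 - e) by rewrite ltr_pM2r//; lra.
have : 0 <= be * (1 - 2 * e) by apply: mulr_ge0 => //; lra.
have : 0 <= e * (1 - 2 * e) by apply: mulr_ge0 => //; lra.
nra.
Qed.

(** The first-order term of [near_pair_sharp] as [s] tends to 0: norming pairs of
    the dual space give no larger numerical radius to adjoints. *)
Lemma pair_numerical_le (T : operators X) (w : bidual) (f : dual norm) :
  ddn w <= 1 -> dn f <= 1 -> 1 <= re (w f) -> re (w (adjoint T f)) <= vr T.
Proof.
move=> w1 f1 wf; set r := re _; rewrite leNgt; apply/negP => ar.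
have a0 : 0 <= vr T by exact: (re_ge0 H (numerical_radius_ge0 H T)).
pose b := re (opnorm T); have bb : 0 <= b ^+ 2 by exact: sqr_ge0.
have ra : 0 <= r * vr T by apply: mulr_ge0 => //; exact: le_trans a0 (ltW ar).
pose s := (r - vr T) / (2 * (b ^+ 2 + r * vr T + 1)).
have s0 : 0 < s by rewrite divr_gt0//; lra.
have sE : s * (2 * (b ^+ 2 + r * vr T + 1)) = r - vr T by rewrite /s divfK// gt_eqF//; lra.
have aa : 0 <= vr T * vr T by exact: mulr_ge0.
have sa : s * vr T < 1.
  by rewrite /s mulrAC ltr_pdivrMr; lra.
have wf0 : 1 - 0 <= re (w f) by rewrite subr0.
have := near_pair_sharp (pair_re_le T) (re_operator_le T) (ltW s0) sa w1 f1 wf0.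
rewrite -/r -/b subr0 => h.
have : s * (s * (2 * (b ^+ 2 + r * vr T + 1))) = s * (r - vr T) by rewrite sE.
have : 0 < s * s by exact: mulr_gt0.
have : 0 <= s * s * (b ^+ 2 + r * vr T) by apply: mulr_ge0; [apply: mulr_ge0; exact: ltW|lra].
have -> : s * (s * (2 * (b ^+ 2 + r * vr T + 1))) =
    2 * (s * s * (b ^+ 2 + r * vr T)) + 2 * (s * s) by ring.
have : (1 + s * r) * (1 - s * vr T) = 1 + s * (r - vr T) - s * s * (r * vr T) by ring.
have : s ^+ 2 * b ^+ 2 = s * s * (b ^+ 2) by ring.
have : s * s * (b ^+ 2 + r * vr T) = s * s * b ^+ 2 + s * s * (r * vr T) by ring.
lra.
Qed.

Lemma adjoint_rank_one (g f : dual norm) x : adjoint (rank_one H g x) f = (f x : K) *: g.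
Proof. by apply: blin_eq => y; rewrite [LHS]/= (dualZ f) mulrC. Qed.

Lemma rank_one_le (g : dual norm) x y : dn g <= 1 -> re `|x| <= 1 ->
  re `|rank_one H g x y| <= re `|y|.
Proof.
move=> g1 x1; rewrite normrZ (reM_ge0 H)//.
have := ler_pM (rn_ge0 H (g y)) (re_normv_ge0 H x) (re_le_opnorm H kn g y) x1.
rewrite mulr1 => h; apply: le_trans h _.
by rewrite -[leRHS]mul1r; apply: ler_wpM2r => //; exact: (re_normv_ge0 H).
Qed.

Let b : R := 1 + 2 * k.

(** [A = C - S], where [C] is a contraction of rank one whose value at [(w, f)] is
    nearly the largest possible, and [S] is given by [ideal_split] for
    [Phi = tensor w f]. The numerical range of [A] is controlled because that of
    [C + 1 - S] is. *)
Lemma ideal_contraction (w : bidual) (f : dual norm) (e : R) : 0 < e <= 1 ->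
  exists A : operators X, [/\ A \in compact_operator X,
    forall fx, norming_pairs norm fx -> re (fx.1 (A fx.2)) <= e,
    forall x, re `|A x| <= b * re `|x| &
    ddn w * dn f - re (P (tensor w f) id) - 2 * e <= re (w (adjoint A f))].
Proof.
move=> e01; have /andP[e0 e1] := e01.
have w0 : 0 <= ddn w by exact: (re_opnorm_ge0 H kdn).
have f0 : 0 <= dn f by exact: (re_opnorm_ge0 H kn).
pose h := e / (ddn w + dn f + 1).
have h0 : 0 < h by rewrite divr_gt0//; lra.
have [g g1 [wg wgE]] := dual_adherent H kdn w h0.
have [x x1 [fx fxE]] := dual_adherent H kn f h0.
have rg1 : dn g <= 1 by rewrite -(re1 H) (re_mono H).
have rx1 : re `|x| <= 1 by rewrite -(re1 H) (re_mono H).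
pose C := rank_one H g x.
have Cle y : re `|C y| <= re `|y| by exact: rank_one_le.
have C1 : vr C <= 1.
  apply: le_trans (re_mono H (numerical_radius_opnorm H C)) _.
  by apply: (re_opnorm_le H kn) => // y; rewrite mul1r; exact: Cle.
have [S cS [CS S1 PS]] :=
  ideal_split H PP P_ann P_norm (tensor w f) (compact_rank_one H g x) C1 e01.
exists (C - S); split.
- by rewrite rpredB// compact_rank_one.
- move=> fy hfy; have := pair_re_le (C + id - S) hfy.
  rewrite !blinDE !blinNE !(blinD fy.1) !(blinN fy.1) !(reD H) !(reN H).
  have -> : fy.1 (id fy.2) = 1 by case: hfy.
  by rewrite (re1 H); lra.
- move=> y; rewrite blinDE blinNE; apply: le_trans (re_mono H (ler_normB _ _)) _.
  rewrite (reD H) mulrDl mul1r; apply: lerD; first exact: Cle.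
  apply: le_trans (re_operator_le S y) _; apply: ler_wpM2r; first exact: (re_normv_ge0 H).
  apply: le_trans (kle S) _; rewrite mulrC; apply: ler_wpM2r => //; lra.
have -> : adjoint (C - S) f = (f x : K) *: g - adjoint S f.
  by apply: blin_eq => y; rewrite [LHS](blinD f) (blinN f) -adjoint_rank_one.
rewrite (blinB w) (blinZ w) (reB H) -[w (adjoint S f)]/(tensor w f S).
have -> : re ((f x : K) *: w g) = re (f x) * re (w g).
  by rewrite [X in X *: _]fxE [_ *: _]/(`|f x : K| * w g) (reM_ge0 H)// -fxE.
suff : ddn w * dn f - re (f x) * re (w g) <= e by lra.
have he : h * (ddn w + dn f + 1) = e by rewrite /h divfK// gt_eqF//; lra.
have fxle : re (f x) <= dn f.
  apply: le_trans (re_le_norm H _) _; apply: le_trans (re_le_opnorm H kn f x) _.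
  by rewrite -[leRHS]mulr1; apply: ler_wpM2l => //.
have fx0 : 0 <= re (f x) by rewrite fxE; exact: (rn_ge0 H).
have : 0 <= ddn w * (h - (dn f - re (f x))) by apply: mulr_ge0 => //; lra.
have : 0 <= re (f x) * (h - (ddn w - re (w g))) by apply: mulr_ge0 => //; lra.
have : 0 <= h * (dn f - re (f x)) by apply: mulr_ge0 => //; lra.
nra.
Qed.

(** By [near_pair], if the numerical range of an operator lies to the left of a
    small [e], the real parts of its values at nearly norming pairs of the dual
    space are small or negative. This is applied to the [C - S] of
    [ideal_contraction], whose value is nearly minus the drift, and to
    [S - 1], with [S] from [ideal_split] for [C = 0] and [Phi = - tensor w f],
    whose value is nearly the drift. *)
Lemma drift_small (th : R) : 0 < th -> exists2 d, 0 < d &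
  forall (w : bidual) (f : dual norm), ddn w <= 1 -> dn f <= 1 ->
    1 - d <= re (w f) -> - th <= re (drift w f) <= th.
Proof.
move=> th0; pose s := th / (8 * b ^+ 2 + th); pose e := Num.min (1 / 2) (th / 16).
have bb : 0 <= b ^+ 2 by exact: sqr_ge0.
have s0 : 0 < s by rewrite divr_gt0//; lra.
have s1 : s <= 1 by rewrite ler_pdivrMr; lra.
have sb : s * (8 * b ^+ 2 + th) = th by rewrite /s divfK// gt_eqF//; lra.
have e0 : 0 < e by rewrite lt_min; apply/andP; split; lra.
have [e1 e2] : e <= 1 / 2 /\ e <= th / 16 by rewrite /e !ge_min !lexx orbT.
have e01 : 0 < e <= 1 by rewrite e0/=; lra.
have se : s * e <= 1 / 2.
  by apply: le_trans e1; rewrite -[leRHS]mul1r; apply: ler_wpM2r => //; exact: ltW.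
exists (s * (th / 4)); first by apply: mulr_gt0 => //; lra.
move=> w f w1 f1 wf.
have fin r : s * (r - 2 * e) <= s * (th / 4) + 2 * (s ^+ 2 * b ^+ 2) + 2 * (s * e) -> r <= th.
  have -> : s * (th / 4) + 2 * (s ^+ 2 * b ^+ 2) + 2 * (s * e) =
    s * (th / 4 + 2 * (s * b ^+ 2) + 2 * e) by ring.
  rewrite ler_pM2l//; have : 0 <= s * th by apply: mulr_ge0; exact: ltW.
  have : s * (8 * b ^+ 2 + th) = 8 * (s * b ^+ 2) + s * th by ring.
  by lra.
apply/andP; split.
  rewrite lerNl; apply: fin.
  have [A [_ Ae Ab hA]] := ideal_contraction w f e01.
  have := near_pair Ae Ab (ltW s0) (ltW e0) se w1 f1 wf.
  apply: le_trans; apply: ler_wpM2l; first exact: ltW.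
  rewrite driftE (reB H); have := re_le_bidual w f; lra.
apply: fin.
have [|S cS [S0 S1 PS]] := ideal_split H PP P_ann P_norm (- tensor w f) (rpred0 _) _ e01.
  by rewrite (ks0 kv) (re0 H).
have Ae fx : norming_pairs norm fx -> re (fx.1 ((S - id) fx.2)) <= e.
  move=> hfx; rewrite blinDE blinNE (blinB fx.1) (reB H).
  have -> : fx.1 (id fx.2) = 1 by case: hfx.
  by rewrite (re1 H); have := pair_re_le S hfx; lra.
have Ab x : re `|(S - id) x| <= b * re `|x|.
  apply: le_trans (re_operator_le _ x) _; apply: ler_wpM2r; first exact: (re_normv_ge0 H).
  apply: le_trans (kle _) _.
  have -> : vr (S - id) = vr (0 + id - S) by rewrite -opprB (ksN _ kv) add0r.
  have : k * vr (0 + id - S) <= k * 2 by apply: ler_wpM2l => //; lra.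
  by rewrite /b; lra.
have := near_pair Ae Ab (ltW s0) (ltW e0) se w1 f1 wf.
apply: le_trans; apply: ler_wpM2l; first exact: ltW.
have -> : adjoint (S - id) f = adjoint S f - f.
  by apply: blin_eq => y; rewrite [LHS](blinB f).
rewrite driftE (blinB w) !(reB H) -[w (adjoint S f)]/(tensor w f S).
by rewrite linearN !blinNE !(reN H) in PS; lra.
Qed.

(** A functional [f] at which [w] nearly attains its norm sees almost no drift, by
    [drift_small]. *)
Lemma drift_skew (t : R) (w : bidual) : ddn w <= ddn (w + emb t *: drift w).
Proof.
have kdd := kseminorm_dual H kdn.
wlog w1 : w / ddn w = 1 => [hw|].
  have := re_opnorm_ge0 H kdn w; rewrite le_eqVlt => /predU1P[<-|w0].
    exact: (re_opnorm_ge0 H kdn).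
  have w0' : 0 <= (ddn w)^-1 by rewrite invr_ge0 ltW.
  have ZE (u : bidual) : ddn (emb (ddn w)^-1 *: u) = (ddn w)^-1 * ddn u.
    by rewrite (ksZ kdd) (reM_ge0 H)// (rn_emb H) ger0_norm.
  have := hw (emb (ddn w)^-1 *: w).
  have -> : drift (emb (ddn w)^-1 *: w) = emb (ddn w)^-1 *: drift w.
    have d0 : drift 0 = 0.
      by have := driftP (-1) 0 0; rewrite !scaleN1r oppr0 addr0 addNr.
    by have := driftP (emb (ddn w)^-1) w 0; rewrite d0 !addr0.
  have -> : emb (ddn w)^-1 *: w + emb t *: (emb (ddn w)^-1 *: drift w) =
      emb (ddn w)^-1 *: (w + emb t *: drift w).
    by rewrite scalerDr !scalerA [emb t * _]mulrC.
  rewrite !ZE mulVf ?gt_eqF// => /(_ erefl).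
  by rewrite ler_pdivlMl// mulr1.
rewrite w1; apply/ler_addgt0Pl => eta eta0.
pose th := eta / (2 * (`|t| + 1)).
have t0 : 0 <= `|t| by [].
have th0 : 0 < th by rewrite divr_gt0//; lra.
have thE : th * (2 * (`|t| + 1)) = eta by rewrite /th divfK// gt_eqF//; lra.
have [d d0 hd] := drift_small th0.
pose d' := Num.min d (eta / 2).
have d'0 : 0 < d' by rewrite lt_min d0 divr_gt0.
have [d'd d'e] : d' <= d /\ d' <= eta / 2 by rewrite /d' !ge_min !lexx orbT.
have [f f1 [wf _]] := dual_adherent H kdn w d'0.
have rf1 : dn f <= 1 by rewrite -(re1 H) (re_mono H).
rewrite [dual_norm _ w]/(dual_norm (dual_norm norm) w) w1 in wf.
have w1' : ddn w <= 1 by rewrite w1.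
have /andP[r1 r2] : - th <= re (drift w f) <= th by apply: hd => //; lra.
have := re_le_bidual (w + emb t *: drift w) f.
rewrite blinDE blinZE (reD H) [re (_ *: _)](reM H) => h.
have h2 : ddn (w + emb t *: drift w) * dn f <= ddn (w + emb t *: drift w).
  by rewrite -[leRHS]mulr1; apply: ler_wpM2l => //; exact: (re_opnorm_ge0 H kdn).
have h3 : - (`|t| * th) <= t * re (drift w f).
  have : `|t * re (drift w f)| <= `|t| * th.
    by rewrite normrM; apply: ler_wpM2l => //; rewrite ler_norml r1.
  by rewrite ler_norml => /andP[].
have : 2 * (`|t| * th) <= eta by rewrite -thE; lra.
lra.
Qed.
End Drift.

(** * Compact perturbations of the identity *)

Section Path.
Context (R : realType) (K : numFieldType) (emb : {rmorphism R -> K}) (re : K -> R).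
Hypothesis H : real_form emb re.
Context (X : normedModType K).
Local Notation norm := (norm_of X).
Local Notation v := (numerical_radius X).
Local Notation kn := (kseminorm_norm X).
Local Notation kdn := (kseminorm_dual H kn).
Local Notation dn f := (re (dual_norm norm f)).
Local Notation bidual := (dual (dual_norm norm)).
Local Notation ddn w := (re (dual_norm (dual_norm norm) w)).
Local Notation id := (op_id X).
Context (us : dual norm).

Definition perturbation (c : R) : set (operators X) :=
  [set M | M - id \in compact_operator X /\ forall x, re `|M x| <= c * re `|x|].

Definition reach (c : R) (z : bidual) : R :=
  sup [set re (z (adjoint M us)) | M in perturbation c].

Lemma perturbation_id c : 1 <= c -> perturbation c id.
Proof.
move=> c1; split; first by rewrite subrr rpred0.
by move=> x; rewrite -[leLHS]mul1r; apply: ler_wpM2r => //; exact: (re_normv_ge0 H).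
Qed.

Lemma reach_bound c (z : bidual) M : 1 <= c -> perturbation c M ->
  re (z (adjoint M us)) <= c * dn us * ddn z.
Proof.
move=> c1 [_ Mc]; have c0 : 0 <= c by exact: le_trans ler01 c1.
apply: le_trans (re_le_bidual H z _) _; rewrite mulrC.
by apply: ler_wpM2r; [exact: (re_opnorm_ge0 H kdn)|exact: (adjoint_norm_le H)].
Qed.

Lemma le_reach c (z : bidual) M : 1 <= c -> perturbation c M -> re (z (adjoint M us)) <= reach c z.
Proof.
move=> c1 cM; apply: ub_le_sup; last by exists M.
by exists (c * dn us * ddn z) => _ [N cN <-]; exact: reach_bound.
Qed.

Lemma reach_le c (z : bidual) r : 1 <= c ->
  (forall M, perturbation c M -> re (z (adjoint M us)) <= r) -> reach c z <= r.
Proof.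
move=> c1 hr; apply: ge_sup.
  by exists (re (z (adjoint id us))), id => //; exact: perturbation_id.
by move=> _ [M cM <-]; exact: hr.
Qed.

Lemma reach_sublinear c : 1 <= c -> sublinear (reach c : realify emb bidual -> R).
Proof.
move=> c1; apply: (@sublinear_sup R (realify emb bidual) _ (perturbation c)
  (fun M (z : realify emb bidual) => re ((z : bidual) (adjoint M us)))
  (fun z => c * dn us * ddn z)).
- by exists id; exact: perturbation_id.
- by move=> M t y z; rewrite realify_scaleE !blinDE blinZE (reD H) [re (_ *: _)](reM H).
- by move=> M z; exact: reach_bound.
Qed.

Hypothesis hn : 0 < numerical_index X.
Let k : R := (re (numerical_index X))^-1.
Let b : R := 1 + 2 * k.
Context (P : {linear dual v -> dual v}).
Hypothesis PP : forall f, P (P f) = P f.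
Hypothesis P_ann : [set f | P f = 0] = annihilator v [set T | T \in compact_operator X].
Hypothesis P_norm : forall f, dual_norm v f = dual_norm v (P f) + dual_norm v (f - P f).

(** Given [M0], compose it with [1 + t A] for the [A] of [ideal_contraction] at the
    pair of [z] and the image of [us]. The result is again a compact perturbation
    of the identity, [step_norm] bounds its norm, and up to an
    arbitrarily small error it increases the value at [z] by at least as much as
    the move from [z] towards [w], corrected by the drift, can. *)
Lemma reach_step c t (z w : bidual) : 1 <= c -> 0 < t <= 1 -> ddn w <= ddn z ->
  reach c (z + emb t *: (w - z - drift H hn P_norm z))
    <= reach (c * (1 + (b ^+ 2 + 1) * t ^+ 2)) z.
Proof.
move=> c1 /andP[t0 t1] wz; apply: reach_le => // M0 [cM0 M0c].
set y := adjoint M0 us.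
have bb : 0 <= b ^+ 2 by exact: sqr_ge0.
have tt : 0 <= t ^+ 2 by exact: sqr_ge0.
have c0 : 0 <= c by exact: le_trans ler01 c1.
pose q := 1 + (b ^+ 2 + 1) * t ^+ 2.
have q1 : 1 <= q by rewrite /q lerDl; apply: mulr_ge0 => //; lra.
have cq1 : 1 <= c * q by rewrite -[1]mulr1; apply: ler_pM.
apply/ler_addgt0Pl => eta eta0.
(* The bound [t / (b ^+ 2 + 2)] makes the error [t * e] of second order in [t]. *)
pose e := Num.min (t / (b ^+ 2 + 2)) (eta / 2).
have b2 : 0 < b ^+ 2 + 2 by lra.
have e0 : 0 < e by rewrite lt_min !divr_gt0.
have [et ee] : e <= t / (b ^+ 2 + 2) /\ e <= eta / 2 by rewrite /e !ge_min !lexx orbT.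
have et' : e * (b ^+ 2 + 2) <= t by rewrite -ler_pdivlMr.
have eb : 0 <= e * b ^+ 2 by apply: mulr_ge0 => //; exact: ltW.
have e01 : 0 < e <= 1 by rewrite e0/=; lra.
have [A [cA Ae Ab hA]] := ideal_contraction H hn PP P_ann P_norm z y e01.
pose N := emb t *: A + id; pose M := op_comp H M0 N.
have te1 : t * e < 1.
  have : t * e <= e by rewrite -[leRHS]mul1r; apply: ler_wpM2r => //; exact: ltW.
  by lra.
have Nq x : re `|N x| <= q * re `|x|.
  have := step_norm H Ae Ab (ltW t0) te1 x; rewrite [x + _]addrC.
  rewrite -[emb t *: A x + x]/(N x) => h.
  have h1 : 0 < 1 - t * e by lra.
  rewrite -(ler_pM2r h1); apply: le_trans h _; rewrite [leRHS]mulrAC.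
  apply: ler_wpM2r; first exact: (re_normv_ge0 H).
  have tt1 : t ^+ 2 <= 1 by rewrite expr_le1// ltW.
  have : 0 <= (1 - t ^+ 2) * (t * e) by apply: mulr_ge0; [lra|apply: mulr_ge0; exact: ltW].
  have : 0 <= (1 - t ^+ 2) * (t * (e * b ^+ 2)).
    by apply: mulr_ge0; [lra|apply: mulr_ge0 => //; exact: ltW].
  have : 0 <= t * (t - e * (b ^+ 2 + 2)) by apply: mulr_ge0; [exact: ltW|lra].
  by rewrite /q; move: (b ^+ 2) => B; nra.
have cM : perturbation (c * q) M.
  split; last first.
    move=> x; apply: le_trans (M0c _) _; rewrite -mulrA.
    by apply: ler_wpM2l => //; exact: Nq.
  have -> : M - id = op_comp H (M0 - id) N + emb t *: A.
    apply: blin_eq => x; rewrite !blinDE blinNE blinZE.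
    rewrite -[op_comp H (M0 - id) N x]/(M0 (N x) - N x) -[M x]/(M0 (N x)) -[id x]/x.
    move: (M0 (N x)) => m.
    by rewrite -[N x]/(emb t *: A x + x) opprD addrA addrAC subrK.
  by rewrite rpredD// ?compactZ// compact_comp.
apply: le_trans (_ : re (z (adjoint M us)) + eta <= _); last first.
  by rewrite addrC lerD2l; apply: le_reach.
have -> : adjoint M us = emb t *: adjoint A y + y.
  by apply: blin_eq => x; rewrite -[LHS]/(us (M0 (emb t *: A x + x))) (blinP M0) (blinP us).
have -> : re ((z + emb t *: (w - z - drift H hn P_norm z)) y) =
    re (z y) + t * (re (w y) - re (P (tensor H hn z y) id)).
  rewrite !blinDE blinZE !blinDE !blinNE driftE (reD H).
  rewrite [re (_ *: _)](reM H) !(reD H) !(reN H) (reD H) (reN H); ring.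
rewrite (blinD z) (blinZ z) (reD H) [re (_ *: _)](reM H).
have h1 : re (w y) <= ddn z * dn y.
  apply: le_trans (re_le_bidual H w _) _; apply: ler_wpM2r => //.
  exact: (re_opnorm_ge0 H kn).
have : t * (re (w y) - re (P (tensor H hn z y) id)) <= t * (re (z (adjoint A y)) + 2 * e).
  by apply: ler_wpM2l; [exact: ltW|lra].
have : t * e <= e by rewrite -[leRHS]mul1r; apply: ler_wpM2r => //; exact: ltW.
lra.
Qed.

Lemma eval_dual (x : X) : exists2 w : bidual, forall f, w f = f x & ddn w <= re `|x|.
Proof.
have hF : ((fun f : dual norm => f x : K^o) : dual norm -> K^o)
    \in bounded_linear (dual_norm norm) K^o.
  apply: (@mem_bounded_linear _ _ _ _ H _ _ kdn K^o _ (re `|x|)) => // f.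
  by rewrite mulrC; exact: (re_le_opnorm H kn).
exists (Blin hF) => //; apply: (re_opnorm_le H kdn); first exact: (re_normv_ge0 H).
by move=> f; rewrite mulrC; exact: (re_le_opnorm H kn).
Qed.

(** [flow_norming] for the drift and the functionals [reach c] on the bidual: the
    hypothesis bounds [reach c u] by [re (u us) + (c - 1)]. *)
Theorem ideal_norming (u : bidual) :
  (forall M, M - id \in compact_operator X -> forall c, 1 <= c ->
     (forall x, re `|M x| <= c * re `|x|) -> re (u (adjoint M us)) <= re (u us) + (c - 1)) ->
  dn us * ddn u <= re (u us).
Proof.
move=> hu; have kdd := kseminorm_dual H kdn.
have k0 : 0 <= k by exact: (index_inv_ge0 H hn).
apply: (@flow_norming R (realify emb bidual) (fun z => ddn z) _
  (drift H hn P_norm : realify emb bidual -> realify emb bidual) (k + 1) (b ^+ 2 + 1)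
  _ _ _ _ _ reach (dn us) _ _ _ _ (fun z => re ((z : bidual) us)) _ _ _ _ u 1).
- split=> [x y|t x].
    by rewrite -(reD H) (re_mono H)// (ksD kdd).
  by rewrite realify_scaleE (ksZ kdd) (reM_ge0 H)// (rn_emb H).
- by move=> t x y; rewrite !realify_scaleE driftP.
- by move=> x; exact: drift_norm.
- by rewrite addr_ge0.
- rewrite /b; nra.
- by move=> t x; exact: drift_skew.
- exact: (re_opnorm_ge0 H kn).
- exact: reach_sublinear.
- by move=> c x c1; apply: reach_le => // M; exact: reach_bound.
- by move=> c t x w; exact: reach_step.
- by move=> t y z; rewrite realify_scaleE !blinDE blinZE (reD H) [re (_ *: _)](reM H).
- by move=> x; rewrite mulrC; exact: (re_le_bidual H).
- move=> c x c1; have := le_reach x c1 (perturbation_id c1).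
  by have -> : adjoint id us = us by exact: blin_eq.
- move=> eta eta0; have [x x1 [hx _]] := dual_adherent H kn us eta0.
  have [w wE wn] := eval_dual x; exists w; last by rewrite wE ltW.
  by apply: le_trans wn _; rewrite -(re1 H) (re_mono H).
- by [].
- by move=> c c1; apply: reach_le => // M [cM Mc]; rewrite mul1r; exact: hu.
Qed.
End Path.

(** * Limits of norming pairs *)

Lemma wstar_closure_lim (K : numFieldType) (V : lmodType K) (p : V -> K) (A : set (dual p))
    (I : Type) (U : set_system I) (h : I -> dual p) (f : dual p) : ProperFilter U ->
  (forall i, A (h i)) -> (forall x, (fun i => h i x : K^o) @ U --> (f x : K^o)) ->
  wstar_closure A f.
Proof.
move=> UP hA hf B; rewrite nbhsE; case=> O [oO Of] OB.
move: oO => [Q oQ QO]; rewrite -QO /= in Of.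
have hc : (fun i => (h i : {ptws V -> K^o})) @ U --> (f : {ptws V -> K^o}).
  apply/cvg_sup => x.
  have sx : (fun g : V -> K^o => g x) @` setT = setT.
    by rewrite eqEsubset; split=> c // _; exists (cst c).
  apply/cvg_image => //= B' B'f; exists ((fun g : V -> K^o => g x) @^-1` B').
    exact: hf.
  exact: image_preimage.
have hQ : ((fun i => (h i : {ptws V -> K^o})) @ U) Q.
  by apply: hc; exact: open_nbhs_nbhs.
have [i hi] : exists i, Q (h i : V -> K^o) by exact: (@filter_ex _ U _ _ hQ).
by exists (h i); split; [exact: hA|apply: OB; rewrite -QO].
Qed.

Section Representation.
Context (R : realType) (K : numFieldType) (emb : {rmorphism R -> K}) (re : K -> R).
Hypothesis H : real_form emb re.
Context (X : normedModType K).
Local Notation norm := (norm_of X).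
Local Notation v := (numerical_radius X).
Local Notation kn := (kseminorm_norm X).
Local Notation kv := (kseminorm_numerical_radius H X).
Local Notation vr T := (re (v T)).
Local Notation dn f := (re (dual_norm norm f)).
Local Notation bidual := (dual (dual_norm norm)).
Local Notation id := (op_id X).
Hypothesis hn : 0 < numerical_index X.

Lemma norming_pairs_nonempty : exists fx, norming_pairs norm fx.
Proof.
have [[x x0]|X0] := pselect (exists x : X, x != 0).
  have [f f1 fx] := norming_functional H x0.
  exists (f, `|x|^-1 *: x); split=> //=.
    by rewrite /norm_of normrZ normfV normr_id mulVf ?normr_eq0.
  by rewrite (dualZ f) fx mulVf ?normr_eq0.
exfalso; suff E : [set numerical_radius X T | T in [set T : operators X | opnorm T = 1]] = set0.
  by move: hn; rewrite /numerical_index E /infimum eqxx ltxx.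
apply/seteqP; split=> // _ [T /= T1 _]; have := oner_neq0 K; rewrite -T1 => /eqP; apply.
apply/eqP; rewrite eq_le (opnorm_ge0 H kn) andbT; apply: (opnorm_le H kn) => // x.
have -> : x = 0 by apply: contrapT => /eqP x0; apply: X0; exists x.
by rewrite (blin0 T) normr0 mul0r.
Qed.

(** Indices of the functionals [T |-> l * f (T x)], which norm the numerical
    radius. *)
Definition rotated_pair := {t : K * (dual norm * X) | `|t.1| = 1 /\ norming_pairs norm t.2}.

Definition at_pair (i : rotated_pair) (T : operators X) : K :=
  (sval i).1 * (sval i).2.1 (T (sval i).2.2).

Lemma at_pairP i a S T : at_pair i (a *: S + T) = a * at_pair i S + at_pair i T.
Proof.
by rewrite /at_pair blinDE blinZE (dualP (sval i).2.1) mulrDr mulrCA.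
Qed.

Lemma at_pair_le i T : `|at_pair i T| <= v T.
Proof.
case: i => -[l fx] [/= l1 hfx]; rewrite /at_pair /= normrM l1 mul1r.
exact: (numerical_radius_le H T hfx).
Qed.

Lemma at_pair_norming T (eta : R) : 0 < eta -> exists i, vr T - eta < re (at_pair i T).
Proof.
move=> e0; apply: contrapT => hi.
have hi' fx : norming_pairs norm fx -> re `|fx.1 (T fx.2) : K| <= vr T - eta.
  move=> hfx; have [l l1 lE] := exists_rotation (fx.1 (T fx.2) : K).
  rewrite leNgt; apply/negP => h; apply: hi.
  have hl : `|l| = 1 /\ norming_pairs norm fx by [].
  by exists (exist _ (l, fx) hl); rewrite /at_pair /= lE.
have [fx0 hfx0] := norming_pairs_nonempty.
have m0 : 0 <= vr T - eta by apply: le_trans (hi' _ hfx0); exact: (rn_ge0 H).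
have [_ _ h] := numerical_radius_lub H T.
have : v T <= emb (vr T - eta).
  apply: h => [|fx hfx]; first by rewrite (emb_ge0 H).
  by rewrite (le_emb H)//; exact: hi'.
by rewrite (le_emb H) ?(ks_ge0 kv)//; lra.
Qed.

Lemma extreme_wstar : extreme_points (dual_ball v) `<=`
  wstar_closure [set phi : dual v | exists (l : K) (xs : dual norm) (x : X),
    [/\ `|l| = 1, norming_pairs norm (xs, x) & forall T, phi T = l * xs (T x)] ].
Proof.
move=> phi phiE.
have [||U [UU hU]] := extreme_ultra H kv at_pairP _ _ phiE.
- by move=> i T; apply: le_trans (re_le_norm H _) _; apply: (re_mono H); exact: at_pair_le.
- exact: at_pair_norming.
have UP : ProperFilter U by exact: ultra_proper.
have hi i : exists h : dual v, forall T, h T = at_pair i T.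
  have hF : (at_pair i : operators X -> K^o) \in bounded_linear v K^o.
    apply: (@mem_bounded_linear _ _ _ _ H _ v kv K^o _ 1); first exact: at_pairP.
    by move=> T; rewrite mul1r; apply: (re_mono H); exact: at_pair_le.
  by exists (Blin hF).
have [h hE] := choice hi.
apply: (@wstar_closure_lim _ _ _ _ _ U h _ UP).
  move=> i; case: (i) (hE i) => -[l [f x]] [/= l1 hfx] hT.
  by exists l, f, x; split.
move=> T; have := hU T; rewrite (_ : (fun i => at_pair i T : K^o) = (fun i => h i T))//.
by apply/funext => i; rewrite hE.
Qed.

Section Limit.
Context (I : Type) (U : set_system I) (UU : UltraFilter U).
Let UP : ProperFilter U. Proof. exact: ultra_proper. Qed.

Lemma cvg_zero_le (W : normedModType K) (g : I -> W) (y : W) (d : I -> K) (c : R) :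
  g @ U --> y -> (forall i, re `|d i| <= c * re `|y - g i|) ->
  (fun i => d i : K^o) @ U --> (0 : K^o).
Proof.
move=> gy dle; apply/cvgrPdist_lt => eps eps0.
have e0 : 0 < re eps by rewrite -(emb_lt H) rmorph0 -(ge0_emb H) // ltW.
have c0 : 0 < `|c| + 1 by rewrite ltr_wpDl.
have eK : 0 < emb (re eps / (`|c| + 1)).
  by rewrite -(rmorph0 emb) (emb_lt H) divr_gt0.
move: gy => /cvgrPdist_lt/(_ _ eK); apply: filterS => i.
rewrite sub0r normrN (norm_emb H (d i)) (normv_emb H) (ge0_emb H (ltW eps0)) !(emb_lt H) (reK H).
rewrite ltr_pdivlMr// => h; apply: le_lt_trans h; apply: le_trans (dle i) _.
rewrite mulrC; apply: ler_wpM2l; first exact: (re_normv_ge0 H).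
by apply: le_trans (ler_norm _) _; rewrite lerDl.
Qed.

Context (f : I -> dual norm) (x : I -> X) (pairs : forall i, norming_pairs norm (f i, x i)).
Context (us : dual norm) (u : bidual).
Hypothesis hus : forall y, (fun i => f i y : K^o) @ U --> (us y : K^o).
Hypothesis hu : forall g : dual norm, (fun i => g (x i) : K^o) @ U --> (u g : K^o).

(** A compact [S] maps [x i] to a family converging in norm to some [y], and
    then both sides are equal to [us y]. *)
Lemma compact_limit (S : operators X) : S \in compact_operator X ->
  (fun i => f i (S (x i)) : K^o) @ U --> (u (adjoint S us) : K^o).
Proof.
move=> /compact_opP[A cA AS].
have [i|y _ Sy] := @ultra_compact _ _ U (fun i => S (x i)) A UU cA.
  by apply: AS; have [_ /= h _] := pairs i; rewrite -[`|x i|]/(norm (x i)) h.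
have dnf i : dn (f i) = 1 by have [/= -> _ _] := pairs i; rewrite (re1 H).
have h1 : (fun i => f i (S (x i) - y) : K^o) @ U --> (0 : K^o).
  apply: (@cvg_zero_le _ _ _ _ 1 Sy) => i.
  by rewrite -[1](dnf i) -normrN opprB; exact: (re_le_opnorm H kn).
have h2 : (fun i => us (S (x i) - y) : K^o) @ U --> (0 : K^o).
  apply: (@cvg_zero_le _ _ _ _ (dn us) Sy) => i.
  by rewrite -normrN opprB; exact: (re_le_opnorm H kn).
have -> : u (adjoint S us) = us y.
  have h3 : (fun i => us (S (x i) - y) + us y : K^o) @ U --> (0 + us y : K^o).
    by apply: cvgD => //; exact: cvg_cst.
  have h4 : (fun i => adjoint S us (x i) : K^o) @ U --> (us y : K^o).
    rewrite add0r in h3.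
    rewrite (_ : (fun i => _) = (fun i => us (S (x i) - y) + us y : K^o))//.
    by apply/funext => i; rewrite (blinB us) subrK.
  have h5 : (fun i => adjoint S us (x i) : K^o) @ U --> (u (adjoint S us) : K^o).
    exact: hu.
  exact: (@cvg_unique K^o (@norm_hausdorff _ K^o) _ _ _ _ h5 h4).
have h3 : (fun i => f i (S (x i) - y) + f i y : K^o) @ U --> (0 + us y : K^o).
  by apply: cvgD => //; exact: hus.
rewrite add0r in h3; rewrite (_ : (fun i => _) = (fun i => f i (S (x i) - y) + f i y : K^o))//.
by apply/funext => i; rewrite (blinB (f i)) subrK.
Qed.

(** [compact_limit] for [S = M - 1]: the values [f i (M (x i))] are at most [c], and
    those of [f i (x i)] are 1. *)
Lemma limit_pair_le (M : operators X) (c : R) : M - id \in compact_operator X ->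
  (forall y, re `|M y| <= c * re `|y|) -> re (u (adjoint M us)) <= re (u us) + (c - 1).
Proof.
move=> cM Mc; have := compact_limit cM.
have -> : adjoint (M - id) us = adjoint M us - us.
  by apply: blin_eq => y; rewrite [LHS](blinB us).
move=> /(@lim_re_le _ _ _ _ H) h.
suff : re (u (adjoint M us - us)) <= c - 1 by rewrite (blinB u) (reB H); lra.
apply: h => i; have [/= f1 x1 fx] := pairs i.
have -> : f i ((M - id) (x i)) = f i (M (x i)) - 1.
  by rewrite -[LHS]/(f i (M (x i) - x i)) (blinB (f i)) fx.
rewrite (reB H) (re1 H) lerD2r.
apply: le_trans (re_le_norm H _) _; apply: le_trans (re_le_opnorm H kn (f i) _) _.
rewrite [opnorm _]f1 (re1 H) mul1r; apply: le_trans (Mc _) _.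
by rewrite -[`|x i|]/(norm (x i)) x1 (re1 H) mulr1.
Qed.
End Limit.
End Representation.

(** * The two representations *)

Section Compact.
Context (R : realType) (K : numFieldType) (emb : {rmorphism R -> K}) (re : K -> R).
Hypothesis H : real_form emb re.
Context (X : normedModType K).
Local Notation norm := (norm_of X).
Local Notation v := (numerical_radius X).
Local Notation vc := (numerical_radius_compact X).
Local Notation kn := (kseminorm_norm X).
Local Notation kdn := (kseminorm_dual H kn).
Local Notation kv := (kseminorm_numerical_radius H X).
Local Notation kc := (kseminorm_compact H X).
Local Notation vr T := (re (v T)).
Local Notation dn f := (re (dual_norm norm f)).
Local Notation bidual := (dual (dual_norm norm)).
Local Notation ddn w := (re (dual_norm (dual_norm norm) w)).
Hypothesis hn : 0 < numerical_index X.

(** The hypothesis says that [u] and [us] form a norming pair once normalized, so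
    [pair_numerical_le] applies. *)
Lemma adjoint_radius_le (u : bidual) (us : dual norm) (T : operators X) :
  ddn u * dn us <= re (u us) -> re `|u (adjoint T us) : K| <= ddn u * dn us * vr T.
Proof.
move=> hu; have kdd := kseminorm_dual H kdn.
have u0 : 0 <= ddn u by exact: (re_opnorm_ge0 H kdn).
have us0 : 0 <= dn us by exact: (re_opnorm_ge0 H kn).
have [l l1 lE] := exists_rotation (u (adjoint T us) : K).
have lT : u (adjoint (l *: T) us) = l * u (adjoint T us).
  rewrite -dualZ; congr (u _); apply: blin_eq => x.
  by rewrite [LHS](blinZ us).
have vlT : vr (l *: T) = vr T by rewrite (ksZ kv) l1 mul1r.
rewrite -lE -lT -vlT; move: {l l1 lE lT vlT T}(l *: T) => T.
move: u0; rewrite le_eqVlt => /predU1P[u0|u0].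
  by apply: le_trans (re_le_bidual H _ _) _; rewrite -u0 !mul0r.
move: us0; rewrite le_eqVlt => /predU1P[us0|us0].
  apply: le_trans (re_le_bidual H _ _) _; rewrite -us0 mulr0 mul0r.
  rewrite pmulr_rle0//.
  have := adjoint_norm_le H us (re_opnorm_ge0 H kn T) (re_operator_le H T).
  by rewrite -us0 mulr0.
pose w : bidual := emb (ddn u)^-1 *: u; pose f : dual norm := emb (dn us)^-1 *: us.
have w1 : ddn w = 1.
  rewrite (ksZ kdd) (reM_ge0 H)// (rn_emb H) ger0_norm ?invr_ge0 ?(ltW u0)//.
  by rewrite mulVf// gt_eqF.
have f1 : dn f = 1.
  rewrite (ksZ kdn) (reM_ge0 H)// (rn_emb H) ger0_norm ?invr_ge0 ?(ltW us0)//.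
  by rewrite mulVf// gt_eqF.
have wE (g : dual norm) : re (w g) = (ddn u)^-1 * re (u g) by rewrite dualZE (reM H).
have wf : 1 <= re (w f).
  rewrite wE [u f](dualZ u) (reM H) ler_pdivlMl// mulr1 ler_pdivlMl//.
  by rewrite mulrC.
have := pair_numerical_le H T (_ : ddn w <= 1) (_ : dn f <= 1) wf.
rewrite w1 f1 => /(_ (lexx _) (lexx _)); rewrite wE.
have -> : adjoint T f = emb (dn us)^-1 *: adjoint T us by exact: blin_eq.
rewrite (dualZ u) (reM H) ler_pdivrMl// ler_pdivrMl//.
by rewrite mulrA [dn us * _]mulrC.
Qed.

(** If [s < 1], then [f] is the midpoint of [(2 - s) *: f] and [s *: f], both in the
    ball, so [f = 0]; but 0 is the midpoint of [g] and [- g]. *)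
Lemma extreme_norm_ge1 (V : lmodType K) (p : V -> K) (hp : kseminorm p) (f g : dual p) (s : R) :
  extreme_points (dual_ball p) f -> re (dual_norm p f) <= s -> 0 <= s ->
  g != 0 -> re (dual_norm p g) <= 1 -> 1 <= s.
Proof.
move=> [fb fext] fs s0 g0 g1; rewrite leNgt; apply/negP => s1.
have kd := kseminorm_dual H hp.
have half : 0 < (emb (1 / 2) : K) < 1.
  by rewrite -(rmorph0 emb) -(rmorph1 emb) !(emb_lt H); apply/andP; split; lra.
have ballP (h : dual p) : re (dual_norm p h) <= 1 -> dual_ball p h.
  by move=> h1; rewrite /dual_ball /= -(rmorph1 emb) (le_emb H)// (dual_norm_ge0 H hp).
have mid (h : dual p) : re (dual_norm p (f + h)) <= 1 -> re (dual_norm p (f - h)) <= 1 ->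
    h = 0.
  move=> /ballP h1 /ballP h2; have [|+ _] := fext (emb (1 / 2)) _ _ h1 h2 half.
    have -> : 1 - emb (1 / 2) = emb (1 / 2) :> K.
      by rewrite -(rmorph1 emb) -rmorphB; congr (emb _); lra.
    rewrite -scalerDr addrACA subrr addr0 scalerDr -scalerDl -rmorphD.
    by rewrite (_ : 1 / 2 + 1 / 2 = 1) ?rmorph1 ?scale1r//; lra.
  by rewrite -[X in _ = X -> _]addr0 => /addrI.
have f0 : f = 0.
  have h : emb (1 - s) *: f = 0.
    have nZ (c : R) : 0 <= c -> re (dual_norm p (emb c *: f)) = c * re (dual_norm p f).
      by move=> c0; rewrite (ksZ kd) (reM_ge0 H)// (rn_emb H) ger0_norm.
    have n0 : 0 <= re (dual_norm p f) by exact: (re_opnorm_ge0 H hp).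
    apply: mid.
      have -> : f + emb (1 - s) *: f = emb (2 - s) *: f.
        by rewrite -{1}[f]scale1r -scalerDl -(rmorph1 emb) -rmorphD; congr (emb _ *: _); lra.
      rewrite nZ; [nra|lra].
    have -> : f - emb (1 - s) *: f = emb s *: f.
      by rewrite -{1}[f]scale1r -scalerBl -(rmorph1 emb) -rmorphB; congr (emb _ *: _); lra.
    rewrite nZ//; nra.
  have es : emb (1 - s) != 0 :> K by rewrite fmorph_eq0 subr_eq0 gt_eqF.
  by apply/eqP; move/eqP: h; rewrite scaler_eq0 (negbTE es).
move/eqP: g0; apply; apply: mid; rewrite f0 ?add0r//.
by rewrite (ksN _ kd).
Qed.

Context (P : {linear dual v -> dual v}).
Hypothesis PP : forall f, P (P f) = P f.
Hypothesis P_ann : [set f | P f = 0] = annihilator v [set T | T \in compact_operator X].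
Hypothesis P_norm : forall f, dual_norm v f = dual_norm v (P f) + dual_norm v (f - P f).

Lemma extreme_compact : extreme_points (dual_ball vc) `<=`
  [set phi : dual vc | exists (l : K) (xss : bidual) (xs : dual norm),
    [/\ `|l| = 1, norming_pairs (dual_norm norm) (xss, xs) &
        forall S : compact_operators X, phi S = l * xss (adjoint S xs)] ].
Proof.
move=> phi phiE.
pose a (i : rotated_pair X) (S : compact_operators X) : K := at_pair i S.
have [|||U [UU hU]] := @extreme_ultra R K emb re H _ vc kc (rotated_pair X) a _ _ _ phi phiE.
- by move=> i c S T; exact: at_pairP.
- by move=> i S; apply: le_trans (re_le_norm H _) _; apply: (re_mono H); exact: (at_pair_le H).
- by move=> S eta; exact: (at_pair_norming H hn S).
have UP : ProperFilter U by exact: ultra_proper.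
pose f (i : rotated_pair X) : dual norm := (sval i).2.1.
pose x (i : rotated_pair X) : X := (sval i).2.2.
pose l (i : rotated_pair X) : K := (sval i).1.
have l1 i : `|l i| = 1 by have [] := svalP i.
have pairs i : norming_pairs norm (f i, x i).
  by have [_] := svalP i; rewrite /f /x; case: (sval i).2.
have [l0 hl0] : exists l0 : K, (fun i => l i : K^o) @ U --> (l0 : K^o).
  have [A cA hA] := disc_compact H (1 : K^o) 1.
  have [i|y _ gy] := @ultra_compact _ _ U (fun i => l i : K^o) A UU cA; last by exists y.
  by rewrite -[l i]mulr1; apply: hA; rewrite l1 (re1 H).
have l01 : `|l0| = 1.
  rewrite (norm_emb H) -[RHS](rmorph1 emb); congr (emb _); apply/eqP; rewrite eq_le.
  apply/andP; split; apply/ler_addgt0Pl => eta e0.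
    have [i hi] := lim_adherent H UP hl0 e0.
    have := rnD H (l0 - l i) (l i); rewrite subrK l1 (re1 H) => h.
    by apply: le_trans h _; rewrite lerD2r ltW.
  have [i hi] := lim_adherent H UP hl0 e0.
  have := rnD H (l i - l0) l0; rewrite subrK l1 (re1 H) => h.
  by apply: le_trans h _; rewrite lerD2r -normrN opprB ltW.
have fle i y : `|f i y : K| <= norm y.
  by apply: le_trans (le_dual_norm H kn _ _) _; have [/= -> _ _] := pairs i; rewrite mul1r.
have xle i (g : dual norm) : `|g (x i) : K| <= dual_norm norm g.
  apply: le_trans (le_dual_norm H kn g _) _.
  by have [/= _ -> _] := pairs i; rewrite mulr1.
have [us hus us1] := ultra_dual H kn UU (fun i => dualP (f i)) fle.
have [u hu u1] := @ultra_dual R K emb re H (dual norm) (dual_norm norm) kdn _ U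
  (fun i g => g (x i)) UU (fun i c g h => erefl) xle.
have nu : dn us * ddn u <= re (u us).
  apply: (ideal_norming H hn PP P_ann P_norm) => M cM c _ Mc.
  exact: (limit_pair_le H UU pairs hus hu cM Mc).
have phiS S : phi S = l0 * u (adjoint S us).
  have h1 := compact_limit H UU pairs hus hu (compact_valP S).
  have h2 : (fun i => a i S : K^o) @ U --> (l0 * u (adjoint S us) : K^o).
    exact: (cvgM hl0 h1).
  exact: (@cvg_unique K^o (@norm_hausdorff _ K^o) _ _ _ _ (hU S) h2).
rewrite mulrC in nu.
have u0 : 0 <= ddn u by exact: (re_opnorm_ge0 H kdn).
have us0 : 0 <= dn us by exact: (re_opnorm_ge0 H kn).
(* The functional [S |-> fx.1 (S fx.2)] does not vanish at the rank-one operator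
   built from the same pair. *)
have s1 : 1 <= ddn u * dn us.
  have [fx hfx] := norming_pairs_nonempty H hn.
  have [fx1 fx2 fx3] := hfx.
  have gP : ((fun S : compact_operators X => fx.1 ((S : operators X) fx.2) : K^o) : _ -> K^o)
      \in bounded_linear vc K^o.
    apply: (@mem_bounded_linear _ _ _ _ H _ vc kc K^o _ 1).
      move=> c S T; rewrite -(dualP fx.1).
      by rewrite -[LHS]/(fx.1 (c *: (S : operators X) fx.2 + (T : operators X) fx.2)).
    by move=> S; rewrite mul1r; apply: (re_mono H); exact: (numerical_radius_le H S hfx).
  apply: (@extreme_norm_ge1 _ vc kc phi (Blin gP : dual vc)) => //.
  - apply: (re_opnorm_le H kc) => [|S]; first exact: mulr_ge0.
    rewrite phiS normrM l01 mul1r; exact: adjoint_radius_le.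
  - exact: mulr_ge0.
  - apply/eqP => /(congr1 (fun g : dual vc => g (CompactOperator (compact_rank_one H fx.1 fx.2)))).
    rewrite -[LHS]/(fx.1 ((fx.1 fx.2 : K) *: fx.2)) (dualZ fx.1) fx3 mulr1 => /eqP.
    by rewrite oner_eq0.
  - apply: (re_opnorm_le H kc) => // S; rewrite mul1r.
    by apply: (re_mono H); exact: (numerical_radius_le H S hfx).
have us1' : dn us = 1.
  apply/eqP; rewrite eq_le us1/=; apply: le_trans s1 _.
  by rewrite -[leRHS]mul1r; apply: ler_wpM2r.
have u1' : ddn u = 1.
  apply/eqP; rewrite eq_le u1/=; apply: le_trans s1 _.
  by rewrite us1' mulr1.
have [r r1 rE] := exists_rotation (u us : K).
have uus : `|u us : K| = 1.
  rewrite (norm_emb H) -[RHS](rmorph1 emb); congr (emb _); apply/eqP; rewrite eq_le.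
  rewrite (le_trans (le_bidual H u us)) ?u1' ?us1' ?mulr1//=.
  by apply: le_trans (re_le_norm H _); apply: le_trans nu; rewrite u1' us1' mulr1.
have r0 : r != 0 by rewrite -normr_eq0 r1 oner_neq0.
(* A rotation is moved from [l0] to [u] to make the value at [us] equal to 1. *)
exists (l0 / r), (r *: u), us; split.
- by rewrite normf_div l01 r1 divr1.
- split=> /=.
  + rewrite (ksZ (kseminorm_dual H kdn)) r1 mul1r.
    by rewrite [LHS](opnormE H kdn) [re _]u1' rmorph1.
  + by rewrite [LHS](opnormE H kn) [re _]us1' rmorph1.
  + by rewrite -[LHS]/(r * u us) rE uus.
- by move=> S; rewrite phiS -[(r *: u) _]/(r * u (adjoint S us)) mulrA divfK.
Qed.
End Compact.

Lemma real_or_complex_real_form (K : numFieldType) : real_or_complex K ->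
  exists (R : realType) (emb : {rmorphism R -> K}) (re : K -> R), real_form emb re.
Proof.
case=> R; first by exists R, (idfun : {rmorphism R -> R}), id; exact: real_form_real.
exists R, (real_complex R : {rmorphism R -> R[i]}), (@complex.Re R).
exact: real_form_complex.
Qed.

Theorem proposition2p16 (K : numFieldType) (hK : real_or_complex K)
    (X : completeNormedModType K) (hn : 0 < numerical_index X)
    (hM : M_ideal (numerical_radius X)
            [set T : operators X | T \in compact_operator X]) :
  extreme_points (dual_ball (numerical_radius X)) `<=`
    wstar_closure
      [set phi : dual (numerical_radius X) |
        exists (lambda : K) (xs : dual (norm_of X)) (x : X),
          [/\ `|lambda| = 1, norming_pairs (norm_of X) (xs, x) &
              forall T : operators X, phi T = lambda * xs (T x)] ]
  /\
  extreme_points (dual_ball (numerical_radius_compact X)) `<=`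
    [set phi : dual (numerical_radius_compact X) |
      exists (lambda : K) (xss : dual (dual_norm (norm_of X)))
             (xs : dual (norm_of X)),
        [/\ `|lambda| = 1,
            norming_pairs (dual_norm (norm_of X)) (xss, xs) &
            forall S : compact_operators X,
              phi S = lambda * xss (adjoint S xs)] ].
Proof.
have [R [emb [re H]]] := real_or_complex_real_form hK.
have [_ _ [P [PP P_ann P_norm]]] := hM; split.
  exact: (extreme_wstar H hn).
exact: (extreme_compact H hn PP P_ann P_norm).
Qed.
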